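(* Let $\{X_{ij} : j\ge i\ge 1\}$ be a collection of i.i.d. real random variables with $\mathbb{E}X_{12}=0$, $\mathrm{Var}(X_{12})=1$ and $\mathbb{E}X_{12}^4<\infty$, and let $\mathbf{M}_n$ be the associated $n\times n$ symmetric Markov matrix. Then $$\lim_{n\to\infty}\frac{\|\mathbf{M}_n\|}{\sqrt{2n\log n}}=1\qquad\text{almost surely.}$$
   Context: Markov matrix: put $X_{ji}=X_{ij}$ for $j>i\ge1$, $\mathbf{X}_n=[X_{ij}]_{1\le i,j\le n}$, $\mathbf{D}_n=\mathrm{diag}\big(\sum_{j=1}^nX_{ij}\big)_{1\le i\le n}$ and $\mathbf{M}_n=\mathbf{X}_n-\mathbf{D}_n$; thus each row of $\mathbf{M}_n$ sums to zero (and the values $X_{ii}$ are irrelevant). $\|\mathbf{M}_n\|$ is the spectral norm, i.e. the largest absolute value of the eigenvalues of the symmetric matrix $\mathbf{M}_n$. *)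

(* Defs.v *)
From HB Require Import structures.
From mathcomp Require Import all_boot all_order all_algebra finmap.
From mathcomp Require Import all_classical all_reals all_analysis.

Set Implicit Arguments.
Unset Strict Implicit.
Unset Printing Implicit Defensive.

Import Order.TTheory GRing.Theory Num.Theory.
Import numFieldNormedType.Exports.

Local Open Scope classical_set_scope.
Local Open Scope ring_scope.

Section iid.
Context (d : measure_display) (T : measurableType d) (R : realType)
  (P : probability T R) (I : choiceType).
Implicit Types (D : set I) (X : I -> {RV P >-> R}).

(* Mutual independence: the product rule over every finite subfamily of D. *)
Definition independent_RVs D X : Prop :=
  forall (J : {fset I}) (A : I -> set R),
    [set` J] `<=` D ->
    (forall i, i \in J -> measurable (A i)) ->
    P (\bigcap_(i in [set` J]) (X i @^-1` A i)) =
      (\prod_(i <- J) P (X i @^-1` A i))%E.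

Definition identically_distributed D X : Prop :=
  forall i j, D i -> D j -> forall A : set R, measurable A ->
    distribution P (X i) A = distribution P (X j) A.

Definition iid D X : Prop :=
  independent_RVs D X /\ identically_distributed D X.

End iid.

Section markov.
Context (R : realType).

(* Indices start at 0, so x i j stands for the entry X_{i+1,j+1}; only the
   values x i j with i <= j are used. *)
Definition symmetric_mx (x : nat -> nat -> R) (n : nat) : 'M[R]_n :=
  \matrix_(i < n, j < n) if (i <= j)%N then x i j else x j i.

Definition markov_mx (x : nat -> nat -> R) (n : nat) : 'M[R]_n :=
  symmetric_mx x n - diag_mx (\row_(i < n) \sum_(j < n) symmetric_mx x n i j).

(* Intended for symmetric A, whose eigenvalues are all real. If n > 0 the set
   is then finite and nonempty, so the supremum is a maximum. *)
Definition spectral_norm (n : nat) (A : 'M[R]_n) : R :=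
  sup [set `|a| | a in [set a : R | eigenvalue A a]].

End markov.

(* Main.v *)
Require Import Defs.
From mathcomp Require Import all_boot all_order all_algebra finmap.
From mathcomp Require Import all_classical all_reals all_analysis.
From mathcomp Require Import measurable_realfun.
From mathcomp Require Import ring lra.

Set Implicit Arguments.
Unset Strict Implicit.
Unset Printing Implicit Defensive.

Import Order.TTheory GRing.Theory Num.Theory.
Import numFieldNormedType.Exports.

Local Open Scope classical_set_scope.
Local Open Scope ring_scope.

(** The diagonal of M_n dominates: truncating the entries at sqrt n, the row sums
    have Gaussian exponential moments at the scale sqrt (log n / n). Chernoff
    bounds then give max_i |row sum| <= (1 + o(1)) sqrt (2 n log n) along n = k^p,
    the gaps being filled by bounds on short partial row sums. Tilting gives the
    matching lower bound, since the parts of the first n / K rows that lie beyond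
    column n / K are independent. A diagonal entry of M_n is at most its norm.

    For the off-diagonal part it suffices that its norm is o(sqrt (n log n)). Let
    A be the sum of u_k^T u_k over the strictly upper triangular columns u_k, which
    are independent and eventually satisfy |u_k|^2 <= b = 8 n. For S >= 0 one has
    u (S + u^T u)^p u^T <= u (S + b)^p u^T when |u|^2 <= b. Averaging over u_k
    turns this into E tr A^(p+1) <= n sum_c C(p, c) b^c E tr A^(p-c), the recursion
    of Poisson moments, and p of order log n yields |A| = o(n log n). *)

(** * Quadratic forms and the spectral norm *)

(** With four moments only, exponential moments exist after truncation but need not exist before it.
    The fourth moment makes the sum of n P(X^2 > n) finite, so almost surely truncation at sqrt n
    eventually changes no entry. At the tilt s = c sqrt(log n / n) a truncated entry contributes at
    most c sqrt(log n) to the exponent; its exponential is n^o(1), and the third-order error is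
    negligible against s^2.

    A union over n rows against tails n^(-1-e) leaves n^(-e), which need not be summable: this
    forces the passage to n = k^p with e p >= 2. In the lower bound, the rows i and j share the
    entry X_ij. Cutting the first n / K columns from the first n / K rows removes every shared entry
    and costs only a fraction 1 / K of the variance.

    Since |A| only has to be o(n log n), a recursion that uses just the covariance of a column, its
    independence from the others and its length can replace any counting of paths. Diagonalisation
    is avoided throughout: moments u S^j u^T and Cauchy-Schwarz take the place of spectral
    measures. *)

Section log_convex.
Variables (R : realFieldType) (s : nat -> R).
Hypotheses (s_ge0 : forall j, 0 <= s j)
  (s_cvx : forall j, s j.+1 ^+ 2 <= s j * s j.+2).

(** Log-convexity says that the ratios [s k.+1 / s k] increase. Denominators are cleared because
    terms may vanish, and a zero term forces the next one to vanish. *)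
Lemma log_convex_step i j : s i.+1 * s (i + j) <= s i * s (i + j).+1.
Proof.
elim: j => [|j IH]; first by rewrite addn0 mulrC.
rewrite addnS; set k := (i + j)%N in IH *.
have := s_ge0 k; rewrite le_eqVlt => /orP[/eqP sk0|sk].
  have -> : s k.+1 = 0.
    by apply/eqP; rewrite -sqrf_eq0 eq_le sqr_ge0 andbT
      (le_trans (s_cvx k))// -sk0 mul0r.
  by rewrite mulr0 mulr_ge0.
rewrite -(ler_pM2l sk) mulrA.
have h1 : s k * s i.+1 * s k.+1 <= s i * s k.+1 ^+ 2.
  by rewrite [s k * _]mulrC expr2 mulrA ler_wpM2r.
by rewrite (le_trans h1)// [leRHS]mulrCA ler_wpM2l.
Qed.

Lemma log_convex_mul i j : s i * s j <= s 0%N * s (i + j)%N.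
Proof.
elim: i j => [|i IH] j //.
have := s_ge0 i; rewrite le_eqVlt => /orP[/eqP si0|si].
  have -> : s i.+1 = 0.
    by apply/eqP; rewrite -sqrf_eq0 eq_le sqr_ge0 andbT
      (le_trans (s_cvx i))// -si0 mul0r.
  by rewrite mul0r mulr_ge0.
rewrite -(ler_pM2l si) addSn mulrA [s i * s i.+1]mulrC -mulrA.
apply: (@le_trans _ _ (s i.+1 * (s 0%N * s (i + j)%N))); first by rewrite ler_wpM2l.
by rewrite mulrCA [leRHS]mulrCA ler_wpM2l// log_convex_step.
Qed.
End log_convex.

(** * Positive semidefinite forms: moments, words and traces of powers *)

Section psd.
Variables (R : realFieldType) (n : nat).
Implicit Types (S Q : 'M[R]_n) (u v : 'rV[R]_n).

(** Vectors are rows, as in [eigenvalue]; [bil v 1 v] is the squared Euclidean length. *)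
Definition bil u S v : R := (u *m S *m v^T) 0 0.

Definition psd S : Prop := S^T = S /\ forall v, 0 <= bil v S v.

Lemma bilE u S v : bil u S v = \sum_j \sum_i u 0 i * S i j * v 0 j.
Proof.
by rewrite /bil mxE; apply: eq_bigr => j _; rewrite !mxE mulr_suml.
Qed.

Lemma bilDl u1 u2 S v : bil (u1 + u2) S v = bil u1 S v + bil u2 S v.
Proof. by rewrite /bil !mulmxDl mxE. Qed.

Lemma bilDr u S v1 v2 : bil u S (v1 + v2) = bil u S v1 + bil u S v2.
Proof. by rewrite /bil linearD/= mulmxDr mxE. Qed.

Lemma bilZl c u S v : bil (c *: u) S v = c * bil u S v.
Proof. by rewrite /bil -!scalemxAl mxE. Qed.

Lemma bilZr c u S v : bil u S (c *: v) = c * bil u S v.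
Proof. by rewrite /bil linearZ/= -scalemxAr mxE. Qed.

Lemma bilDm u S Q v : bil u (S + Q) v = bil u S v + bil u Q v.
Proof. by rewrite /bil mulmxDr mulmxDl mxE. Qed.

Lemma bilZm u c S v : bil u (c *: S) v = c * bil u S v.
Proof. by rewrite /bil -scalemxAr -scalemxAl mxE. Qed.

Lemma bilM u S Q v : bil u (S *m Q) v = bil (u *m S) Q v.
Proof. by rewrite /bil !mulmxA. Qed.

Lemma bil_tr u S v : bil u S^T v = bil v S u.
Proof.
rewrite /bil -[v *m S *m u^T]trmxK [RHS]mxE.
by rewrite !trmx_mul !trmxK mulmxA.
Qed.

Lemma bilMr u S Q v : bil u (S *m Q) v = bil u S (v *m Q^T).
Proof. by rewrite /bil trmx_mul trmxK !mulmxA. Qed.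

Lemma psd_cauchy_schwarz Q u v : psd Q ->
  bil u Q v ^+ 2 <= bil u Q u * bil v Q v.
Proof.
move=> [Qs Qp]; set a := bil u Q u; set b := bil u Q v; set c := bil v Q v.
have h t : 0 <= a + 2 * t * b + t ^+ 2 * c.
  have := Qp (u + t *: v).
  rewrite !bilDl !bilDr !bilZl !bilZr -/a -/b -/c.
  have -> : bil v Q u = b by rewrite -bil_tr Qs.
  by rewrite (_ : _ + _ = a + 2 * t * b + t ^+ 2 * c) //; ring.
have c0 : 0 <= c by exact: Qp.
move: c0; rewrite le_eqVlt => /orP[/eqP c0|c0].
  rewrite -c0 mulr0.
  have [->|bn0] := eqVneq b 0; first by rewrite expr0n.
  (* For c = 0 and b != 0 the polynomial is affine in t, and this t gives it the value -1. *)
  have := h (- (a + 1) / (2 * b)); rewrite -c0 mulr0 addr0.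
  have -> : a + 2 * (- (a + 1) / (2 * b)) * b = -1 by field.
  by rewrite ler0N1.
have := h (- b / c).
have -> : a + 2 * (- b / c) * b + (- b / c) ^+ 2 * c = (a * c - b ^+ 2) / c.
  by field; rewrite gt_eqF.
by rewrite pmulr_lge0 ?invr_gt0// subr_ge0.
Qed.

Lemma tr_exp S j : S^T = S -> (S ^+ j)^T = S ^+ j.
Proof.
move=> Ss; elim: j => [|j IH]; first by rewrite expr0 trmx1.
by rewrite {1}exprS exprSr trmx_mul IH Ss.
Qed.

Lemma bil1_ge0 v : 0 <= bil v 1 v.
Proof.
by rewrite /bil mulmx1 mxE sumr_ge0// => i _; rewrite mxE -expr2 sqr_ge0.
Qed.

(** The form of S^(j+2) at v is the form of S^j at v S, so the induction goes in steps of two and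
    needs no square root of S. *)
Lemma psd_exp S j : psd S -> psd (S ^+ j).
Proof.
move=> [Ss Sp]; split; first exact: tr_exp.
suff: (forall v, 0 <= bil v (S ^+ j) v) /\ (forall v, 0 <= bil v (S ^+ j.+1) v).
  by case.
elim: j => [|j [IH1 IH2]]; first by split=> v; rewrite ?expr1// expr0 bil1_ge0.
split=> // v.
by rewrite exprS exprSr -mulmxE bilM mulmxE -mulmxE bilMr Ss.
Qed.

Lemma psd_add S Q : psd S -> psd Q -> psd (S + Q).
Proof.
move=> [S1 S2] [Q1 Q2]; split; first by rewrite linearD/= S1 Q1.
by move=> v; rewrite bilDm addr_ge0.
Qed.

Lemma psd0 : psd 0.
Proof. by split=> [|v]; rewrite ?trmx0// /bil mulmx0 mul0mx mxE. Qed.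

Lemma psd_sum (I : Type) (r : seq I) (p : pred I) (F : I -> 'M[R]_n) :
  (forall i, p i -> psd (F i)) -> psd (\sum_(i <- r | p i) F i).
Proof. by move=> h; apply: big_ind => //; [exact: psd0|exact: psd_add]. Qed.

Lemma psd_scalar b : 0 <= b -> psd b%:M.
Proof.
move=> b0; split; first by rewrite tr_scalar_mx.
by move=> v; rewrite -[b%:M]mulmx1 mul_scalar_mx bilZm mulr_ge0// bil1_ge0.
Qed.

Lemma bil_rank1 u v w : bil v (u^T *m u) w = (v *m u^T) 0 0 * (u *m w^T) 0 0.
Proof.
by rewrite /bil mulmxA -mulmxA [v *m _]mx11_scalar mul_scalar_mx !mxE eqxx mulr1n.
Qed.

Lemma psd_rank1 u : psd (u^T *m u).
Proof.
split; first by rewrite trmx_mul trmxK.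
move=> v; rewrite bil_rank1.
rewrite (_ : (v *m u^T) 0 0 = (u *m v^T) 0 0) -?expr2 ?sqr_ge0//.
by rewrite -[v *m u^T]trmxK [LHS]mxE trmx_mul trmxK.
Qed.

(** Cauchy-Schwarz for the form of S^j at u and u S makes the moments u S^j u^T log-convex. This is
    Chebyshev's correlation inequality for the spectral measure of S at u, obtained without that
    measure. *)
Lemma psd_moments u S i j : psd S ->
  bil u (S ^+ i) u * bil u (S ^+ j) u <= bil u 1 u * bil u (S ^+ (i + j)) u.
Proof.
move=> Sp; rewrite -(expr0 S).
apply: (@log_convex_mul _ (fun j => bil u (S ^+ j) u)) => {i} {}j.
  by case: (psd_exp j Sp).
have := psd_cauchy_schwarz u (u *m S) (psd_exp j Sp).
have [Ss _] := Sp.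
have e x : bil x (S ^+ j) (u *m S) = bil x (S ^+ j.+1) u.
  by rewrite exprSr -mulmxE bilMr Ss.
by rewrite !e -bilM mulmxE -exprS.
Qed.

(* Each occurrence of u^T u splits the word u S^a (S + u^T u)^i u^T in two. *)
Lemma word_rec u S a i :
  bil u (S ^+ a * (S + u^T *m u) ^+ i.+1) u =
  bil u (S ^+ a.+1 * (S + u^T *m u) ^+ i) u +
  bil u (S ^+ a) u * bil u ((S + u^T *m u) ^+ i) u.
Proof.
set A := S + _.
rewrite exprS mulrA {1}/A mulrDr mulrDl bilDm -exprSr; congr (_ + _).
by rewrite -!mulmxE bilM !mulmxA [u *m _ *m u^T]mx11_scalar mul_scalar_mx bilZl.
Qed.

Lemma word_ge0 u S a i : psd S -> 0 <= bil u (S ^+ a * (S + u^T *m u) ^+ i) u.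
Proof.
move=> Sp; elim: i a => [|i IH] a.
  by rewrite expr0 mulr1; case: (psd_exp a Sp).
rewrite word_rec addr_ge0// mulr_ge0//; first by case: (psd_exp a Sp).
by have := IH 0%N; rewrite expr0 mul1r.
Qed.

Let shifted_rec u S b a i :
  bil u (S ^+ a * (S + b%:M) ^+ i.+1) u =
  bil u (S ^+ a.+1 * (S + b%:M) ^+ i) u + b * bil u (S ^+ a * (S + b%:M) ^+ i) u.
Proof.
rewrite exprS mulrA mulrDr mulrDl bilDm -exprSr; congr (_ + _).
by rewrite -!mulmxE scalar_mxC mul_scalar_mx -scalemxAl bilZm.
Qed.

Let shifted_ge0 u S b a i : psd S -> 0 <= b ->
  0 <= bil u (S ^+ a * (S + b%:M) ^+ i) u.
Proof.
move=> Sp b0; elim: i a => [|i IH] a.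
  by rewrite expr0 mulr1; case: (psd_exp a Sp).
by rewrite shifted_rec addr_ge0// mulr_ge0.
Qed.

(** The expansion of (S + b)^i has nonnegative coefficients, so [psd_moments] carries over to it. *)
Let shifted_moments u S b a a' i : psd S -> 0 <= b ->
  bil u (S ^+ a) u * bil u (S ^+ a' * (S + b%:M) ^+ i) u <=
  bil u 1 u * bil u (S ^+ (a + a') * (S + b%:M) ^+ i) u.
Proof.
move=> Sp b0; elim: i a' => [|i IH] a'.
  by rewrite !expr0 !mulr1 psd_moments.
rewrite !shifted_rec !mulrDr lerD//; first by rewrite -addnS IH.
by rewrite mulrCA [leRHS]mulrCA ler_wpM2l.
Qed.

(** The prefix S^a is what makes the induction on i close. Splitting off one factor u^T u yields the
    product of u S^a u^T with a shorter word. The induction hypothesis with empty prefix and the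
    moment inequality bound this by |u|^2 times the shifted form with prefix S^a, and |u|^2 <= b
    turns it into the scalar term of (S + b)^(i+1). *)
Lemma word_le u S b a i : psd S -> bil u 1 u <= b ->
  bil u (S ^+ a * (S + u^T *m u) ^+ i) u <= bil u (S ^+ a * (S + b%:M) ^+ i) u.
Proof.
move=> Sp ub; have b0 : 0 <= b by rewrite (le_trans _ ub)// bil1_ge0.
elim: i a => [|i IH] a; first by rewrite !expr0.
rewrite word_rec shifted_rec lerD//.
have := IH 0%N; rewrite expr0 !mul1r => h.
have Sa : 0 <= bil u (S ^+ a) u by case: (psd_exp a Sp).
rewrite (le_trans (ler_wpM2l Sa h))//.
have := @shifted_moments u S b a 0%N i Sp b0; rewrite expr0 mul1r addn0.
move=> /le_trans; apply; rewrite ler_wpM2r//.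
exact: shifted_ge0.
Qed.

Lemma psd_shift S b : psd S -> 0 <= b -> psd (S + b%:M).
Proof. by move=> Sp b0; apply: psd_add => //; exact: psd_scalar. Qed.

Lemma mxtrace_rank1 u S : \tr (u^T *m u *m S) = bil u S u.
Proof. by rewrite -mulmxA mxtrace_mulC trace_mx11 /bil. Qed.

(** S and A = S + u^T u need not commute, so factors S are exchanged for A one at a time. Each
    exchange adds the trace of S^a u^T u A^i, a word in u and therefore nonnegative. *)
Lemma mxtrace_exp_le S u j : psd S -> \tr (S ^+ j) <= \tr ((S + u^T *m u) ^+ j).
Proof.
move=> Sp; set A := S + _.
suff h i a : \tr (S ^+ (i + a)) <= \tr (S ^+ a * A ^+ i).
  by have := h j 0%N; rewrite addn0 expr0 mul1r.
elim: i a => [|i IH] a; first by rewrite expr0 mulr1.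
rewrite addSnnS (le_trans (IH a.+1))//.
rewrite (exprS A) mulrA {2}/A mulrDr mulrDl -exprSr linearD/= lerDl.
rewrite -!mulmxE -[S ^+ a *m _ *m _]mulmxA mxtrace_mulC -[_ *m S ^+ a]mulmxA mxtrace_rank1.
have [Ss _] := Sp; have As : A^T = A by rewrite linearD/= trmx_mul trmxK Ss.
rewrite -bil_tr trmx_mul !tr_exp// mulmxE.
exact: word_ge0.
Qed.

Lemma psd_diag Q i : psd Q -> 0 <= Q i i.
Proof.
move=> [_ /(_ (delta_mx 0 i))]; rewrite /bil -rowE trmx_delta -colE.
by rewrite !mxE.
Qed.

(** Testing Q on v_i e_j - v_j e_i bounds each term of the form by diagonal entries; summing over i
    and j produces the trace. *)
Lemma psd_le_mxtrace Q v : psd Q -> bil v Q v <= bil v 1 v * \tr Q.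
Proof.
move=> Qp; have [Qs Qv] := Qp.
have key i j : 2 * (v 0 i * Q i j * v 0 j) <= v 0 i ^+ 2 * Q j j + v 0 j ^+ 2 * Q i i.
  have := Qv (v 0 i *: delta_mx 0 j - v 0 j *: delta_mx 0 i).
  rewrite -scaleNr !bilDl !bilDr !bilZl !bilZr.
  have e k l : bil (delta_mx 0 k) Q (delta_mx 0 l) = Q k l.
    by rewrite /bil -rowE trmx_delta -colE !mxE.
  rewrite !e.
  have -> : Q j i = Q i j by rewrite -[in LHS]Qs mxE.
  by move=> h; nra.
have -> : bil v 1 v = \sum_i v 0 i ^+ 2.
  by rewrite /bil mulmx1 mxE; apply: eq_bigr => i _; rewrite mxE expr2.
rewrite -(@ler_pM2l _ 2)// bilE mulr_sumr.
apply: (@le_trans _ _ (\sum_j \sum_i (v 0 i ^+ 2 * Q j j + v 0 j ^+ 2 * Q i i))).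
  by apply: ler_sum => j _; rewrite mulr_sumr ler_sum.
rewrite le_eqVlt; apply/orP; left; apply/eqP.
under eq_bigr do rewrite big_split/=.
rewrite big_split/= [X in X + _]exchange_big/=.
rewrite -!big_distrlr/= -/(mxtrace Q); ring.
Qed.

(** For |v| = 1 this is (v Q v^T)^(p+1) <= v Q^(p+1) v^T <= tr Q^(p+1), the first step being
    Jensen's inequality for the spectral measure. It converts a bound on the trace of a power into a
    bound on the form. *)
Lemma psd_exp_le_mxtrace Q v p : psd Q ->
  bil v Q v ^+ p.+1 <= bil v 1 v ^+ p.+1 * \tr (Q ^+ p.+1).
Proof.
move=> Qp; have v0 := bil1_ge0 v; have s0 : 0 <= bil v Q v by case: Qp.
suff h : bil v Q v ^+ p.+1 <= bil v 1 v ^+ p * bil v (Q ^+ p.+1) v.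
  rewrite (le_trans h)// [_ ^+ p.+1 * \tr _](_ : _ = bil v 1 v ^+ p * (bil v 1 v * \tr (Q ^+ p.+1))).
    by rewrite ler_wpM2l ?exprn_ge0// psd_le_mxtrace//; exact: psd_exp.
  by rewrite exprSr mulrA.
elim: p => [|p IH]; first by rewrite !expr0 mul1r !expr1.
rewrite exprS (le_trans (ler_wpM2l s0 IH))// mulrCA [bil v 1 v ^+ p.+1]exprSr -mulrA.
rewrite ler_wpM2l ?exprn_ge0//.
by have := psd_moments v 1 p.+1 Qp; rewrite expr1 add1n.
Qed.

Lemma mxtrace_shift S b m : \tr ((S + b%:M) ^+ m) =
  \sum_(c < m.+1) 'C(m, c)%:R * b ^+ c * \tr (S ^+ (m - c)).
Proof.
rewrite exprDn_comm; last by rewrite /GRing.comm -!mulmxE scalar_mxC.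
rewrite linear_sum; apply: eq_bigr => c _ /=.
have -> : (b%:M : 'M[R]_n) ^+ c = (b ^+ c)%:M.
  elim: (nat_of_ord c) => [|k IH]; first by rewrite !expr0.
  by rewrite !exprS IH -mulmxE -scalar_mxM.
rewrite -mulmxE scalar_mxC mul_scalar_mx -scaler_nat !linearZ/=.
by rewrite mulrA.
Qed.

(** Cauchy-Schwarz against each basis vector puts an isotropic vector into the kernel. *)
Lemma psd_bil0 Q v : psd Q -> bil v Q v = 0 -> v *m Q = 0.
Proof.
move=> Qp v0; apply/rowP => j; rewrite [RHS]mxE.
have := psd_cauchy_schwarz v (delta_mx 0 j) Qp.
rewrite v0 mul0r => h.
have : bil v Q (delta_mx 0 j) ^+ 2 == 0 by rewrite eq_le h sqr_ge0.
by rewrite sqrf_eq0 => /eqP; rewrite /bil trmx_delta -colE mxE.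
Qed.
End psd.

(** * Rayleigh quotients and eigenvalues *)

Section rayleigh.
Variables (R : realType) (n : nat).
Implicit Types (S : 'M[R]_n) (v : 'rV[R]_n).

Lemma continuous_quadratic_form S : continuous (fun v => bil v S v).
Proof.
under eq_fun do rewrite bilE.
apply: continuous_big => [|j _]; first exact: add_continuous.
apply: continuous_big => [|i _ v]; first exact: add_continuous.
apply: (@continuousM R _ (fun v : 'rV[R]_n => v 0 i * S i j) (fun v => v 0 j));
  last exact: coord_continuous.
apply: (@continuousM R _ (fun v : 'rV[R]_n => v 0 i) (fun=> S i j));
  last exact: cst_continuous.
exact: coord_continuous.
Qed.

Lemma compact_sphere : compact [set v : 'rV[R]_n | bil v 1 v = 1].
Proof.
have cube : compact [set v : 'rV[R]_n | forall i, `[(-1 : R), 1]%classic (v ord0 i)].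
  by apply: (@rV_compact R n (fun=> `[(-1 : R), 1]%classic)) => _; exact: segment_compact.
apply: (subclosed_compact _ cube).
  apply: (@preimage_closed _ _ (fun v => bil v 1 v) [set x | x = 1]).
  - by move=> x _; exact: continuous_quadratic_form.
  - exact: closed_eq.
move=> v /= v1 i; rewrite in_itv/= -ler_norml.
rewrite -(@ler_pXn2r _ 2) ?nnegrE// expr1n real_normK ?num_real// -v1.
rewrite /bil mulmx1 mxE (bigD1 i)//= !mxE -expr2 lerDl sumr_ge0// => j _.
by rewrite mxE -expr2 sqr_ge0.
Qed.

(* A maximiser of the Rayleigh quotient is an eigenvector: the form of a - S is
   nonnegative and vanishes at it. *)
Lemma rayleigh_le_eigenvalue S w : S^T = S -> bil w 1 w = 1 ->
  exists2 a, eigenvalue S a & bil w S w <= a.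
Proof.
move=> Ss w1.
have [||v vA vmax] := @compact_EVT_max _ R (fun v => bil v S v) _ _ compact_sphere.
- by exists w.
- by apply: continuous_subspaceT; exact: continuous_quadratic_form.
have {}vA : bil v 1 v = 1 by rewrite inE in vA.
exists (bil v S v); last by apply: vmax; rewrite inE.
set a := bil v S v.
have sc u : bil u a%:M u = a * bil u 1 u.
  by rewrite -[a%:M]mulmx1 mul_scalar_mx bilZm.
have Sub u : bil u (a%:M - S) u = a * bil u 1 u - bil u S u.
  by rewrite bilDm sc -scaleN1r bilZm mulN1r.
have Qp : psd (a%:M - S).
  split; first by rewrite linearB/= tr_scalar_mx Ss.
  move=> u; rewrite Sub subr_ge0.
  have := bil1_ge0 u; rewrite le_eqVlt => /orP[/eqP u0|u0].
    have -> : u = 0.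
      by have := psd_bil0 (@psd_scalar R n 1 ler01) (esym u0); rewrite mulmx1.
    by rewrite /bil !mul0mx mxE mulr0.
  set t := (Num.sqrt (bil u 1 u))^-1.
  have t2 : t * (t * bil u 1 u) = 1.
    rewrite mulrA -expr2 exprVn sqr_sqrtr ?ltW// mulVf//.
    by rewrite gt_eqF.
  have := vmax (t *: u); rewrite inE/= !bilZl !bilZr t2 => /(_ erefl) h.
  have tt : 0 < t * t by rewrite mulr_gt0 ?invr_gt0 ?sqrtr_gt0.
  by rewrite -(ler_pM2l tt) mulrCA -!mulrA t2 mulr1.
apply/eigenvalueP; exists v; last first.
  apply: contra_eq_neq vA => ->; rewrite /bil !mul0mx mxE.
  by rewrite eq_sym oner_neq0.
have : v *m (a%:M - S) = 0.
  by apply: psd_bil0 => //; rewrite Sub vA mulr1 subrr.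
rewrite mulmxBr mul_mx_scalar => /eqP; rewrite subr_eq0 => /eqP ->//.
Qed.

(** The upper bound tests the form on eigenvectors. The supremum must also run over a nonempty set:
    the index [i] supplies a unit vector, from which an eigenvalue of absolute value at least
    [|S i i|] is obtained. *)
Lemma spectral_norm_bounds S i C : S^T = S ->
  (forall v, `|bil v S v| <= C * bil v 1 v) ->
  `|S i i| <= spectral_norm S <= C.
Proof.
move=> Ss SC.
have ub a : eigenvalue S a -> `|a| <= C.
  move=> /eigenvalueP[v va v0].
  have v1 : 0 < bil v 1 v.
    rewrite lt_neqAle bil1_ge0 andbT; apply: contraNneq v0 => u0.
    by have := psd_bil0 (@psd_scalar R n 1 ler01) (esym u0); rewrite mulmx1 => ->.
  have := SC v; rewrite {1}/bil va -[a *: v]mulmx1 -scalemxAl.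
  rewrite -/(bil (a *: v) 1 v) -scalemxAl.
  by rewrite mxE normrM (ger0_norm (ltW v1)) ler_pM2r.
have Si (A : 'M[R]_n) : bil (delta_mx 0 i) A (delta_mx 0 i) = A i i.
  by rewrite /bil -rowE trmx_delta -colE !mxE.
have d1 : bil (delta_mx 0 i) 1 (delta_mx 0 i) = 1 :> R.
  by rewrite Si mxE eqxx.
have [b Sb bge] : exists2 b, eigenvalue S b & `|S i i| <= `|b|.
  have [Sii|Sii] := leP 0 (S i i).
    have [b eb] := rayleigh_le_eigenvalue Ss d1.
    rewrite Si => h; exists b => //.
    by rewrite ger0_norm// ger0_norm// (le_trans _ h).
  (* The Rayleigh argument reaches eigenvalues from below only, so a negative diagonal entry is
     handled through - S. *)
  have Ns : (- S)^T = - S by rewrite linearN/= Ss.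
  have [b /eigenvalueP[v vb v0]] := rayleigh_le_eigenvalue Ns d1.
  rewrite Si mxE => h; exists (- b).
    apply/eigenvalueP; exists v => //.
    by rewrite scaleNr -vb mulmxN opprK.
  by rewrite normrN (ltr0_norm Sii) (le_trans h)// ler_norm.
have ne : [set `|a| | a in [set a : R | eigenvalue S a]] !=set0.
  by exists `|b|, b.
apply/andP; split.
  rewrite (le_trans bge)//; apply: ub_le_sup; last by exists b.
  by exists C => _ [a ea <-]; exact: ub.
by apply: ge_sup => // _ [a ea <-]; exact: ub.
Qed.

End rayleigh.

(** * Bounds on the norm of the Markov matrix *)

Section markov_norm.
Variable R : realType.
Implicit Types x : nat -> nat -> R.

Definition sym_entry x i j : R := if (i <= j)%N then x i j else x j i.

(** The term j = i is left out because X_ii cancels on the diagonal of M_n. *)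
Definition row_sum x (n i : nat) : R :=
  \sum_(j < n | (j : nat) != i) sym_entry x i j.

(** Stored as a row padded with zeros; the sum of u^T u over these rows is U U^T, where U is the
    strictly upper triangular part of X_n. *)
Definition upper_col x n k : 'rV[R]_n :=
  \row_(i < n) if (i < k)%N then x i k else 0.

Lemma sym_entryC x i j : sym_entry x i j = sym_entry x j i.
Proof. by rewrite /sym_entry; case: ltngtP => // ->. Qed.

Lemma tr_markov_mx x n : (markov_mx x n)^T = markov_mx x n.
Proof.
rewrite /markov_mx linearB/= tr_diag_mx; congr (_ - _).
by apply/matrixP => i j; rewrite !mxE -!/(sym_entry _ _ _) sym_entryC.
Qed.

Lemma markov_mx_diag x n (i : 'I_n) : markov_mx x n i i = - row_sum x n i.
Proof.
rewrite !mxE eqxx mulr1n leqnn (bigD1 i)//= mxE leqnn opprD addrA subrr add0r.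
by congr (- _); apply: eq_bigr => j _; rewrite mxE.
Qed.

Lemma bil_markov_mx x n v : bil v (markov_mx x n) v =
  2 * (\sum_(k < n) (v *m (upper_col x n k)^T) 0 0 * v 0 k)
  - \sum_(i < n) row_sum x n i * v 0 i ^+ 2.
Proof.
rewrite bilE.
have -> : \sum_(k < n) (v *m (upper_col x n k)^T) 0 0 * v 0 k =
    \sum_(k < n) \sum_(i < n | (i < k)%N) v 0 i * sym_entry x i k * v 0 k.
  apply: eq_bigr => k _; rewrite mxE mulr_suml [RHS]big_mkcond/=.
  apply: eq_bigr => i _; rewrite !mxE /sym_entry.
  by case: ltnP => ik; rewrite ?(ltnW ik)// mulr0 mul0r.
rewrite mulr_natl mulr2n [X in _ + X - _](exchange_big_dep xpredT)//= -big_split/= -sumrB.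
apply: eq_bigr => j _.
rewrite (bigD1 j)//= markov_mx_diag [LHS]addrC; congr (_ + _); last first.
  by ring.
rewrite (bigID (fun i : 'I_n => (i < j)%N))/=; congr (_ + _).
  apply: eq_big => [i|i /andP[ij _]].
    by rewrite -(inj_eq val_inj)/=; case: (ltngtP i j).
  rewrite !mxE -/(sym_entry _ _ _) (negbTE ij) mulr0n subr0//.
apply: eq_big => [i|i /andP[ij _]].
  rewrite -leqNgt -(inj_eq val_inj)/=; by case: (ltngtP i j).
rewrite !mxE -/(sym_entry _ _ _) (negbTE ij) mulr0n subr0 sym_entryC.
by rewrite mulrAC [v 0 i * _]mulrC mulrAC.
Qed.

(** Half of the off-diagonal form at v is the inner product of v U with v. Here |v U|^2 is the form
    of A = U U^T at v, which the trace of a power of A bounds by K |v|^2. The lower bound is read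
    off a diagonal entry. *)
Lemma markov_norm_bounds x n (i : 'I_n) (K D : R) p : 0 <= K ->
  \tr ((\sum_(k < n) (upper_col x n k)^T *m upper_col x n k) ^+ p.+1) <= K ^+ p.+1 ->
  (forall i, (i < n)%N -> `|row_sum x n i| <= D) ->
  `|row_sum x n i| <= spectral_norm (markov_mx x n) <= 2 * Num.sqrt K + D.
Proof.
move=> K0; set A := \sum_(k < n) _ => trA rD.
have Ap : psd A by apply: psd_sum => k _; exact: psd_rank1.
have -> : `|row_sum x n i| = `|markov_mx x n i i|.
  by rewrite markov_mx_diag normrN.
apply: spectral_norm_bounds; first exact: tr_markov_mx.
move=> v; rewrite bil_markov_mx [leRHS]mulrDl (le_trans (ler_normB _ _))// lerD//.
- rewrite normrM ger0_norm// -mulrA ler_wpM2l//.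
  set w := \row_(k < n) (v *m (upper_col x n k)^T) 0 0.
  have -> : \sum_(k < n) (v *m (upper_col x n k)^T) 0 0 * v 0 k = bil w 1 v.
    by rewrite /bil mulmx1 mxE; apply: eq_bigr => k _; rewrite !mxE.
  have v0 := bil1_ge0 v.
  have wA : bil w 1 w = bil v A v.
    rewrite /bil mulmx1 mxE mulmx_sumr mulmx_suml summxE.
    apply: eq_bigr => k _.
    rewrite -/(bil v _ v) bil_rank1 !mxE; congr (_ * _).
    by apply: eq_bigr => j _; rewrite !mxE mulrC.
  have vA : bil v A v <= K * bil v 1 v.
    rewrite -(@ler_pXn2r _ p.+1)// ?nnegrE ?mulr_ge0//; last by case: Ap.
    rewrite (le_trans (psd_exp_le_mxtrace v p Ap))// exprMn mulrC.
    by rewrite ler_wpM2r// exprn_ge0.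
  rewrite -(@ler_pXn2r _ 2)// ?nnegrE ?mulr_ge0 ?sqrtr_ge0//.
  rewrite real_normK ?num_real//.
  have p1 : psd (1 : 'M[R]_n) by exact: psd_scalar.
  rewrite (le_trans (psd_cauchy_schwarz w v p1))// wA exprMn sqr_sqrtr//.
  by rewrite [in leRHS]expr2 mulrA ler_wpM2r.
- rewrite (le_trans (ler_norm_sum _ _ _))// /bil mulmx1 mxE mulr_sumr.
  apply: ler_sum => k _.
  by rewrite normrM !mxE -expr2 (ger0_norm (sqr_ge0 _)) ler_wpM2r ?sqr_ge0 ?rD.
Qed.

End markov_norm.
(** * Expectation and independence *)

Section expectation.
Context d (T : measurableType d) (R : realType) (P : probability T R).
Implicit Types f g h : T -> R.

Definition L1 f : Prop := P.-integrable setT (EFin \o f).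

(** [Rintegral] sends an infinite integral to 0, so identities between means are stated under
    [L1]. *)
Definition mean f : R := \int[P]_w f w.

Lemma L1_measurable f : L1 f -> measurable_fun setT f.
Proof. by move=> /measurable_int/measurable_EFinP. Qed.

Lemma mean_EFin f : L1 f -> (\int[P]_w (f w)%:E = (mean f)%:E)%E.
Proof. by move=> f1; rewrite /mean /Rintegral fineK// integrable_fin_num. Qed.

Lemma L1_cst c : L1 (fun=> c).
Proof. by apply: finite_measure_integrable_cst. Qed.

Lemma mean_cst c : mean (fun=> c) = c.
Proof. by rewrite /mean Rintegral_cst//= probability_setT mulr1. Qed.

Lemma L1D f g : L1 f -> L1 g -> L1 (fun w => f w + g w).
Proof. by move=> f1 g1; apply: (integrableD _ f1 g1). Qed.

Lemma meanD f g : L1 f -> L1 g -> mean (fun w => f w + g w) = mean f + mean g.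
Proof. by move=> f1 g1; rewrite /mean RintegralD. Qed.

Lemma L1Z c f : L1 f -> L1 (fun w => c * f w).
Proof. by move=> f1; apply: (integrableZl _ c f1). Qed.

Lemma meanZ c f : L1 f -> mean (fun w => c * f w) = c * mean f.
Proof. by move=> f1; rewrite /mean RintegralZl. Qed.

Lemma L1B f g : L1 f -> L1 g -> L1 (fun w => f w - g w).
Proof. by move=> f1 g1; apply: (integrableB _ f1 g1). Qed.

Lemma meanB f g : L1 f -> L1 g -> mean (fun w => f w - g w) = mean f - mean g.
Proof. by move=> f1 g1; rewrite /mean RintegralB. Qed.

Lemma L1_sum (I : Type) (r : seq I) (p : pred I) (F : I -> T -> R) :
  (forall i, p i -> L1 (F i)) -> L1 (fun w => \sum_(i <- r | p i) F i w).
Proof.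
move=> h; elim: r => [|i r IH].
  by under eq_fun do rewrite big_nil; exact: L1_cst.
under eq_fun do rewrite big_cons.
by case pi: (p i) => //; apply: L1D => //; exact: h.
Qed.

Lemma mean_sum (I : Type) (r : seq I) (p : pred I) (F : I -> T -> R) :
  (forall i, p i -> L1 (F i)) ->
  mean (fun w => \sum_(i <- r | p i) F i w) = \sum_(i <- r | p i) mean (F i).
Proof.
move=> h; elim: r => [|i r IH].
  by under eq_fun do rewrite big_nil; rewrite big_nil mean_cst.
under eq_fun do rewrite big_cons.
rewrite big_cons; case pi: (p i) => //.
rewrite (@meanD (F i) (fun w => \sum_(j <- r | p j) F j w)) ?IH//.
  exact: h.
exact: L1_sum.
Qed.

Lemma le_mean f g : L1 f -> L1 g -> (forall w, f w <= g w) -> mean f <= mean g.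
Proof. by move=> f1 g1 h; apply: le_Rintegral. Qed.

Lemma mean_ge0 f : (forall w, 0 <= f w) -> 0 <= mean f.
Proof. by move=> h; apply: Rintegral_ge0. Qed.

Lemma L1_le f g : measurable_fun setT f -> (forall w, `|f w| <= g w) ->
  L1 g -> L1 f.
Proof.
move=> mf fg g1; apply: (le_integrable _ _ _ g1) => //.
  exact/measurable_EFinP.
by move=> w _; rewrite /= lee_fin (le_trans (fg w))// ler_norm.
Qed.

Lemma L1_bounded f M : measurable_fun setT f -> (forall w, `|f w| <= M) -> L1 f.
Proof. by move=> mf fM; apply: (L1_le mf fM); exact: L1_cst. Qed.

Lemma norm_mean f : L1 f -> `|mean f| <= mean (fun w => `|f w|).
Proof. by move=> f1; apply: le_normr_Rintegral. Qed.

Lemma L1_norm f : L1 f -> L1 (fun w => `|f w|).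
Proof. by move=> f1; exact: integrable_norm. Qed.

Definition indep_funs f g : Prop := forall A B, measurable A -> measurable B ->
  P (f @^-1` A `&` g @^-1` B) = (P (f @^-1` A) * P (g @^-1` B))%E.

(** By independence the law of (f, g) and the product of the two laws agree on rectangles, hence
    everywhere. Tonelli then gives the integrability of the product and Fubini its mean. *)
Lemma indep_mean f g : indep_funs f g -> L1 f -> L1 g ->
  L1 (fun w => f w * g w) /\ mean (fun w => f w * g w) = mean f * mean g.
Proof.
move=> fg f1 g1.
have mf := L1_measurable f1; have mg := L1_measurable g1.
pose F : {mfun T >-> R} := MeasurableFun.Pack (MeasurableFun.Class
  (isMeasurableFun.Build _ _ _ _ _ mf)).
pose G : {mfun T >-> R} := MeasurableFun.Pack (MeasurableFun.Class
  (isMeasurableFun.Build _ _ _ _ _ mg)).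
have mH : measurable_fun setT (fun w => (f w, g w)) by exact: measurable_fun_pair.
pose H : {mfun T >-> (R * R)%type} := MeasurableFun.Pack (MeasurableFun.Class
  (isMeasurableFun.Build _ _ _ _ _ mH)).
pose q : (R * R)%type -> \bar R := fun z => (z.1 * z.2)%:E.
have mq : measurable_fun setT q.
  by apply/measurable_EFinP; exact: measurable_funM.
have prodE A : measurable A -> A `<=` setT ->
    distribution P H A = (distribution P F \x distribution P G)%E A.
  move=> mA _; apply/esym/product_measure_unique => //.
have intd (h : T -> R) (mh : measurable_fun setT h)
    (U := MeasurableFun.Pack (MeasurableFun.Class
      (isMeasurableFun.Build _ _ _ _ _ mh)) : {mfun T >-> R}) : L1 h ->
    (distribution P U).-integrable setT EFin /\
    (\int[distribution P U]_y y%:E = (mean h)%:E)%E.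
  move=> h1; split.
    apply: (@integrable_pushforward _ _ _ _ R U) => //.
  by rewrite integral_distribution//= mean_EFin.
have [iF EF] := intd f mf f1; have [iG EG] := intd g mg g1.
rewrite -/F in iF EF; rewrite -/G in iG EG.
set mu := distribution P F in iF EF prodE; set nu := distribution P G in iG EG prodE.
have iq : (mu \x nu)%E.-integrable setT q.
  apply/integrable12ltyP => //.
  have [c cE] : exists c, (\int[nu]_y `|y%:E| = c%:E)%E.
    exists (fine (\int[nu]_y `|y%:E|))%E.
    by rewrite fineK// integrable_fin_num//; exact: integrable_abse.
  rewrite (eq_integral (fun x : R => `|x%:E| * c%:E)%E); last first.
    move=> x _; rewrite -cE -integralZl//; last exact: integrable_abse.
    by apply: eq_integral => y _; rewrite /q/= normrM EFinM.
  rewrite integralZr//; last exact: integrable_abse.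
  rewrite lte_mul_pinfty//; first exact: integral_ge0.
    by rewrite integrable_fin_num//; exact: integrable_abse.
  exact: ltry.
have iH : L1 (fun w => f w * g w).
  apply/integrableP; split.
    exact/measurable_EFinP/measurable_funM.
  rewrite (_ : \int[P]_x _ = \int[distribution P H]_z `|q z|)%E; last first.
    by rewrite ge0_integral_distribution//; exact: measurableT_comp.
  rewrite (eq_measure_integral _ prodE).
  by case/integrableP : iq.
split=> //; apply: EFin_inj; rewrite -mean_EFin//.
rewrite (_ : \int[P]_w _ = \int[distribution P H]_z q z)%E; last first.
  by rewrite integral_distribution.
rewrite (eq_measure_integral _ prodE) -integral12_prod_meas1// /fubini_F /q/=.
rewrite (eq_integral (fun x : R => x%:E * (mean g)%:E)%E).
  by rewrite integralZr// EF.
by move=> x _; rewrite -EG -integralZl.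
Qed.

End expectation.

(** * Borel-Cantelli through means *)

Section borel_cantelli.
Context d (T : measurableType d) (R : realType) (P : probability T R).
Implicit Types (h : nat -> T -> R) (c : nat -> R).

(** Markov's inequality bounds the probability of h n >= 1 by c n. The almost sure statements below
    rest on this, with h n a count of large entries, a sum of exponentials, a product of windows or
    a scaled trace. *)
Lemma borel_cantelli_mean h c M : (forall n, L1 P (h n)) ->
  (forall n w, 0 <= h n w) -> (forall n, 0 <= c n) ->
  (forall N, \sum_(n < N) c n <= M) ->
  (\forall n \near \oo, mean P (h n) <= c n) ->
  {ae P, forall w, \forall n \near \oo, h n w < 1}.
Proof.
move=> h1 h0 c0 cM [n0 _ hc].
pose A n : set T := if (n0 <= n)%N then [set w | 1 <= h n w] else set0.
have mA n : measurable (A n).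
  rewrite /A; case: ifP => // _.
  rewrite -[X in measurable X]setTI.
  apply: (measurable_fun_le (f := fun=> 1)) => //.
  exact: L1_measurable (h1 n).
have PA n : (P (A n) <= (c n)%:E)%E.
  rewrite /A; case: ifP => hn; last by rewrite measure0 lee_fin.
  apply: (@le_trans _ _ (mean P (h n))%:E); last by rewrite lee_fin; exact: hc.
  have mAn := mA n; rewrite /A hn in mAn.
  rewrite -mean_EFin// -[X in P X]setIT -integral_indic//.
  apply: ge0_le_integral => //.
  - by apply/measurable_EFinP; exact: measurable_indic.
  - by apply/measurable_EFinP; exact: L1_measurable (h1 n).
  - move=> w _; rewrite lee_fin indicE.
    by case: (boolP (w \in _)) => //; rewrite inE.
have PA0 : P (lim_sup_set A) = 0%E.
  apply: lim_sup_set_cvg0 => //.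
  apply: (@le_lt_trans _ _ M%:E); last exact: ltry.
  apply: lime_le; first exact: is_cvg_nneseries.
  apply: nearW => N; rewrite big_mkord.
  apply: (@le_trans _ _ (\sum_(n < N) (c n)%:E)%E); first by apply: lee_sum => n _; exact: PA.
  by rewrite sumEFin lee_fin.
exists (lim_sup_set A); split => //.
  apply: bigcap_measurable => [|k _]; first by exists 0%N.
  by apply: bigcup_measurable => j _; exact: mA.
move=> w /= nw k _; apply: contrapT => nA; apply: nw.
exists (maxn k n0) => // n /= kn; rewrite ltNge; apply/negP => h1n.
apply: nA; exists n => /=; first exact: leq_trans (leq_maxl _ _) kn.
by rewrite /A (leq_trans (leq_maxr _ _) kn).
Qed.

Lemma sum_inv_sqr_le N : \sum_(n < N) (n.+1%:R ^+ 2)^-1 <= 2 :> R.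
Proof.
case: N => [|N]; first by rewrite big_ord0.
(* Strengthened so that the induction telescopes: 1 / (N + 2)^2 <= 1 / (N + 1) - 1 / (N + 2). *)
suff h : \sum_(n < N.+1) (n.+1%:R ^+ 2)^-1 <= 2 - N.+1%:R^-1 :> R.
  by rewrite (le_trans h)// gerBl.
elim: N => [|N IH].
  by rewrite big_ord_recl big_ord0 addr0 expr1n invr1 lerBrDr.
rewrite big_ord_recr/=; apply: (le_trans (lerD IH (lexx _))).
have n1 : 0 < N.+1%:R :> R by [].
have -> : N.+2%:R = N.+1%:R + 1 :> R by rewrite -natr1.
set x : R := N.+1%:R in n1 *; rewrite -addrA lerD2l addrC lerBlDr.
rewrite -subr_ge0.
have -> : - (x + 1)^-1 + x^-1 - ((x + 1) ^+ 2)^-1 = (x * (x + 1) ^+ 2)^-1.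
  by field; rewrite !gt_eqF// addr_gt0.
by rewrite invr_ge0 mulr_ge0 ?sqr_ge0// ltW.
Qed.

End borel_cantelli.

(** * Independence of functions of disjoint blocks of variables *)

Section independence.
Context d (T : measurableType d) (R : realType) (P : probability T R).

(** The events that satisfy the product rule with a fixed C form a Dynkin class. *)
Lemma pi_system_indep (G : set (set T)) (C : set T) :
  setI_closed G -> G `<=` measurable -> measurable C ->
  (forall A, G A -> P (A `&` C) = P A * P C)%E ->
  forall A, <<s G >> A -> (P (A `&` C) = P A * P C)%E.
Proof.
move=> GI Gm mC GC.
have sm : <<s G >> `<=` measurable.
  by apply: smallest_sub => //; exact: sigma_algebra_measurable.
apply: (@dynkin_induction _ (g_sigma_algebraType G) G) => //.
- by rewrite setTI probability_setT mul1e.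
- move=> S mS /= SC; have {}mS : @measurable d T S by exact: sm.
  rewrite probability_setC// muleBl ?fin_num_measure// ?mul1e.
  rewrite -SC setIC -setDE measureD//; last first.
    by rewrite (le_lt_trans (probability_le1 _ _))// ltry.
  by rewrite setIC.
- move=> F mF tF FC; have mF' n : @measurable d T (F n) by apply: sm; exact: mF.
  rewrite setI_bigcupl.
  rewrite measure_bigcup//; last 2 first.
    by move=> n _; exact: (@measurableI d T (F n) C).
    exact: trivIset_setIr.
  rewrite measure_bigcup// muleC -[P C]fineK ?fin_num_measure// -nneseriesZl//.
  by apply: eq_eseriesr => n _; rewrite fineK ?fin_num_measure//; exact: etrans (FC n) (muleC _ _).
Qed.

Context (I : choiceType) (D : set I) (X : I -> {RV P >-> R}).
Hypothesis X_indep : independent_RVs D X.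
Implicit Types S : set I.

Definition rv_events S : set (set T) :=
  [set A | exists2 i, S i & exists2 B, measurable B & A = X i @^-1` B].

(** Events on a single variable are not stable under intersection; these cylinders are a pi-system
    that contains them. *)
Definition rv_cylinders S : set (set T) :=
  [set A | exists2 J : {fset I}, [set` J] `<=` S & exists2 B : I -> set R,
     (forall i, measurable (B i)) & A = \bigcap_(i in [set` J]) (X i @^-1` (B i))].

(** Measurability for the sigma-algebra generated by the variables with index in S: [f] depends on
    these variables only. *)
Definition rv_measurable S (f : T -> R) : Prop :=
  measurable_fun setT (f : g_sigma_algebraType (rv_events S) -> R).

Lemma rv_cylinders_measurable S : rv_cylinders S `<=` measurable.
Proof.
move=> _ [J _ [B mB ->]]; apply: fin_bigcap_measurable => //.
by move=> i _; exact: measurable_funPTI.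
Qed.

Lemma rv_cylindersI S : setI_closed (rv_cylinders S).
Proof.
move=> _ _ [J JS [B mB ->]] [K KS [C mC ->]].
exists (J `|` K)%fset.
  by move=> i /=; rewrite inE => /orP[/JS|/KS].
exists (fun i => (if i \in J then B i else setT) `&` (if i \in K then C i else setT)).
  by move=> i; apply: measurableI; case: ifP.
apply/seteqP; split=> [w [wB wC] i /= _|w wBC].
  by split; case: ifP => // h; [exact: wB|exact: wC].
split=> i /= h.
  by have := wBC i; rewrite /= inE h => /(_ isT)[].
by have := wBC i; rewrite /= inE h orbT => /(_ isT)[].
Qed.

Lemma rv_cylinders_indep S S' A C : S `<=` D -> S' `<=` D -> S `&` S' = set0 ->
  rv_cylinders S A -> rv_cylinders S' C -> (P (A `&` C) = P A * P C)%E.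
Proof.
move=> SD S'D SS' [J JS [B mB ->]] [K KS [B' mB' ->]].
have JK i : i \in J -> i \in K -> False.
  move=> iJ iK; suff : (S `&` S') i by rewrite SS'.
  by split; [exact: JS|exact: KS].
rewrite X_indep//; last by move=> i /= /JS/SD.
rewrite X_indep//; last by move=> i /= /KS/S'D.
pose B2 i := if i \in J then B i else B' i.
rewrite (_ : _ `&` _ = \bigcap_(i in [set` (J `|` K)%fset]) X i @^-1` B2 i).
  rewrite X_indep; last 2 first.
  - by move=> i /=; rewrite inE => /orP[/JS/SD|/KS/S'D].
  - by move=> i _; rewrite /B2; case: ifP.
  rewrite (perm_big (enum_fset J ++ enum_fset K))/=; last first.
    apply: uniq_perm; rewrite ?fset_uniq//.
      rewrite cat_uniq !fset_uniq/= andbT; apply/hasPn => i iK.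
      by apply/negP => iJ; exact: (JK i).
    by move=> i; rewrite mem_cat inE.
  rewrite big_cat/=; congr (_ * _)%E.
    by apply: eq_big_seq => i iJ; rewrite /B2 iJ.
  apply: eq_big_seq => i iK; rewrite /B2; case: ifP => // iJ.
  by case: (JK i).
apply/seteqP; split=> [w [wB wC] i /=|w h].
  rewrite inE /B2 => /orP[iJ|iK]; first by rewrite iJ; exact: wB.
  by case: ifPn => iJ; [exact: wB|exact: wC].
split=> i /= iJ; have := h i; rewrite /= inE iJ ?orbT => /(_ isT); rewrite /B2 ?iJ//.
by case: ifP => // iJ'; case: (JK i).
Qed.

Lemma rv_events_cylinders S : rv_events S `<=` rv_cylinders S.
Proof.
move=> _ [i Si [B mB ->]]; exists [fset i]%fset.
  by move=> j /=; rewrite inE => /eqP ->.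
exists (fun=> B) => //; apply/seteqP; split=> [w wB j /=|w].
  by rewrite inE => /eqP ->.
by apply => /=; rewrite inE.
Qed.

(** The pi-lambda argument is used once on each side, the other event being held fixed. *)
Lemma rv_events_indep S S' A C : S `<=` D -> S' `<=` D -> S `&` S' = set0 ->
  <<s rv_events S >> A -> <<s rv_events S' >> C ->
  (P (A `&` C) = P A * P C)%E.
Proof.
move=> SD S'D SS' SA S'C.
have sub U B : <<s rv_events U >> B -> <<s rv_cylinders U >> B.
  by apply: sub_sigma_algebra2; exact: rv_events_cylinders.
have mcyl U B : <<s rv_cylinders U >> B -> measurable B.
  apply: smallest_sub; first exact: sigma_algebra_measurable.
  exact: rv_cylinders_measurable.
apply: (pi_system_indep (@rv_cylindersI S)) => //.
- exact: rv_cylinders_measurable.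
- exact: mcyl (sub _ _ S'C).
- move=> A' A'S; rewrite setIC muleC.
  apply: (pi_system_indep (@rv_cylindersI S')) => //.
  + exact: rv_cylinders_measurable.
  + exact: (@rv_cylinders_measurable S).
  + move=> C' C'S; rewrite setIC muleC; exact: (rv_cylinders_indep SD S'D).
  + exact: sub.
- exact: sub.
Qed.

Lemma rv_measurableT S f : rv_measurable S f -> measurable_fun setT f.
Proof.
move=> Sf _ B mB; rewrite setTI.
have : <<s rv_events S >> (f @^-1` B) by rewrite -[f @^-1` B]setTI; exact: Sf.
apply: smallest_sub; first exact: sigma_algebra_measurable.
by move=> _ [i _ [C mC ->]]; exact: measurable_funPTI.
Qed.

Lemma rv_measurable_indep S S' f g : S `<=` D -> S' `<=` D -> S `&` S' = set0 ->
  rv_measurable S f -> rv_measurable S' g -> indep_funs P f g.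
Proof.
move=> SD S'D SS' Sf S'g A B mA mB; apply: (rv_events_indep SD S'D SS').
  by rewrite -[X in <<s _ >> X]setTI; exact: Sf.
by rewrite -[X in <<s _ >> X]setTI; exact: S'g.
Qed.

Lemma rv_measurable_coord S i : S i -> rv_measurable S (X i).
Proof.
move=> Si _ B mB; rewrite setTI; apply: sub_sigma_algebra.
by exists i => //; exists B.
Qed.

Lemma sub_rv_measurable S S' f : S `<=` S' -> rv_measurable S f ->
  rv_measurable S' f.
Proof.
move=> SS' Sf _ B mB; have := Sf measurableT B mB.
apply: sub_sigma_algebra2 => A [i Si h]; exists i => //.
exact: SS'.
Qed.

Lemma rv_measurableM S f g : rv_measurable S f -> rv_measurable S g ->
  rv_measurable S (fun w => f w * g w).
Proof.
move=> Sf Sg.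
exact: (@measurable_funM _ (g_sigma_algebraType (rv_events S)) _ _ f g).
Qed.

Lemma rv_measurable_comp S f (phi : R -> R) : measurable_fun setT phi ->
  rv_measurable S f -> rv_measurable S (fun w => phi (f w)).
Proof. by move=> mphi Sf; exact: (measurableT_comp mphi Sf). Qed.

Lemma rv_measurable_cst S c : rv_measurable S (fun=> c).
Proof. exact: measurable_cst. Qed.

Lemma rv_measurable_sum S (A : Type) (r : seq A) (p : pred A) (f : A -> T -> R) :
  (forall a, p a -> rv_measurable S (f a)) ->
  rv_measurable S (fun w => \sum_(a <- r | p a) f a w).
Proof.
move=> h; elim: r => [|a r IH].
  by under eq_fun do rewrite big_nil; exact: rv_measurable_cst.
under eq_fun do rewrite big_cons.
case pa: (p a) => //.
apply: (@measurable_funD _ (g_sigma_algebraType (rv_events S)) _ _ (f a)) => //.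
exact: h.
Qed.

(** One block is peeled off at a time: it is independent of the product over the remaining ones,
    which is measurable on the union [U] of their index sets. *)
Lemma mean_prod_blocks (A : eqType) (r : seq A) (S : A -> set I)
    (f : A -> T -> R) : uniq r ->
  (forall a, a \in r -> S a `<=` D) ->
  (forall a b, a \in r -> b \in r -> a != b -> S a `&` S b = set0) ->
  (forall a, a \in r -> rv_measurable (S a) (f a)) ->
  (forall a, a \in r -> L1 P (f a)) ->
  L1 P (fun w => \prod_(a <- r) f a w) /\
  mean P (fun w => \prod_(a <- r) f a w) = \prod_(a <- r) mean P (f a).
Proof.
move=> ur SD Sdisj Sf f1.
pose U (s : seq A) := [set i | exists2 a, a \in s & S a i].
have mU s : {subset s <= r} -> rv_measurable (U s) (fun w => \prod_(a <- s) f a w).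
  elim: s => [_|a s IH sr].
    by under eq_fun do rewrite big_nil; exact: rv_measurable_cst.
  under eq_fun do rewrite big_cons.
  apply: rv_measurableM.
    apply: (@sub_rv_measurable (S a)).
      by move=> i Si; exists a => //; rewrite inE eqxx.
    by apply: Sf; rewrite sr// inE eqxx.
  apply: (@sub_rv_measurable (U s)).
    by move=> i [b bs Si]; exists b => //; rewrite inE bs orbT.
  by apply: IH => b bs; rewrite sr// inE bs orbT.
have sr : {subset r <= r} by [].
elim: {1 2 4 5 6}r ur sr => [_ _|a s IH /= /andP[as_ us] sr].
  under eq_fun do rewrite big_nil.
  by rewrite big_nil mean_cst; split => //; exact: L1_cst.
have sr' : {subset s <= r} by move=> b bs; rewrite sr// inE bs orbT.
have ar : a \in r by rewrite sr// inE eqxx.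
have [s1 sE] := IH us sr'.
under eq_fun do rewrite big_cons.
rewrite big_cons -sE; apply: indep_mean => //; last exact: f1.
apply: (@rv_measurable_indep (S a) (U s)) => //.
- exact: SD.
- by move=> i [b bs Si]; exact: (SD b (sr' _ bs)).
- apply/seteqP; split => // i [Sai [b bs Sbi]].
  have : (S a `&` S b) i by [].
  rewrite Sdisj//; first exact: sr'.
  by apply: contraNneq as_ => ->.
- exact: Sf.
- exact: mU.
Qed.

End independence.
(** * Truncation and exponential moments *)

Section exponential_taylor.
Context (R : realType).
Implicit Types x y : R.

(** Since (m + k)! >= k!, the tail of the series from order m on is at most |y|^m times the series
    of exp |y|. *)
Lemma expR_taylor_le m y :
  `|expR y - \sum_(k < m) y ^+ k / k`!%:R| <= `|y| ^+ m * expR `|y|.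
Proof.
have cv : series (exp_coeff y) n @[n --> \oo] --> expR y.
  exact: is_cvg_series_exp_coeff.
have part n : \sum_(k < n) `|y| ^+ k / k`!%:R <= expR `|y|.
  have := nondecreasing_cvgn_le _ (is_cvg_series_exp_coeff `|y|) n.
  rewrite /series/= big_mkord /exp_coeff/=; apply.
  apply: nondecreasing_series => k _ _; exact: exp_coeff_ge0.
have tail n : `|series (exp_coeff y) (m + n)%N - \sum_(k < m) y ^+ k / k`!%:R| <=
    `|y| ^+ m * expR `|y|.
  rewrite /series/= big_mkord big_split_ord/= addrAC subrr add0r.
  rewrite (le_trans (ler_norm_sum _ _ _))//.
  apply: (@le_trans _ _ (\sum_(k < n) `|y| ^+ m * (`|y| ^+ k / k`!%:R))).
    apply: ler_sum => k _; rewrite /exp_coeff/= normrM normfV normr_nat normrX.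
    rewrite mulrA -exprD ler_wpM2l ?exprn_ge0// lef_pV2 ?posrE ?ltr0n ?fact_gt0//.
    by rewrite ler_nat; apply: leq_fact; rewrite leq_addl.
  by rewrite -mulr_sumr ler_wpM2l// exprn_ge0.
have cv' : `|series (exp_coeff y) (m + n)%N - \sum_(k < m) y ^+ k / k`!%:R|
    @[n --> \oo] --> `|expR y - \sum_(k < m) y ^+ k / k`!%:R|.
  apply: cvg_norm; apply: cvgB; last exact: cvg_cst.
  have h : [sequence series (exp_coeff y) (n + m)%N]_n @ \oo --> expR y.
    by rewrite cvg_shiftn.
  by under eq_fun do rewrite addnC; exact: h.
rewrite -(cvg_lim _ cv')//; apply: limr_le.
  by apply/cvg_ex; exists `|expR y - \sum_(k < m) y ^+ k / k`!%:R|.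
by apply: nearW => n; exact: tail.
Qed.

(** From exp(y^2 - y) >= 1 - y + y^2 and (1 + y)(1 - y + y^2) = 1 + y^3 >= 1. It puts a lower bound
    on a moment generating function into exponential form, ready for taking powers. *)
Lemma expR_le_1D y : 0 <= y -> expR (y - y ^+ 2) <= 1 + y.
Proof.
move=> y0; have := expR_ge1Dx (y ^+ 2 - y) => h.
have c0 : 0 < 1 + (y ^+ 2 - y) by nra.
rewrite -[y - _]opprB expRN -(invrK (1 + y)) lef_pV2 ?posrE ?expR_gt0 ?invr_gt0//; last first.
  by rewrite ltr_pwDl.
rewrite (le_trans _ h)// -(@ler_pM2l _ (1 + y)) ?ltr_pwDl// divff; last first.
  by rewrite gt_eqF// ltr_pwDl.
have : 0 <= y ^+ 3 by rewrite exprn_ge0.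
by move=> y3; rewrite (_ : _ * _ = 1 + y ^+ 3) ?lerDl//; ring.
Qed.

End exponential_taylor.

(** * Truncated variables and the moments of an entry *)

Section truncation.
Context (R : realType).

Definition trunc (n : nat) (x : R) : R := if x ^+ 2 <= n%:R then x else 0.

Lemma measurable_trunc n : measurable_fun setT (trunc n).
Proof.
apply: measurable_fun_if => //.
by apply: measurable_fun_ler => //; exact: measurable_funX.
Qed.

Lemma trunc_id n x : x ^+ 2 <= n%:R -> trunc n x = x.
Proof. by move=> xn; rewrite /trunc xn. Qed.

Lemma trunc_sqr_le n x : trunc n x ^+ 2 <= n%:R.
Proof.
by rewrite /trunc; case: ifP => // _; rewrite expr0n.
Qed.

Lemma norm_trunc_le n x : `|trunc n x| <= Num.sqrt n%:R.
Proof.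
rewrite -(@ler_pXn2r _ 2) ?nnegrE ?sqrtr_ge0// real_normK ?num_real//.
by rewrite sqr_sqrtr ?trunc_sqr_le.
Qed.

Lemma norm_trunc_le_id n x : `|trunc n x| <= `|x|.
Proof. by rewrite /trunc; case: ifP; rewrite ?normr0. Qed.

(** An error occurs only for |x| > sqrt n, and then |x| <= x^4 / n^(3/2). The bias of the truncated
    mean is thus of order n^(-3/2). *)
Lemma trunc_err n x : (0 < n)%N ->
  `|trunc n x - x| <= x ^+ 4 / (n%:R * Num.sqrt n%:R).
Proof.
move=> n0; have nR : 0 < n%:R :> R by rewrite ltr0n.
have s0 : 0 < Num.sqrt n%:R :> R by rewrite sqrtr_gt0.
have x4 : 0 <= x ^+ 4 by rewrite (exprM _ 2 2) sqr_ge0.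
rewrite /trunc; case: (leP (x ^+ 2) n%:R) => xn.
  by rewrite subrr normr0 divr_ge0// mulr_ge0// ltW.
rewrite sub0r normrN ler_pdivlMr ?mulr_gt0//.
have -> : x ^+ 4 = `|x| * (x ^+ 2 * `|x|).
  by rewrite mulrCA -expr2 real_normK ?num_real// -exprD.
rewrite ler_wpM2l//; apply: ler_pM => //; first exact: ltW.
rewrite -(@ler_pXn2r _ 2) ?nnegrE ?sqrtr_ge0// real_normK ?num_real//.
by rewrite sqr_sqrtr ltW.
Qed.

Lemma trunc_sqr_err n x : (0 < n)%N ->
  0 <= x ^+ 2 - trunc n x ^+ 2 <= x ^+ 4 / n%:R.
Proof.
move=> n0; have nR : 0 < n%:R :> R by rewrite ltr0n.
have x4 : 0 <= x ^+ 4 by rewrite (exprM _ 2 2) sqr_ge0.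
rewrite /trunc; case: (leP (x ^+ 2) n%:R) => xn.
  by rewrite subrr lexx/= divr_ge0// ltW.
rewrite expr0n subr0 sqr_ge0/= ler_pdivlMr// (exprM x 2 2) expr2.
by rewrite ler_wpM2l ?sqr_ge0// ltW.
Qed.

Lemma norm_exprn_le k (x : R) : (k <= 4)%N -> `|x ^+ k| <= 1 + x ^+ 4.
Proof.
move=> k4; rewrite normrX; have x4 : x ^+ 4 = `|x| ^+ 4.
  by rewrite -normrX ger0_norm// (exprM _ 2 2) sqr_ge0.
rewrite x4; have [x1|x1] := leP `|x| 1.
  by rewrite (le_trans (exprn_ile1 _ (normr_ge0 x) x1))// lerDl exprn_ge0.
by rewrite (le_trans (ler_weXn2l (ltW x1) k4))// lerDr.
Qed.

End truncation.

Section iid_entries.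
Context d (T : measurableType d) (R : realType) (P : probability T R).
Context (X : nat -> nat -> {RV P >-> R}).

Definition upper_pairs : set (nat * nat) := [set ij | (ij.1 <= ij.2)%N].

Definition entry (ij : nat * nat) : {RV P >-> R} := X ij.1 ij.2.

Hypotheses (X_iid : iid upper_pairs entry)
  (X_mean : ('E_P[X 0%N 1%N] = 0)%E)
  (X_var : ('V_P[X 0%N 1%N] = 1)%E)
  (X_moment4 : ('E_P[fun w => (X 0%N 1%N w ^+ 4)%R] < +oo)%E).

Let x0 : T -> R := X 0%N 1%N.

Lemma iid_mean (phi : R -> R) p : measurable_fun setT phi ->
  L1 P (fun w => phi (x0 w)) -> upper_pairs p ->
  L1 P (fun w => phi (entry p w)) /\
  mean P (fun w => phi (entry p w)) = mean P (fun w => phi (x0 w)).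
Proof.
move=> mphi phi1 Dp.
have dE A : measurable A -> A `<=` setT ->
    distribution P (entry p) A = distribution P (entry (0%N, 1%N)) A.
  by move=> mA _; exact: X_iid.2.
have mphiE : measurable_fun setT (EFin \o phi) by exact/measurable_EFinP.
have phip : L1 P (fun w => phi (entry p w)).
  apply/integrableP; split.
    by apply/measurable_EFinP; exact: measurableT_comp.
  rewrite (_ : \int[P]_x _ = \int[distribution P (entry p)]_y `|(phi y)%:E|)%E; last first.
    by rewrite ge0_integral_distribution//; exact: measurableT_comp.
  rewrite (eq_measure_integral _ dE) ge0_integral_distribution//; last first.
    exact: measurableT_comp.
  by case/integrableP : phi1.
split=> //; apply: EFin_inj; rewrite -!mean_EFin//.
transitivity (\int[distribution P (entry p)]_y (phi y)%:E)%E.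
  by rewrite integral_distribution.
by rewrite (eq_measure_integral _ dE) integral_distribution.
Qed.

Lemma moment4_L1 : L1 P (fun w => x0 w ^+ 4).
Proof.
apply/integrableP; split.
  by apply/measurable_EFinP; apply: measurable_funX.
move: X_moment4; rewrite unlock; apply: le_lt_trans.
rewrite le_eqVlt; apply/orP; left; apply/eqP.
apply: eq_integral => w _; rewrite /= ger0_norm//.
by rewrite (exprM _ 2 2) sqr_ge0.
Qed.

Lemma moment_L1 k : (k <= 4)%N -> L1 P (fun w => x0 w ^+ k).
Proof.
move=> k4; apply: (L1_le (g := fun w => 1 + x0 w ^+ 4)).
- exact: measurable_funX.
- by move=> w; exact: norm_exprn_le.
- by apply: L1D; [exact: L1_cst|exact: moment4_L1].
Qed.

Lemma mean_x0 : mean P x0 = 0.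
Proof.
apply: EFin_inj; rewrite -mean_EFin; first by move: X_mean; rewrite unlock.
by have := moment_L1 (isT : (1 <= 4)%N).
Qed.

Lemma mean_x0_sqr : mean P (fun w => x0 w ^+ 2) = 1.
Proof.
apply: EFin_inj; rewrite -mean_EFin; last exact: moment_L1.
rewrite -X_var /variance covariance.unlock X_mean/= unlock.
apply: eq_integral => w _.
change ((x0 w ^+ 2)%:E = ((x0 w - 0) * (x0 w - 0))%:E).
by rewrite subr0 expr2.
Qed.

End iid_entries.

(** * Exponential moments at the moderate deviation scale *)

Section moderate_deviation_mgf.
Context d (T : measurableType d) (R : realType) (P : probability T R).
Variable x0 : T -> R.
Hypotheses (x0_L4 : L1 P (fun w => x0 w ^+ 4)) (mx0 : measurable_fun setT x0)
  (x0_mean : mean P x0 = 0) (x0_sqr : mean P (fun w => x0 w ^+ 2) = 1).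

Let m4 := mean P (fun w => x0 w ^+ 4).

Definition trunc_mgf n s := mean P (fun w => expR (s * trunc n (x0 w))).

Lemma mean_comp_L1 k : (k <= 4)%N -> L1 P (fun w => x0 w ^+ k).
Proof.
move=> k4; apply: (L1_le (g := fun w => 1 + x0 w ^+ 4)).
- exact: measurable_funX.
- by move=> w; exact: norm_exprn_le.
- by apply: L1D => //; exact: L1_cst.
Qed.

Let mtr n : measurable_fun setT (fun w => trunc n (x0 w)).
Proof. by apply: measurableT_comp => //; exact: measurable_trunc. Qed.

Let L1_tr n : L1 P (fun w => trunc n (x0 w)).
Proof.
by apply: (@L1_bounded _ _ _ _ _ (Num.sqrt n%:R)) => // w; exact: norm_trunc_le.
Qed.

Let L1_tr2 n : L1 P (fun w => trunc n (x0 w) ^+ 2).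
Proof.
apply: (@L1_bounded _ _ _ _ _ n%:R); first exact: measurable_funX.
by move=> w; rewrite ger0_norm ?sqr_ge0// trunc_sqr_le.
Qed.

Lemma L1_expR_trunc n s : L1 P (fun w => expR (s * trunc n (x0 w))).
Proof.
apply: (@L1_bounded _ _ _ _ _ (expR (`|s| * Num.sqrt n%:R))).
  by apply: measurableT_comp => //; exact: measurable_funM.
move=> w; rewrite ger0_norm ?expR_ge0// ler_expR.
rewrite (le_trans (ler_norm _))// normrM ler_wpM2l//.
exact: norm_trunc_le.
Qed.

(** The three error terms are the bias of the truncated mean, the defect of the truncated second
    moment, and the third-order Taylor remainder, in which |x|^3 <= 1 + x^4. *)
Lemma trunc_mgf_taylor n s : (0 < n)%N ->
  `|trunc_mgf n s - (1 + s ^+ 2 / 2)| <=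
  `|s| * (m4 / (n%:R * Num.sqrt n%:R)) + s ^+ 2 / 2 * (m4 / n%:R) +
  `|s| ^+ 3 * expR (`|s| * Num.sqrt n%:R) * (1 + m4).
Proof.
move=> n0.
set t := fun w => trunc n (x0 w).
pose Z w := expR (s * t w) - (1 + s * t w + s ^+ 2 / 2 * t w ^+ 2).
have x1 : L1 P x0 := @mean_comp_L1 1 isT.
have Zint : L1 P (fun w => 1 + s * t w + s ^+ 2 / 2 * t w ^+ 2).
  apply: L1D; last exact/L1Z/L1_tr2.
  by apply: L1D; [exact: L1_cst|exact/L1Z/L1_tr].
have Z1 : L1 P Z by apply: L1B => //; exact: L1_expR_trunc.
have ZE : mean P Z = trunc_mgf n s - (1 + s * mean P t + s ^+ 2 / 2 * mean P (fun w => t w ^+ 2)).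
  rewrite /Z meanB//; last exact: L1_expR_trunc.
  rewrite meanD; last 2 first.
  - by apply: L1D; [exact: L1_cst|exact/L1Z/L1_tr].
  - exact/L1Z/L1_tr2.
  rewrite meanD; last 2 first.
  - exact: L1_cst.
  - exact/L1Z/L1_tr.
  by rewrite mean_cst meanZ ?meanZ//; [exact: L1_tr2|exact: L1_tr].
have e1 : `|mean P t| <= m4 / (n%:R * Num.sqrt n%:R).
  rewrite -[mean P t]subr0 -x0_mean -meanB//; last exact: L1_tr.
  have tx : L1 P (fun w => t w - x0 w) by apply: L1B => //; exact: L1_tr.
  rewrite (le_trans (norm_mean tx))// mulrC -meanZ//.
  apply: le_mean; [exact: L1_norm|exact: L1Z|].
  by move=> w; rewrite mulrC; exact: trunc_err.
have e2 : `|1 - mean P (fun w => t w ^+ 2)| <= m4 / n%:R.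
  have x2 : L1 P (fun w => x0 w ^+ 2) by exact: mean_comp_L1.
  have xt : L1 P (fun w => x0 w ^+ 2 - t w ^+ 2) by apply: L1B => //; exact: L1_tr2.
  rewrite -[X in `|X - _|]x0_sqr -meanB//; last exact: L1_tr2.
  rewrite (le_trans (norm_mean xt))// mulrC -meanZ//.
  apply: le_mean; [exact: L1_norm|exact: L1Z|].
  move=> w; have /andP[h1 h2] := trunc_sqr_err (x0 w) n0.
  by rewrite ger0_norm// mulrC.
have e3 : `|mean P Z| <= `|s| ^+ 3 * expR (`|s| * Num.sqrt n%:R) * (1 + m4).
  rewrite (le_trans (norm_mean Z1))//.
  have -> : 1 + m4 = mean P (fun w => 1 + x0 w ^+ 4).
    by rewrite meanD ?mean_cst//; exact: L1_cst.
  have L14 : L1 P (fun w => 1 + x0 w ^+ 4) by apply: L1D => //; exact: L1_cst.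
  rewrite -meanZ//; apply: le_mean; [exact: L1_norm|exact: L1Z|move=> w].
  have := expR_taylor_le 3 (s * t w).
  rewrite !big_ord_recl big_ord0/= !expr0 !expr1 (_ : bump 0 1 = 2%N)//.
  rewrite (_ : _ + _ = 1 + s * t w + s ^+ 2 / 2 * t w ^+ 2); last first.
    by rewrite /= !factS fact0 exprMn; field.
  move=> /le_trans; apply; rewrite normrM exprMn -[leLHS]mulrA -[leRHS]mulrA.
  apply: ler_wpM2l; first by rewrite exprn_ge0.
  rewrite [leRHS]mulrC; apply: ler_pM => //; rewrite ?exprn_ge0 ?expR_ge0//.
    rewrite -normrX; apply: le_trans (norm_exprn_le (x0 w) (isT : (3 <= 4)%N)).
    by rewrite !normrX lerXn2r ?nnegrE// norm_trunc_le_id.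
  by rewrite ler_expR ler_wpM2l// norm_trunc_le.
have -> : trunc_mgf n s - (1 + s ^+ 2 / 2) = mean P Z + s * mean P t
    - s ^+ 2 / 2 * (1 - mean P (fun w => t w ^+ 2)) by rewrite ZE; ring.
rewrite (le_trans (ler_normB _ _))// [leRHS]addrC [leRHS]addrA lerD//.
  by rewrite (le_trans (ler_normD _ _))// lerD// normrM ler_wpM2l.
by rewrite normrM ger0_norm ?divr_ge0 ?sqr_ge0// ler_wpM2l ?divr_ge0 ?sqr_ge0.
Qed.

End moderate_deviation_mgf.

Section asymptotics.
Context (R : realType).

Lemma near_ln_ge (A : R) : \forall n \near \oo, A <= ln n%:R.
Proof.
exists (Num.truncn (expR A)).+1 => // n /= hn.
rewrite -[leLHS]expRK ler_ln ?posrE ?expR_gt0//; last first.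
  by rewrite ltr0n (leq_trans _ hn).
by rewrite (le_trans (ltW (truncnS_gt _)))// ler_nat.
Qed.

Lemma expR_ge_id (x : R) : x <= expR x.
Proof. by rewrite (le_trans _ (expR_ge1Dx x))// lerDr. Qed.

Lemma sqrt_expR (x : R) : Num.sqrt (expR x) = expR (x / 2).
Proof.
rewrite (_ : expR x = expR (x / 2) ^+ 2) ?sqrtr_sqr ?ger0_norm ?expR_ge0//.
by rewrite -expRM_natl; congr expR; field.
Qed.

Lemma sqrt_le_id (x : R) : 1 <= x -> Num.sqrt x <= x.
Proof.
move=> x1; have x0 : 0 <= x by rewrite (le_trans _ x1).
rewrite -(@ler_pXn2r _ 2) ?nnegrE ?sqrtr_ge0// sqr_sqrtr// expr2.
by rewrite ler_peMr.
Qed.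

(* In terms of L = log n, c sqrt L <= c^2 + L/4 while sqrt L <= 8 e^(L/8), so the
   left-hand side is O(e^(-L/8)). *)
Lemma sqrt_ln_div_expR_small (c e : R) : 0 < c -> 0 < e ->
  \forall n \near \oo, c * Num.sqrt (ln n%:R / n%:R) *
    expR (c * Num.sqrt (ln n%:R)) <= e.
Proof.
move=> c0 e0.
near=> n.
have n0 : 0 < n%:R :> R.
  by rewrite ltr0n; near: n; exact: nbhs_infty_gt.
set L := ln n%:R.
have L1 : 1 <= L by rewrite /L; near: n; exact: near_ln_ge.
have L0 : 0 <= L by rewrite (le_trans _ L1).
have LA : 8 * (8 * c * expR (c ^+ 2) / e) <= L by rewrite /L; near: n; exact: near_ln_ge.
rewrite -(lnK n0) -/L sqrtrM// sqrtrV ?expR_ge0// sqrt_expR -expRN.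
have h1 : Num.sqrt L <= 8 * expR (L / 8).
  by rewrite (le_trans (sqrt_le_id L1))// -ler_pdivrMl// mulrC expR_ge_id.
have h2 : c * Num.sqrt L <= c ^+ 2 + L / 4.
  have := sqr_ge0 (c - Num.sqrt L / 2); rewrite sqrrB exprMn sqr_sqrtr// => h.
  by nra.
have h3 : 8 * c * expR (c ^+ 2) * expR (- (L / 8)) <= e.
  rewrite expRN ler_pdivrMr ?expR_gt0// -ler_pdivrMl//.
  rewrite (le_trans _ (expR_ge_id _))// ler_pdivlMr// mulrC.
  by rewrite [e^-1 * _]mulrC.
rewrite (le_trans _ h3)//.
apply: (@le_trans _ _ (c * (8 * expR (L / 8) * expR (- (L / 2))) * expR (c ^+ 2 + L / 4))).
  rewrite ler_pM ?mulr_ge0 ?expR_ge0 ?sqrtr_ge0 ?(ltW c0)//.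
    by rewrite ler_wpM2l ?(ltW c0)// ler_wpM2r ?expR_ge0.
  by rewrite ler_expR.
rewrite le_eqVlt; apply/orP; left; apply/eqP.
rewrite expRD.
transitivity (8 * c * expR (c ^+ 2) * (expR (L / 8) * expR (- (L / 2)) * expR (L / 4))).
  by ring.
by rewrite -!expRD; congr (_ * expR _); field.
Unshelve. all: by end_near. Qed.

End asymptotics.

Section moderate_deviation_mgf_bounds.
Context d (T : measurableType d) (R : realType) (P : probability T R).
Variable x0 : T -> R.
Hypotheses (x0_L4 : L1 P (fun w => x0 w ^+ 4)) (mx0 : measurable_fun setT x0)
  (x0_mean : mean P x0 = 0) (x0_sqr : mean P (fun w => x0 w ^+ 2) = 1).

(** At this scale |s| sqrt n = c sqrt(log n), so the factor |s| beats exp(|s| sqrt n) and each of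
    the three Taylor errors is at most q s^2. The lower bound pays y^2 <= q s^2 more for writing 1 +
    y as an exponential. *)
Lemma trunc_mgf_bounds c e : 0 < c -> 0 < e -> e <= 2^-1 ->
  \forall n \near \oo, forall s, `|s| = c * Num.sqrt (ln n%:R / n%:R) ->
    expR ((2^-1 - e) * s ^+ 2) <= trunc_mgf P x0 n s <= expR ((2^-1 + e) * s ^+ 2).
Proof.
move=> c0 e0 e2; set m4 := mean P (fun w => x0 w ^+ 4).
have m40 : 0 <= m4 by apply: mean_ge0 => w; rewrite (exprM _ 2 2) sqr_ge0.
(* Three Taylor errors and the cost of exponentiating the lower bound share e equally. *)
pose q := e / 4; have q0 : 0 < q by rewrite divr_gt0.
have q1 : q <= 1 by rewrite /q; lra.
near=> n; move=> s sE.
have n0 : (0 < n)%N by near: n; exact: nbhs_infty_gt.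
have nR : 0 < n%:R :> R by rewrite ltr0n.
set L := ln n%:R in sE.
have L1 : 1 <= L by rewrite /L; near: n; exact: near_ln_ge.
have L0 : 0 <= L by rewrite (le_trans _ L1).
have Ln : L <= n%:R by rewrite -[leRHS]lnK ?posrE// expR_ge_id.
have nA : m4 / (q * c) <= n%:R.
  by rewrite (le_trans _ Ln)// /L; near: n; exact: near_ln_ge.
have nB : m4 / q <= n%:R.
  by rewrite (le_trans _ Ln)// /L; near: n; exact: near_ln_ge.
have nC : c * Num.sqrt (L / n%:R) * expR (c * Num.sqrt L) <= q / (1 + m4).
  rewrite /L; near: n; apply: sqrt_ln_div_expR_small => //.
  by rewrite divr_gt0// ltr_pwDl.
have sn : `|s| * Num.sqrt n%:R = c * Num.sqrt L.
  by rewrite sE -mulrA -sqrtrM ?divr_ge0// divfK// gt_eqF.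
have hC : `|s| * expR (`|s| * Num.sqrt n%:R) * (1 + m4) <= q.
  by rewrite sn sE -ler_pdivlMr// ltr_pwDl.
have hB : m4 / n%:R <= q by rewrite ler_pdivrMr// mulrC -ler_pdivrMr.
have sqL : 1 <= Num.sqrt L by rewrite -[leLHS]sqrtr1 ler_sqrt.
have sn0 : 0 < Num.sqrt n%:R :> R by rewrite sqrtr_gt0.
have hA : m4 / (n%:R * Num.sqrt n%:R) <= q * `|s|.
  rewrite ler_pdivrMr ?mulr_gt0//.
  rewrite (_ : q * _ * _ = q * n%:R * (`|s| * Num.sqrt n%:R)); last by ring.
  rewrite sn.
  rewrite (le_trans (y := q * c * n%:R))//; first by rewrite mulrC -ler_pdivrMr ?mulr_gt0.
  rewrite (_ : q * n%:R * _ = q * c * n%:R * Num.sqrt L); last by ring.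
  by rewrite ler_peMr// !mulr_ge0// ltW.
have s1 : `|s| <= q.
  rewrite (le_trans _ hC)// -mulrA ler_peMr// mulr_ege1//.
    by rewrite -expR0 ler_expR mulr_ge0.
  by rewrite lerDl.
have s2 : s ^+ 2 = `|s| ^+ 2 by rewrite real_normK// num_real.
have key : `|trunc_mgf P x0 n s - (1 + s ^+ 2 / 2)| <= 3 * q * s ^+ 2.
  rewrite (le_trans (trunc_mgf_taylor x0_L4 mx0 x0_mean x0_sqr s n0))//.
  rewrite -/m4.
  have t1 : `|s| * (m4 / (n%:R * Num.sqrt n%:R)) <= q * s ^+ 2.
    by rewrite (le_trans (ler_wpM2l (normr_ge0 s) hA))// s2 expr2 mulrCA.
  have t2 : s ^+ 2 / 2 * (m4 / n%:R) <= q * s ^+ 2.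
    have : s ^+ 2 * (m4 / n%:R) <= s ^+ 2 * q by rewrite ler_wpM2l ?sqr_ge0.
    have : 0 <= s ^+ 2 * q by rewrite mulr_ge0 ?sqr_ge0// ltW.
    by nra.
  have t3 : `|s| ^+ 3 * expR (`|s| * Num.sqrt n%:R) * (1 + m4) <= q * s ^+ 2.
    rewrite s2 (_ : _ * _ * _ = (`|s| * expR (`|s| * Num.sqrt n%:R) * (1 + m4)) * `|s| ^+ 2).
      by rewrite ler_wpM2r// sqr_ge0.
    by ring.
  by rewrite (le_trans (lerD (lerD t1 t2) t3))// le_eqVlt; apply/orP; left; apply/eqP; ring.
have := key; rewrite ler_norml => /andP[k1 k2].
have ss0 := sqr_ge0 s.
apply/andP; split; last first.
  apply: le_trans (expR_ge1Dx _); have : 0 <= q * s ^+ 2 by rewrite mulr_ge0// ltW.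
  have : e = 4 * q by rewrite /q; field.
  by move=> -> ?; nra.
set y := (2^-1 - 3 * q) * s ^+ 2.
have y0 : 0 <= y by rewrite mulr_ge0// subr_ge0 /q; lra.
have ylow : 1 + y <= trunc_mgf P x0 n s by rewrite /y; nra.
rewrite (le_trans _ ylow)// (le_trans _ (expR_le_1D y0))// ler_expR.
have y2 : y ^+ 2 <= q * s ^+ 2.
  have ys : y <= s ^+ 2 by rewrite /y ler_piMl//; nra.
  rewrite (le_trans (y := s ^+ 2 * s ^+ 2))//; first by rewrite expr2 ler_pM.
  rewrite ler_wpM2r// s2 expr2 (le_trans (ler_pM _ _ s1 s1))//.
  by rewrite ler_piMl// ltW.
have -> : e = 4 * q by rewrite /q; field.
by rewrite /y in y2 *; nra.
Unshelve. all: by end_near. Qed.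

End moderate_deviation_mgf_bounds.

(** * Chernoff bounds and unions *)

Section chernoff.
Context d (T : measurableType d) (R : realType) (P : probability T R).
Context (X : nat -> nat -> {RV P >-> R}).
Hypotheses (X_iid : iid upper_pairs (entry X))
  (X_mean : ('E_P[X 0%N 1%N] = 0)%E)
  (X_var : ('V_P[X 0%N 1%N] = 1)%E)
  (X_moment4 : ('E_P[fun w => (X 0%N 1%N w ^+ 4)%R] < +oo)%E).

Let x0 : T -> R := X 0%N 1%N.

Definition sym_pair i j : nat * nat := if (i <= j)%N then (i, j) else (j, i).

Definition sentry i j (w : T) : R := sym_entry (fun i j => X i j w) i j.

Lemma sentryE i j w : sentry i j w = entry X (sym_pair i j) w.
Proof. by rewrite /sentry /sym_entry /entry /sym_pair; case: ifP. Qed.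

(** Distinct columns of one row occupy distinct positions of the upper triangle; this is why the
    entries of a row are independent although X_n is symmetric. *)
Lemma sym_pair_inj i : injective (sym_pair i).
Proof.
move=> j k; rewrite /sym_pair.
case: leqP => ij; case: leqP => ik [] // h1 h2; first by rewrite h1 ltnn in ik.
by rewrite h1 ltnn in ij.
Qed.

Lemma sym_pair_upper i j : upper_pairs (sym_pair i j).
Proof. by rewrite /sym_pair; case: (leqP i j) => // ji; exact: ltnW. Qed.

Lemma mean_expR_sum (A : eqType) (r : seq A) (p : A -> nat * nat) (phi : R -> R) :
  uniq r -> {in r &, injective p} -> (forall a, a \in r -> upper_pairs (p a)) ->
  measurable_fun setT phi -> L1 P (fun w => expR (phi (x0 w))) ->
  L1 P (fun w => expR (\sum_(a <- r) phi (entry X (p a) w))) /\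
  mean P (fun w => expR (\sum_(a <- r) phi (entry X (p a) w))) =
    mean P (fun w => expR (phi (x0 w))) ^+ size r.
Proof.
move=> ur pinj pu mphi phi1.
have mE : measurable_fun setT (fun x => expR (phi x)) by exact: measurableT_comp.
have iidE a : a \in r -> _ := fun ar => iid_mean X_iid mE phi1 (pu a ar).
have := @mean_prod_blocks _ _ _ P _ upper_pairs (entry X) X_iid.1 A r
  (fun a => [set p a]) (fun a w => expR (phi (entry X (p a) w))) ur.
case.
- by move=> a ar _ ->; exact: pu.
- move=> a b ar br ab; apply/seteqP; split => // z [/= -> e].
  by case/eqP: ab; exact: pinj.
- move=> a ar; apply: (@rv_measurable_comp _ _ _ _ _ _ _ (entry X (p a)) (fun x => expR (phi x))) => //.
  exact: rv_measurable_coord.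
- by move=> a ar; case: (iidE a ar).
move=> h1 h2.
have -> : (fun w => expR (\sum_(a <- r) phi (entry X (p a) w))) =
    (fun w => \prod_(a <- r) expR (phi (entry X (p a) w))).
  by apply/funext => w; rewrite expR_sum.
split => //.
rewrite h2 (eq_big_seq (fun=> mean P (fun w => expR (phi (x0 w))))).
  by rewrite big_const_seq count_predT iter_mulr_1.
by move=> a ar; case: (iidE a ar).
Qed.

Lemma mean_expR_row_sum N i (r : seq nat) s : uniq r ->
  L1 P (fun w => expR (s * \sum_(j <- r) trunc N (sentry i j w))) /\
  mean P (fun w => expR (s * \sum_(j <- r) trunc N (sentry i j w))) =
    trunc_mgf P x0 N s ^+ size r.
Proof.
move=> ur.
have -> : (fun w => expR (s * \sum_(j <- r) trunc N (sentry i j w))) =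
    (fun w => expR (\sum_(j <- r) s * trunc N (entry X (sym_pair i j) w))).
  apply/funext => w; rewrite mulr_sumr; congr expR.
  by apply: eq_bigr => j _; rewrite sentryE.
apply: (@mean_expR_sum _ r (sym_pair i) (fun x => s * trunc N x)) => //.
- by move=> a b _ _; exact: sym_pair_inj.
- by move=> a _; exact: sym_pair_upper.
- by apply: measurable_funM => //; exact: measurable_trunc.
- exact: L1_expR_trunc.
Qed.

(** The union bound is taken on exponentials: once the sum of exp(f n a) over a is below 1, every f
    n a is negative. *)
Lemma chernoff_borel_cantelli (A : eqType) (r : nat -> seq A)
    (f : nat -> A -> T -> R) (c : nat -> R) M :
  (forall n a, L1 P (fun w => expR (f n a w))) ->
  (forall n, 0 <= c n) -> (forall N, \sum_(n < N) c n <= M) ->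
  (\forall n \near \oo, exists2 m, (size (r n))%:R * m <= c n &
    forall a, a \in r n -> mean P (fun w => expR (f n a w)) <= m) ->
  {ae P, forall w, \forall n \near \oo, forall a, a \in r n -> f n a w < 0}.
Proof.
move=> f1 c0 cM hc.
pose h n w := \sum_(a <- r n) expR (f n a w).
have h1 n : L1 P (h n) by apply: L1_sum.
have h0 n w : 0 <= h n w by apply: sumr_ge0 => a _; exact: expR_ge0.
have : \forall n \near \oo, mean P (h n) <= c n.
  near=> n.
  have [m mc hm] : exists2 m, (size (r n))%:R * m <= c n &
    forall a, a \in r n -> mean P (fun w => expR (f n a w)) <= m by near: n.
  rewrite (le_trans _ mc)// mean_sum//.
  rewrite -[in leRHS](count_predT (r n)) mulr_natl -iter_addr_0 -big_const_seq.
  by rewrite big_seq [in leRHS]big_seq; apply: ler_sum.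
move=> /(borel_cantelli_mean h1 h0 c0 cM); apply: filterS => w.
apply: filterS => n hn a ar.
rewrite -expR_lt1 (le_lt_trans _ hn)// /h (big_rem a ar)/= lerDl.
by apply: sumr_ge0 => b _; exact: expR_ge0.
Unshelve. all: by end_near. Qed.

End chernoff.

(** * Size of entries and columns *)

Section entry_bounds.
Context d (T : measurableType d) (R : realType) (P : probability T R).
Context (X : nat -> nat -> {RV P >-> R}).
Hypotheses (X_iid : iid upper_pairs (entry X))
  (X_mean : ('E_P[X 0%N 1%N] = 0)%E)
  (X_var : ('V_P[X 0%N 1%N] = 1)%E)
  (X_moment4 : ('E_P[fun w => (X 0%N 1%N w ^+ 4)%R] < +oo)%E).

Let x0 : T -> R := X 0%N 1%N.

Lemma expR_Nln2_le n : (0 < n)%N ->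
  expR (- (2 * ln n%:R)) <= 4 * (n.+1%:R ^+ 2)^-1 :> R.
Proof.
move=> n0; have nR : 0 < n%:R :> R by rewrite ltr0n.
rewrite expRN expRM_natl lnK// -ler_pdivrMl// -invfM lef_pV2 ?posrE ?mulr_gt0 ?exprn_gt0//.
rewrite (_ : 4 = 2 ^+ 2) -?exprMn ?lerXn2r ?nnegrE//; last by ring.
by rewrite -natrM ler_nat mul2n -addnn -addn1 leq_add2l.
Qed.

Lemma chernoff_borel_cantelli_sqr (A : eqType) (r : nat -> seq A)
    (f : nat -> A -> T -> R) C : 0 <= C ->
  (forall n a, L1 P (fun w => expR (f n a w))) ->
  (\forall n \near \oo, exists2 m,
    (size (r n))%:R * m <= C * expR (- (2 * ln n%:R)) &
    forall a, a \in r n -> mean P (fun w => expR (f n a w)) <= m) ->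
  {ae P, forall w, \forall n \near \oo, forall a, a \in r n -> f n a w < 0}.
Proof.
move=> C0 f1 hf.
apply: (@chernoff_borel_cantelli _ _ _ P A r f
  (fun n => C * 4 * (n.+1%:R ^+ 2)^-1) (C * 4 * 2)) => //.
- by move=> n; rewrite mulr_ge0 ?invr_ge0 ?sqr_ge0// mulr_ge0.
- by move=> N; rewrite -mulr_sumr ler_wpM2l ?mulr_ge0// sum_inv_sqr_le.
- near=> n.
  have [m mC hm] : exists2 m, (size (r n))%:R * m <= C * expR (- (2 * ln n%:R)) &
    forall a, a \in r n -> mean P (fun w => expR (f n a w)) <= m by near: n.
  exists m => //; rewrite (le_trans mC)// -mulrA ler_wpM2l// expR_Nln2_le//.
  by near: n; exact: nbhs_infty_gt.
Unshelve. all: by end_near. Qed.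

(** At y = x0^2 this is where the fourth moment enters: the sum of n + 1 over all n < x0^2 is at
    most (x0^2 + 1)^2, which is integrable. *)
Let sum_below_le (y : R) m : 0 <= y ->
  \sum_(j < m) j.+1%:R * (j%:R < y)%R%:R <= (y + 1) ^+ 2.
Proof.
move=> y0.
have tri k : \sum_(j < k) j.+1%:R = k%:R * (k%:R + 1) / 2 :> R.
  elim: k => [|k IH]; first by rewrite big_ord0 !mul0r.
  by rewrite big_ord_recr/= IH -natr1; field.
elim: m => [|m IH]; first by rewrite big_ord0 sqr_ge0.
rewrite big_ord_recr/=; case: (ltP m%:R y) => my; last by rewrite mulr0 addr0.
rewrite mulr1.
apply: (@le_trans _ _ (\sum_(j < m.+1) j.+1%:R)).
  rewrite big_ord_recr/= lerD2r; apply: ler_sum => j _.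
  by case: (_ < _)%R; rewrite ?mulr1// mulr0.
rewrite tri -natr1; have m0 : 0 <= m%:R :> R by [].
by nra.
Qed.

Let big n (x : R) : R := (n%:R < x ^+ 2)%R%:R.

Let mbig n : measurable_fun setT (big n).
Proof.
rewrite (_ : big n = fun x => if (n%:R < x ^+ 2)%R then 1 else 0).
  apply: measurable_fun_if => //.
  by apply: measurable_fun_ltr => //; exact: measurable_funX.
by apply/funext => x; rewrite /big; case: ifP.
Qed.

(** Column j is tested against its own index, so that one event per column serves all N > j. Its j +
    1 entries exceed the level in expected numbers that are summable by the fourth moment. *)
Lemma entries_truncated : {ae P, forall w, \forall N \near \oo,
  forall i j, (i <= j < N)%N -> X i j w ^+ 2 <= N%:R}.
Proof.
have x4 := moment4_L1 X_moment4.
have x2 : L1 P (fun w => x0 w ^+ 2) := moment_L1 X_moment4 (isT : (2 <= 4)%N).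
have big1 n : L1 P (fun w => big n (x0 w)).
  apply: (@L1_bounded _ _ _ _ _ 1); first exact: measurableT_comp.
  by move=> w; rewrite /big normr_nat; case: (_ < _)%R.
pose h n w := \sum_(i < n.+1) big n (X i n w).
have bigX n (i : 'I_n.+1) : L1 P (fun w => big n (X i n w)) /\
    mean P (fun w => big n (X i n w)) = mean P (fun w => big n (x0 w)).
  have := @iid_mean _ _ _ P X X_iid (big n) (nat_of_ord i, n) (mbig n) (big1 n).
  by apply; rewrite /upper_pairs/= -ltnS.
have h1 n : L1 P (h n) by apply: L1_sum => i _; case: (bigX n i).
have h0 n w : 0 <= h n w by apply: sumr_ge0.
pose c n := mean P (fun w => n.+1%:R * big n (x0 w)).
have c1 n : L1 P (fun w => n.+1%:R * big n (x0 w)) by exact: L1Z.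
have c0 n : 0 <= c n by apply: mean_ge0 => w; rewrite mulr_ge0.
have q1 : L1 P (fun w => (x0 w ^+ 2 + 1) ^+ 2).
  rewrite (_ : (fun w => _) = (fun w => x0 w ^+ 4 + 2 * x0 w ^+ 2 + 1)).
    by apply: L1D; [apply: L1D => //; exact: L1Z|exact: L1_cst].
  by apply/funext => w; ring.
have cM N : \sum_(n < N) c n <= mean P (fun w => (x0 w ^+ 2 + 1) ^+ 2).
  rewrite /c -mean_sum//; apply: le_mean => //; first exact: L1_sum.
  by move=> w; apply: sum_below_le; exact: sqr_ge0.
have hc n : mean P (h n) <= c n.
  rewrite /h mean_sum; last by move=> i _; case: (bigX n i).
  rewrite (eq_bigr (fun=> mean P (fun w => big n (x0 w)))); last first.
    by move=> i _; case: (bigX n i).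
  by rewrite sumr_const card_ord -mulr_natl /c meanZ.
have hcn : \forall n \near \oo, mean P (h n) <= c n by exact: nearW.
have := borel_cantelli_mean h1 h0 c0 cM hcn.
apply: filterS => w [n0 _ hn0].
(* The finitely many columns before n0 are covered once N exceeds the sum of their squared
   entries. *)
pose B : R := \sum_(j < n0) \sum_(i < j.+1) X i j w ^+ 2.
near=> N => i j /andP[ij jN].
have [jn0|jn0] := leqP n0 j.
  have := hn0 j jn0; rewrite /h (bigD1 (Ordinal (ij : (i < j.+1)%N)))//=.
  rewrite {1}/big; case: (ltP j%:R (X i j w ^+ 2)) => //= xj.
    by rewrite -[X in _ < X]addr0 ltrD2l ltNge sumr_ge0.
  by move=> _; rewrite (le_trans xj)// ler_nat ltnW.
rewrite (@le_trans _ _ B)//; last first.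
  rewrite (le_trans (ltW (truncnS_gt B)))// ler_nat.
  by near: N; exact: nbhs_infty_gt.
rewrite /B (bigD1 (Ordinal jn0))//= (bigD1 (Ordinal (ij : (i < j.+1)%N)))//=.
rewrite -addrA lerDl addr_ge0//; first by apply: sumr_ge0 => k _; exact: sqr_ge0.
by apply: sumr_ge0 => k _; apply: sumr_ge0 => l _; exact: sqr_ge0.
Unshelve. all: by end_near. Qed.

(** With th = log n / (2 n), a truncated entry has th x^2 <= log n / 2. The second-order Taylor
    error th^2 sqrt n E x^4 is then at most 1 / n, and fewer than n factors give at most exp(log n /
    2 + 1). The threshold 8 n becomes 4 log n after multiplication by th, which leaves a tail of
    order n^(-7/2) per column. *)
Lemma columns_bounded : {ae P, forall w, \forall n \near \oo,
  forall k, (k < n)%N -> \sum_(i < k) trunc n (X i k w) ^+ 2 < 8 * n%:R}.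
Proof.
have x4 := moment4_L1 X_moment4.
have mx0 : measurable_fun setT x0 by [].
have x2 : L1 P (fun w => x0 w ^+ 2) := moment_L1 X_moment4 (isT : (2 <= 4)%N).
set m := mean P (fun w => x0 w ^+ 4).
have mtr n : measurable_fun setT (fun w => trunc n (x0 w)).
  by apply: measurableT_comp => //; exact: measurable_trunc.
pose th n : R := ln n%:R / (2 * n%:R).
pose phi n (x : R) := th n * trunc n x ^+ 2.
have th0 n : 0 <= th n.
  rewrite /th divr_ge0 ?mulr_ge0//; case: n => [|n]; first by rewrite ln0.
  by rewrite ln_ge0// ler1n.
have mphi n : measurable_fun setT (phi n).
  apply: measurable_funM => //; apply: measurable_funX; exact: measurable_trunc.
have phile n x : phi n x <= th n * n%:R by rewrite ler_wpM2l// trunc_sqr_le.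
have phi0 n x : 0 <= phi n x by rewrite mulr_ge0// sqr_ge0.
have phi1 n : L1 P (fun w => expR (phi n (x0 w))).
  apply: (@L1_bounded _ _ _ _ _ (expR (th n * n%:R))).
    by apply: measurableT_comp => //; exact: measurableT_comp.
  by move=> w; rewrite ger0_norm ?expR_ge0// ler_expR.
have col n k : L1 P (fun w => expR (\sum_(i <- iota 0 k) phi n (X i k w))) /\
    mean P (fun w => expR (\sum_(i <- iota 0 k) phi n (X i k w))) =
    mean P (fun w => expR (phi n (x0 w))) ^+ k.
  have := @mean_expR_sum _ _ _ P X X_iid _ (iota 0 k) (fun i => (i, k)) (phi n)
    (iota_uniq 0 k); rewrite size_iota; apply => //.
  - by move=> i j _ _ [].
  - by move=> i; rewrite mem_iota add0n /upper_pairs/= => /ltnW.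
pose f n k w := \sum_(i <- iota 0 k) phi n (X i k w) - 4 * ln n%:R.
have fE n k : (fun w => expR (f n k w)) = (fun w => expR (- (4 * ln n%:R)) *
    expR (\sum_(i <- iota 0 k) phi n (X i k w))).
  by apply/funext => w; rewrite /f addrC expRD.
have f1 n k : L1 P (fun w => expR (f n k w)).
  by rewrite fE; apply: L1Z; case: (col n k).
have q_le : \forall n \near \oo, mean P (fun w => expR (phi n (x0 w))) <=
    1 + (ln n%:R / 2 + 1) / n%:R.
  near=> n; have n0 : (0 < n)%N by near: n; exact: nbhs_infty_gt.
  have nR : 0 < n%:R :> R by rewrite ltr0n.
  set L := ln n%:R.
  have L0 : 0 <= L by rewrite /L; near: n; exact: near_ln_ge.
  have Lm : 4 * (16 * m) <= L by rewrite /L; near: n; exact: near_ln_ge.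
  have thn : th n * n%:R = L / 2 by rewrite /th -/L; field; rewrite gt_eqF.
  have b1 : L1 P (fun w => 1 + th n * x0 w ^+ 2).
    by apply: L1D; [exact: L1_cst|exact: L1Z].
  have b2 : L1 P (fun w => th n ^+ 2 * expR (L / 2) * x0 w ^+ 4) by exact: L1Z.
  apply: (@le_trans _ _ (mean P (fun w => 1 + th n * x0 w ^+ 2
      + th n ^+ 2 * expR (L / 2) * x0 w ^+ 4))).
    apply: le_mean => //; first exact: L1D.
    move=> w; have := expR_taylor_le 2 (phi n (x0 w)).
    rewrite !big_ord_recl big_ord0/= !expr0 expr1 fact0 !divr1 addr0.
    rewrite (ger0_norm (phi0 _ _)) => /(le_trans (ler_norm _)).
    rewrite lerBlDl => /le_trans; apply.
    have tx : trunc n (x0 w) ^+ 2 <= x0 w ^+ 2.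
      rewrite -[leLHS]real_normK ?num_real// -[leRHS]real_normK ?num_real//.
      by rewrite lerXn2r ?nnegrE// norm_trunc_le_id.
    have px : phi n (x0 w) <= th n * x0 w ^+ 2 by rewrite ler_wpM2l.
    rewrite lerD//; first by rewrite lerD2l.
    rewrite (_ : _ * x0 w ^+ 4 = (th n * x0 w ^+ 2) ^+ 2 * expR (L / 2)).
      apply: ler_pM; [exact: sqr_ge0|exact: expR_ge0| |by rewrite ler_expR -thn].
      by rewrite lerXn2r ?nnegrE// mulr_ge0// sqr_ge0.
    by ring.
  rewrite meanD// meanD ?mean_cst; [|exact: L1_cst|exact: L1Z].
  rewrite !meanZ// (mean_x0_sqr X_mean X_var X_moment4) -/m mulr1 -addrA lerD2l.
  have h1 : L ^+ 2 * m <= 4 * expR (L / 2).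
    have l1 : L <= 8 * expR (L / 8).
      by rewrite -ler_pdivrMl// mulrC expR_ge_id.
    have l2 : 16 * m <= expR (L / 4).
      by rewrite (le_trans _ (expR_ge_id _))// ler_pdivlMr// mulrC.
    have m0 : 0 <= m by apply: mean_ge0 => w; rewrite (exprM _ 2 2) sqr_ge0.
    have l3 : L ^+ 2 <= 64 * expR (L / 4).
      rewrite (le_trans (y := (8 * expR (L / 8)) ^+ 2))//.
        by rewrite lerXn2r ?nnegrE// mulr_ge0 ?expR_ge0.
      rewrite exprMn -expRM_natl (_ : 2%:R * (L / 8) = L / 4); last by field.
      by rewrite (_ : 8 ^+ 2 = 64)//; ring.
    have -> : L / 2 = L / 4 + L / 4 by field.
    rewrite expRD (le_trans (ler_wpM2r m0 l3))//.
    have := ler_wpM2l (expR_ge0 (L / 4)) l2; nra.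
  have h2 : th n ^+ 2 * expR (L / 2) * m <= n%:R^-1.
    rewrite -(@ler_pM2r _ (4 * n%:R ^+ 2)) ?mulr_gt0 ?exprn_gt0//.
    have -> : th n ^+ 2 * expR (L / 2) * m * (4 * n%:R ^+ 2) =
        4 * (th n * n%:R) ^+ 2 * m * expR (L / 2) by ring.
    have -> : n%:R^-1 * (4 * n%:R ^+ 2) = 4 * n%:R :> R.
      by field; rewrite gt_eqF.
    rewrite thn -[in leRHS](lnK nR) -/L (_ : 4 * (L / 2) ^+ 2 * m = L ^+ 2 * m); last by field.
    rewrite (_ : expR L = expR (L / 2) * expR (L / 2)); last first.
      by rewrite -expRD; congr expR; field.
    by rewrite mulrA ler_wpM2r// expR_ge0.
  rewrite mulrDl mul1r lerD// /th -/L le_eqVlt; apply/orP; left; apply/eqP.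
  by field; rewrite gt_eqF.
have hyp : \forall n \near \oo, exists2 q,
    (size (iota 0 n))%:R * q <= expR 1 * expR (- (2 * ln n%:R)) &
    forall k, k \in iota 0 n -> mean P (fun w => expR (f n k w)) <= q.
  near=> n; exists (expR (1 - 7 / 2 * ln n%:R)).
    have n0 : 0 < n%:R :> R by rewrite ltr0n; near: n; exact: nbhs_infty_gt.
    have L0 : 0 <= ln n%:R :> R by near: n; exact: near_ln_ge.
    rewrite size_iota -[X in X * _](lnK n0) -!expRD ler_expR; nra.
  have qn : mean P (fun w => expR (phi n (x0 w))) <= 1 + (ln n%:R / 2 + 1) / n%:R.
    by near: n.
  have n0 : (0 < n)%N by near: n; exact: nbhs_infty_gt.
  have nR : 0 < n%:R :> R by rewrite ltr0n.
  have L0 : 0 <= ln n%:R :> R by near: n; exact: near_ln_ge.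
  move=> k; rewrite mem_iota add0n => /andP[_ kn].
  rewrite fE meanZ; last by case: (col n k).
  rewrite (col n k).2.
  have q0 : 0 <= mean P (fun w => expR (phi n (x0 w))).
    by apply: mean_ge0 => w; exact: expR_ge0.
  have : mean P (fun w => expR (phi n (x0 w))) ^+ k <= expR (ln n%:R / 2 + 1).
    apply: (@le_trans _ _ (expR ((ln n%:R / 2 + 1) / n%:R) ^+ k)).
      by rewrite lerXn2r ?nnegrE ?expR_ge0// (le_trans qn)// expR_ge1Dx.
    rewrite -expRM_natl ler_expR mulrA ler_pdivrMr// mulrC ler_wpM2l ?ler_nat ?(ltnW kn)//.
    by rewrite addr_ge0// divr_ge0.
  move=> /(ler_wpM2l (expR_ge0 (- (4 * ln n%:R)))) /le_trans; apply.
  rewrite -expRD ler_expR; lra.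
have := chernoff_borel_cantelli_sqr (expR_ge0 1) f1 hyp.
apply: filterS => w hw; near=> n => k kn.
have n0 : (0 < n)%N by near: n; exact: nbhs_infty_gt.
have nR : 0 < n%:R :> R by rewrite ltr0n.
have L0 : 1 <= ln n%:R :> R by near: n; exact: near_ln_ge.
have : f n k w < 0.
  have : forall k, k \in iota 0 n -> f n k w < 0 by near: n.
  by apply; rewrite mem_iota add0n.
rewrite /f subr_lt0 -mulr_sumr /th mulrAC ltr_pdivrMr ?mulr_gt0//.
rewrite mulrC (_ : 4 * _ * _ = 8 * n%:R * ln n%:R); last by ring.
rewrite ltr_pM2r ?(lt_le_trans _ L0)// => h.
by rewrite -(big_mkord xpredT (fun i => trunc n (X i k w) ^+ 2)) /index_iota subn0.
Unshelve. all: by end_near. Qed.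

End entry_bounds.
(** * Row sums *)

Section row_sums.
Context d (T : measurableType d) (R : realType) (P : probability T R).
Context (X : nat -> nat -> {RV P >-> R}).
Hypotheses (X_iid : iid upper_pairs (entry X))
  (X_mean : ('E_P[X 0%N 1%N] = 0)%E)
  (X_var : ('V_P[X 0%N 1%N] = 1)%E)
  (X_moment4 : ('E_P[fun w => (X 0%N 1%N w ^+ 4)%R] < +oo)%E).

Let x0 : T -> R := X 0%N 1%N.

Definition row_range (i lo hi : nat) : seq nat :=
  [seq j <- index_iota lo hi | j != i].

Definition trunc_row_sum N i lo hi w : R :=
  \sum_(j <- row_range i lo hi) trunc N (sentry X i j w).

Definition sgn_of (b : bool) : R := if b then 1 else -1.

Let norm_sgn b : `|sgn_of b| = 1.
Proof. by case: b; rewrite /= ?normrN normr1. Qed.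

Lemma row_range_uniq i lo hi : uniq (row_range i lo hi).
Proof. by rewrite filter_uniq// iota_uniq. Qed.

Lemma size_row_range i lo hi : (size (row_range i lo hi) <= hi - lo)%N.
Proof. by rewrite size_filter (leq_trans (count_size _ _))// size_iota. Qed.

Let tail N i lo hi s b w := s * trunc_row_sum N i lo hi w - b.

Let tailE N i lo hi s b : (fun w => expR (tail N i lo hi s b w)) =
  (fun w => expR (- b) * expR (s * trunc_row_sum N i lo hi w)).
Proof. by apply/funext => w; rewrite /tail addrC expRD. Qed.

Let tail_L1 N i lo hi s b : L1 P (fun w => expR (tail N i lo hi s b w)).
Proof.
rewrite tailE; apply: L1Z.
by have [] := mean_expR_row_sum X_iid N i s (row_range_uniq i lo hi).
Qed.

Let mean_tail_le N i lo hi s b q (m : R) : 0 <= q -> (hi - lo)%:R <= m ->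
  trunc_mgf P x0 N s <= expR q ->
  mean P (fun w => expR (tail N i lo hi s b w)) <= expR (q * m - b).
Proof.
move=> q0 hm hq.
have [r1 rE] := mean_expR_row_sum X_iid N i s (row_range_uniq i lo hi).
rewrite tailE meanZ// rE addrC expRD ler_wpM2l ?expR_ge0//.
have mgf0 : 0 <= trunc_mgf P x0 N s by apply: mean_ge0 => w; exact: expR_ge0.
apply: (@le_trans _ _ (expR q ^+ size (row_range i lo hi))).
  by rewrite lerXn2r ?nnegrE ?expR_ge0.
rewrite -expRM_natl ler_expR mulrC ler_wpM2l// (le_trans _ hm)// ler_nat.
exact: size_row_range.
Qed.

Let norm_lt_of_tails N i lo hi s b t w : 0 < s -> s * t = b ->
  (forall sg, tail N i lo hi (sgn_of sg * s) b w < 0) ->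
  `|trunc_row_sum N i lo hi w| < t.
Proof.
move=> s0 st h; have h1 := h true; have h2 := h false.
rewrite /tail /= mul1r -st subr_lt0 ltr_pM2l// in h1.
rewrite /tail /= mulN1r mulNr -mulrN -st subr_lt0 ltr_pM2l// in h2.
by rewrite ltr_norml h1 ltrNl h2.
Qed.

Let sqrt_scale (L n : R) : 0 <= L -> 0 < n ->
  Num.sqrt (L / n) * Num.sqrt (n * L) = L.
Proof.
move=> L0 n0; rewrite -sqrtrM ?divr_ge0 ?(ltW n0)//.
rewrite (_ : L / n * (n * L) = L ^+ 2) ?sqrtr_sqr ?ger0_norm//.
by field; rewrite gt_eqF.
Qed.

(** A range of length N / K has variance smaller by the factor K, which allows a tilt with a large
    constant. Signs, rows and endpoints number at most 8 N^3, against tails N^(-5). *)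
Lemma short_row_sums e : 0 < e -> exists2 K, (0 < K)%N &
  {ae P, forall w, \forall N \near \oo, forall i lo hi,
    (i < N)%N -> (hi <= N)%N -> (K * (hi - lo) <= N)%N ->
    `|trunc_row_sum N i lo hi w| < e * Num.sqrt (N%:R * ln N%:R)}.
Proof.
(* With s = c sqrt(log N / N) and t = e sqrt(N log N) this makes s t = 6 log N, while K >= c^2 keeps
   the logarithm of the moment generating function of a range below log N. *)
move=> e0; pose c := 6 / e; have c0 : 0 < c by rewrite divr_gt0.
pose K := (Num.truncn (c ^+ 2)).+1; exists K => //.
have cK : c ^+ 2 <= K%:R by rewrite ltW// truncnS_gt.
pose s N := c * Num.sqrt (ln N%:R / N%:R) : R.
pose f N (a : (bool * nat) * (nat * nat)) w :=
  tail N a.1.2 a.2.1 a.2.2 (sgn_of a.1.1 * s N) (6 * ln N%:R) w.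
pose r N := [seq a <- allpairs pair (allpairs pair [:: true; false] (iota 0 N))
   (allpairs pair (iota 0 N.+1) (iota 0 N.+1)) | (K * (a.2.2 - a.2.1) <= N)%N].
have x4 := moment4_L1 X_moment4.
have mx0 : measurable_fun setT x0 by [].
have hyp : \forall N \near \oo, exists2 q,
    (size (r N))%:R * q <= 8 * expR (- (2 * ln N%:R)) &
    forall a, a \in r N -> mean P (fun w => expR (f N a w)) <= q.
  near=> N; exists (expR (- (5 * ln N%:R))).
    have n0 : (0 < N)%N by near: N; exact: nbhs_infty_gt.
    have nR : 0 < N%:R :> R by rewrite ltr0n.
    have sz : (size (r N) <= 8 * N ^ 3)%N.
      rewrite size_filter (leq_trans (count_size _ _))// !size_allpairs !size_iota/=.
      have h : (N.+1 <= 2 * N)%N by rewrite mul2n -addnn -addn1 leq_add2l.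
      rewrite (leq_trans (leq_mul (leqnn _) (leq_mul h h)))//.
      by rewrite leq_eqVlt; apply/orP; left; apply/eqP; ring.
    apply: (@le_trans _ _ ((8 * N ^ 3)%N%:R * expR (- (5 * ln N%:R)))).
      by rewrite ler_wpM2r ?expR_ge0// ler_nat.
    rewrite natrM natrX -mulrA ler_wpM2l// -[X in X ^+ 3](lnK nR) -expRM_natl.
    by rewrite -expRD ler_expR; lra.
  have n0 : (0 < N)%N by near: N; exact: nbhs_infty_gt.
  have nR : 0 < N%:R :> R by rewrite ltr0n.
  have L0 : 0 <= ln N%:R :> R by near: N; exact: near_ln_ge.
  have mgf : forall t, `|t| = c * Num.sqrt (ln N%:R / N%:R) ->
      expR ((2^-1 - 2^-1) * t ^+ 2) <= trunc_mgf P x0 N t <=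
      expR ((2^-1 + 2^-1) * t ^+ 2).
    near: N; apply: trunc_mgf_bounds => //; first exact: mean_x0 X_moment4.
    exact: mean_x0_sqr X_moment4.
  move=> [[b i] [lo hi]]; rewrite mem_filter/= => /andP[KN _].
  have sb : `|sgn_of b * s N| = c * Num.sqrt (ln N%:R / N%:R).
    by rewrite normrM norm_sgn mul1r ger0_norm// mulr_ge0// ?(ltW c0)// sqrtr_ge0.
  have /andP[_ up] := mgf _ sb.
  apply: (le_trans (@mean_tail_le N i lo hi _ (6 * ln N%:R) _ (N%:R / K%:R) _ _ up)).
  - by rewrite mulr_ge0 ?sqr_ge0// addr_ge0.
  - rewrite ler_pdivlMr ?ltr0n// mulrC -natrM ler_nat//.
  have sq : (sgn_of b * s N) ^+ 2 = c ^+ 2 * (ln N%:R / N%:R).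
    rewrite -real_normK ?num_real// sb exprMn sqr_sqrtr// divr_ge0//.
  rewrite sq ler_expR lerBlDr (_ : _ * _ * _ = c ^+ 2 / K%:R * ln N%:R); last first.
    by field; rewrite !gt_eqF// ltr0n.
  have : c ^+ 2 / K%:R * ln N%:R <= 1 * ln N%:R.
    by rewrite ler_wpM2r// ler_pdivrMr ?ltr0n// mul1r.
  by lra.
have f1 N a : L1 P (fun w => expR (f N a w)) by exact: tail_L1.
have := chernoff_borel_cantelli_sqr (ler0n _ 8) f1 hyp.
apply: filterS => w hw; near=> N => i lo hi iN hiN KN.
have n0 : (0 < N)%N by near: N; exact: nbhs_infty_gt.
have nR : 0 < N%:R :> R by rewrite ltr0n.
have L0 : 1 <= ln N%:R :> R by near: N; exact: near_ln_ge.
have Lp : 0 < ln N%:R :> R by rewrite (lt_le_trans _ L0).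
have all_neg : forall a, a \in r N -> f N a w < 0 by near: N.
(* The list [r N] has lo <= N only; beyond that the range is empty. *)
have [loN|Nlo] := leqP lo N; last first.
  rewrite /trunc_row_sum /row_range /index_iota.
  have -> : (hi - lo = 0)%N by apply/eqP; rewrite subn_eq0 (leq_trans hiN)// ltnW.
  by rewrite big_nil normr0 mulr_gt0// sqrtr_gt0 mulr_gt0.
apply: (@norm_lt_of_tails N i lo hi (s N) (6 * ln N%:R)).
- by rewrite mulr_gt0// sqrtr_gt0 divr_gt0.
- rewrite /s mulrACA sqrt_scale ?(ltW Lp)//.
  by rewrite /c divfK// gt_eqF.
- move=> b; have := all_neg ((b, i), (lo, hi)); apply.
  rewrite mem_filter; apply/andP; split => //.
  by apply: allpairs_f; apply: allpairs_f; rewrite ?mem_iota//; case: (b).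
Unshelve. all: by end_near. Qed.

Lemma near_exp_nat p (Q : nat -> Prop) : (0 < p)%N ->
  (\forall n \near \oo, Q n) -> \forall k \near \oo, Q (k ^ p)%N.
Proof.
move=> p0 [n0 _ h]; exists n0 => // k /= nk; apply: h => /=.
case: k nk => [|k] nk; first by rewrite (leq_trans nk).
by rewrite (leq_trans nk)// -{1}[k.+1]expn1 leq_pexp2l.
Qed.

(** The tilt (1 + e) sqrt(2 log N / N) gives tails N^(-1-e). The union over rows leaves N^(-e) =
    k^(-e p), summable because e p >= 2. *)
Lemma row_sums_along_powers e p : 0 < e -> 2 <= e * p%:R ->
  {ae P, forall w, \forall k \near \oo, forall i, (i < k ^ p)%N ->
    `|trunc_row_sum (k ^ p) i 0 (k ^ p) w| <
      (1 + e) * Num.sqrt (2 * ((k ^ p)%:R * ln (k ^ p)%:R))}.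
Proof.
move=> e0 ep.
have p0 : (0 < p)%N by case: p ep => //; rewrite mulr0 => h; exfalso; lra.
pose c : R := (1 + e) * Num.sqrt 2.
have e1 : 0 < 1 + e by rewrite ltr_pwDl// ltW.
have c0 : 0 < c by rewrite mulr_gt0// sqrtr_gt0.
have c2 : c ^+ 2 = 2 * (1 + e) ^+ 2 by rewrite exprMn sqr_sqrtr// mulrC.
(* Solves (1 - 2 eta)(1 + e)^2 = 1 + e. *)
pose eta := e / (2 * (1 + e)).
have eta0 : 0 < eta by rewrite divr_gt0// mulr_gt0.
have eta2 : eta <= 2^-1.
  by rewrite /eta ler_pdivrMr ?mulr_gt0// mulKf// lerDr.
pose s N := c * Num.sqrt (ln N%:R / N%:R) : R.
pose f k (a : bool * nat) w := tail (k ^ p) a.2 0 (k ^ p)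
  (sgn_of a.1 * s (k ^ p)%N) (2 * (1 + e) ^+ 2 * ln (k ^ p)%:R) w.
pose r k := allpairs pair [:: true; false] (iota 0 (k ^ p)).
have x4 := moment4_L1 X_moment4.
have mx0 : measurable_fun setT x0 by [].
have mgfN : \forall N \near \oo, forall t, `|t| = c * Num.sqrt (ln N%:R / N%:R) ->
    expR ((2^-1 - eta) * t ^+ 2) <= trunc_mgf P x0 N t <=
    expR ((2^-1 + eta) * t ^+ 2).
  apply: trunc_mgf_bounds => //; first exact: mean_x0 X_moment4.
  exact: mean_x0_sqr X_moment4.
have mgfk := near_exp_nat p0 mgfN.
have hyp : \forall k \near \oo, exists2 q,
    (size (r k))%:R * q <= 2 * expR (- (2 * ln k%:R)) &
    forall a, a \in r k -> mean P (fun w => expR (f k a w)) <= q.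
  near=> k; set N := (k ^ p)%N.
  have k0 : (0 < k)%N by near: k; exact: nbhs_infty_gt.
  have kR : 0 < k%:R :> R by rewrite ltr0n.
  have n0 : (0 < N)%N by rewrite expn_gt0 k0.
  have nR : 0 < N%:R :> R by rewrite ltr0n.
  have lk0 : 0 <= ln k%:R :> R by rewrite ln_ge0// ler1n.
  have LN : ln N%:R = p%:R * ln k%:R :> R by rewrite natrX lnXn// mulr_natl.
  have L0 : 0 <= ln N%:R :> R by rewrite LN mulr_ge0.
  exists (expR (- ((1 + e) * ln N%:R))).
    rewrite size_allpairs size_iota/= natrM -mulrA ler_wpM2l//.
    rewrite -[X in X * _](lnK nR) -expRD ler_expR.
    have : 2 * ln k%:R <= e * p%:R * ln k%:R by rewrite ler_wpM2r.
    by rewrite -mulrA -LN; lra.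
  have mgf : forall t, `|t| = c * Num.sqrt (ln N%:R / N%:R) ->
      expR ((2^-1 - eta) * t ^+ 2) <= trunc_mgf P x0 N t <=
      expR ((2^-1 + eta) * t ^+ 2).
    by rewrite /N; near: k; exact: mgfk.
  move=> [b i] _ /=.
  have sb : `|sgn_of b * s N| = c * Num.sqrt (ln N%:R / N%:R).
    by rewrite normrM norm_sgn mul1r ger0_norm// mulr_ge0// ?(ltW c0)// sqrtr_ge0.
  have /andP[_ up] := mgf _ sb.
  apply: (le_trans (@mean_tail_le N i 0 N _ (2 * (1 + e) ^+ 2 * ln N%:R) _ N%:R _ _ up)).
  - by rewrite mulr_ge0 ?sqr_ge0// addr_ge0// ltW.
  - by rewrite subn0.
  have sq : (sgn_of b * s N) ^+ 2 = c ^+ 2 * (ln N%:R / N%:R).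
    by rewrite -real_normK ?num_real// sb exprMn sqr_sqrtr// divr_ge0.
  rewrite sq c2 ler_expR.
  rewrite (_ : _ * _ - _ = - ((1 + e) * ln N%:R)) ?lexx//.
  by rewrite /eta; field; rewrite !gt_eqF.
have f1 k a : L1 P (fun w => expR (f k a w)) by exact: tail_L1.
have := chernoff_borel_cantelli_sqr (ler0n _ 2) f1 hyp.
apply: filterS => w hw; near=> k => i iN; set N := (k ^ p)%N in iN *.
have k1 : (1 < k)%N by near: k; exact: nbhs_infty_gt.
have n1 : (1 < N)%N by rewrite -(exp1n p) ltn_exp2r.
have nR : 0 < N%:R :> R by rewrite ltr0n ltnW.
have Lp : 0 < ln N%:R :> R by rewrite ln_gt0// ltr1n.
have all_neg : forall a, a \in r k -> f k a w < 0 by near: k.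
apply: (@norm_lt_of_tails N i 0%N N (s N) (2 * (1 + e) ^+ 2 * ln N%:R)).
- by rewrite mulr_gt0// sqrtr_gt0 divr_gt0.
- rewrite sqrtrM// [_ * (_ * (_ * _))](_ : _ = (1 + e) ^+ 2 * (Num.sqrt 2 ^+ 2) *
    (Num.sqrt (ln N%:R / N%:R) * Num.sqrt (N%:R * ln N%:R))); last first.
    by rewrite /s /c; ring.
  by rewrite sqrt_scale ?(ltW Lp)// sqr_sqrtr//; ring.
- move=> b; have := all_neg (b, i); apply.
  by apply: allpairs_f; rewrite ?mem_iota//; case: (b).
Unshelve. all: by end_near. Qed.

End row_sums.

(** * Elementary inequalities for the lower bound *)

Section window_arithmetic.
Context (R : realFieldType).
Implicit Types a b c k m n u x y z K L M : R.

Lemma tilt_sqr_le1 k : 0 < k -> k <= 4^-1 -> (1 - 2 * k) ^+ 2 <= 1.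
Proof. by move=> ? ?; rewrite expr_le1//; lra. Qed.

Lemma tilt_sg_sqr_le1 k (sg : R) : 0 < k -> k <= 4^-1 -> sg = 1 \/ sg = -1 ->
  (1 - 2 * k + sg * k) ^+ 2 <= 1.
Proof. by move=> ? ? [->|->]; rewrite expr_le1//; lra. Qed.

Lemma range_length x m n K : 8 * m <= x * K * m -> x * (m * K) <= x * n ->
  m <= x / 8 * n.
Proof. lra. Qed.

Lemma main_exponent x y : x * y <= x -> y - x / 4 <= (1 - x / 4) * y.
Proof. lra. Qed.

Lemma gap_large x L : 8 <= L * x -> 4 <= 5 / 8 * x * L.
Proof. lra. Qed.

Lemma other_exponent x y z : 0 < x -> x * z <= x ->
  y - x + 2 * (x / 16) * z <= y - x / 4 - 5 / 8 * x.
Proof. lra. Qed.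

Lemma half_remains u x y z : u <= x -> y <= u / 4 -> z <= u / 4 -> u / 2 <= x - y - z.
Proof. lra. Qed.

Lemma scaled_exp a m q K : m * (a / 2) <= m * q ->
  K * (m * (a / 2)) <= K * (m * q) -> a * (2 * K * m) <= 4 * K * (m * q).
Proof. lra. Qed.

Lemma scaled_log k L K : 32 * K * L <= L * k ^+ 2 * L -> 8 * K * L <= (k * L / 2) ^+ 2.
Proof. lra. Qed.

Lemma scaled_goal K L x : 8 * K * L <= 4 * K * x -> 4 * K * (2 * L) <= 4 * K * x.
Proof. lra. Qed.

End window_arithmetic.

(** * Tilted windows and large row sums *)

Section exponential_window.
Context (R : realType).

(* Tilting by e^(th t) isolates the window a < t <= b using exponential moments only. *)
Definition window (th k a b t : R) : R :=
  1 - expR (- (th * b)) *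
    (expR (th * t) - expR (k * a) * expR ((th - k) * t)
     - expR (- (k * b)) * expR ((th + k) * t)).

(** For t <= b the scaled first exponential is at most 1; for t > b the third exponential dominates
    the first. *)
Lemma window_ge0 th k a b t : 0 <= th -> 0 <= k -> 0 <= window th k a b t.
Proof.
move=> th0 k0; rewrite /window -!expRD subr_ge0.
have [tb|bt] := leP t b.
  apply: (@le_trans _ _ (expR (- (th * b)) * expR (th * t))).
    rewrite ler_wpM2l ?expR_ge0//.
    by have := expR_ge0 (k * a + (th - k) * t); have := expR_ge0 (- (k * b) + (th + k) * t); lra.
  by rewrite -expRD -expR0 ler_expR addrC subr_le0 ler_wpM2l.
apply: (@le_trans _ _ 0) => //; apply: mulr_ge0_le0; first exact: expR_ge0.
have : expR (th * t) <= expR (- (k * b) + (th + k) * t).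
  rewrite ler_expR mulrDl addrCA lerDl addrC subr_ge0 ler_wpM2l//.
  exact: ltW.
by have := expR_ge0 (k * a + (th - k) * t); lra.
Qed.

(** Below a the second exponential dominates the first. A product of windows over rows is hence at
    least 1 when no row sum exceeds a, and its mean bounds the probability of that event. *)
Lemma window_ge1 th k a b t : 0 <= k -> t <= a -> 1 <= window th k a b t.
Proof.
move=> k0 ta; rewrite /window -!expRD lerDl oppr_ge0.
apply: mulr_ge0_le0; first exact: expR_ge0.
have : expR (th * t) <= expR (k * a + (th - k) * t).
  rewrite ler_expR mulrBl addrCA lerDl subr_ge0 ler_wpM2l//.
by have := expR_ge0 (- (k * b) + (th + k) * t); lra.
Qed.

End exponential_window.

Section row_sum_lower_bound.
Context d (T : measurableType d) (R : realType) (P : probability T R).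
Context (X : nat -> nat -> {RV P >-> R}).
Hypotheses (X_iid : iid upper_pairs (entry X))
  (X_mean : ('E_P[X 0%N 1%N] = 0)%E)
  (X_var : ('V_P[X 0%N 1%N] = 1)%E)
  (X_moment4 : ('E_P[fun w => (X 0%N 1%N w ^+ 4)%R] < +oo)%E).

Let x0 : T -> R := X 0%N 1%N.

Let size_range i m n : (i < m)%N -> size (row_range i m n) = (n - m)%N.
Proof.
move=> im; rewrite /row_range (all_filterP _) ?size_iota//.
apply/allP => j; rewrite mem_index_iota => /andP[mj _].
by rewrite neq_ltn (leq_trans im mj) orbT.
Qed.

Let mean_window th k a b i m n : (i < m)%N ->
  L1 P (fun w => window th k a b (trunc_row_sum X n i m n w)) /\
  mean P (fun w => window th k a b (trunc_row_sum X n i m n w)) =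
    1 - expR (- (th * b)) *
    (trunc_mgf P x0 n th ^+ (n - m)
     - expR (k * a) * trunc_mgf P x0 n (th - k) ^+ (n - m)
     - expR (- (k * b)) * trunc_mgf P x0 n (th + k) ^+ (n - m)).
Proof.
move=> im.
have row s := mean_expR_row_sum X_iid n i s (row_range_uniq i m n).
rewrite -/x0 in row.
have [r1 e1] := row th; have [r2 e2] := row (th - k).
have [r3 e3] := row (th + k).
rewrite (size_range _ im) in e1 e2 e3.
rewrite -e1 -e2 -e3 /window.
have q1 := L1Z (expR (k * a)) r2; have q2 := L1Z (expR (- (k * b))) r3.
have q3 := L1B r1 q1; have q4 := L1B q3 q2; have q5 := L1Z (expR (- (th * b))) q4.
split; first by apply: L1B q5; exact: L1_cst.
rewrite meanB//; last exact: L1_cst.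
by rewrite mean_cst meanZ// meanB// meanB// !meanZ.
Qed.

Let mean_prod_window th k a b m n :
  L1 P (fun w => \prod_(i <- iota 0 m) window th k a b (trunc_row_sum X n i m n w)) /\
  mean P (fun w => \prod_(i <- iota 0 m) window th k a b (trunc_row_sum X n i m n w)) =
    (1 - expR (- (th * b)) *
    (trunc_mgf P x0 n th ^+ (n - m)
     - expR (k * a) * trunc_mgf P x0 n (th - k) ^+ (n - m)
     - expR (- (k * b)) * trunc_mgf P x0 n (th + k) ^+ (n - m))) ^+ m.
Proof.
have im i : i \in iota 0 m -> (i < m)%N by rewrite mem_iota.
(* Since i < m <= j, the entry (i, j) is stored under row i, so distinct rows use disjoint blocks of
   the upper triangle. *)
have [||||h1 h2] := @mean_prod_blocks _ _ _ P _ upper_pairs (entry X) X_iid.1 _ (iota 0 m)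
  (fun i => [set p | p.1 = i /\ (m <= p.2)%N])
  (fun i w => window th k a b (trunc_row_sum X n i m n w)) (iota_uniq 0 m).
- move=> i /im il [p1 p2] /= [-> h]; exact: ltnW (leq_trans il h).
- move=> i j _ _ ij; apply/seteqP; split => // p [[e1 _] [e2 _]].
  by rewrite -e1 -e2 eqxx in ij.
- move=> i /im il.
  apply: (@rv_measurable_comp _ _ _ _ _ _ _ (trunc_row_sum X n i m n) (window th k a b)).
    rewrite /window; do ?[apply: measurable_funB => //|apply: measurable_funM => //];
      by apply: measurableT_comp => //; exact: measurable_funM.
  have -> : trunc_row_sum X n i m n = (fun w =>
      \sum_(j <- row_range i m n | j \in row_range i m n) trunc n (sentry X i j w)).
    by apply/funext => w; rewrite /trunc_row_sum big_seq.
  apply: rv_measurable_sum => j.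
  rewrite mem_filter mem_index_iota => /andP[_ /andP[mj _]].
  have -> : (fun w => trunc n (sentry X i j w)) =
      (fun w => trunc n (entry X (sym_pair i j) w)).
    by apply/funext => w; rewrite sentryE.
  apply: (@rv_measurable_comp _ _ _ _ _ _ _ (entry X (sym_pair i j)) (trunc n)).
    exact: measurable_trunc.
  apply: rv_measurable_coord; rewrite /sym_pair.
  by rewrite (ltnW (leq_trans il mj)).
- by move=> i /im il; case: (mean_window th k a b n il).
split => //; rewrite h2 big_seq (eq_bigr (fun=>
  1 - expR (- (th * b)) *
    (trunc_mgf P x0 n th ^+ (n - m)
     - expR (k * a) * trunc_mgf P x0 n (th - k) ^+ (n - m)
     - expR (- (k * b)) * trunc_mgf P x0 n (th + k) ^+ (n - m)))).
  by rewrite -big_seq big_const_seq count_predT size_iota iter_mulr_1.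
by move=> i /im il; case: (mean_window th k a b n il).
Qed.

(** The mean of a window is 1 - q with q >= n^(k-1) / 2, so the product over m = n / K independent
    rows has mean (1 - q)^m <= exp(- m q) <= n^(-2). The tilt centres a row sum at (1 - 2 k) tau n,
    in the middle of the window, and K k^2 >= 8 limits the loss from the cut columns to a fraction
    k^2 / 8. *)
Lemma exists_large_row_sum k K : 0 < k -> k <= 4^-1 -> 8 <= K%:R * k ^+ 2 ->
  {ae P, forall w, \forall n \near \oo, exists2 i, (i < n %/ K)%N &
    (1 - 3 * k) * Num.sqrt (2 * (n%:R * ln n%:R)) <
    trunc_row_sum X n i (n %/ K) n w}.
Proof.
move=> k0 k4 Kk.
have K0 : (0 < K)%N by case: K Kk => //; rewrite mul0r => h; exfalso; lra.
have KR : 0 < K%:R :> R by rewrite ltr0n.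
have k2 : 0 < k ^+ 2 by rewrite exprn_gt0.
have k21 : k ^+ 2 <= 16^-1 by nra.
(* The lower end of the window becomes 1 - 3 k, and the cost exponent al^2 + 2 al k + k^2 / 4
   becomes 1 - 2 k + k^2 / 4 <= 1 - k. *)
pose al := 1 - 2 * k.
have al0 : 0 < al by rewrite /al; lra.
have alm : 0 < al - k by rewrite /al; lra.
have alp : 0 < al + k by rewrite /al; lra.
have al1 : al ^+ 2 <= 1 by exact: tilt_sqr_le1.
have alsg sg : sg = 1 \/ sg = -1 -> (al + sg * k) ^+ 2 <= 1.
  exact: tilt_sg_sqr_le1.
pose tau n : R := Num.sqrt 2 * Num.sqrt (ln n%:R / n%:R).
pose b n := (al + k) * tau n * n%:R.
pose a n := (al - k) * tau n * n%:R.
pose h n w := \prod_(i <- iota 0 (n %/ K))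
  window (al * tau n) (k * tau n) (a n) (b n) (trunc_row_sum X n i (n %/ K) n w).
(* The error of the moment generating function and the cut columns each cost a factor 1 - k^2 / 8 in
   the exponent, together at most k^2 / 4. *)
pose eta := k ^+ 2 / 16; have eta0 : 0 < eta by rewrite divr_gt0.
have eta2 : eta <= 2^-1 by rewrite /eta; lra.
have tau0 n : 0 <= tau n by rewrite mulr_ge0// sqrtr_ge0.
have h1 n : L1 P (h n) by case: (mean_prod_window (al * tau n) (k * tau n) (a n) (b n) (n %/ K) n).
have h0 n w : 0 <= h n w.
  by apply: prodr_ge0 => i _; apply: window_ge0; rewrite mulr_ge0// ltW.
have x4 := moment4_L1 X_moment4.
have mx0 : measurable_fun setT x0 by [].
have m1 := mean_x0 X_mean X_moment4.
have m2 := mean_x0_sqr X_mean X_var X_moment4.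
have s20 : 0 < Num.sqrt 2 :> R by rewrite sqrtr_gt0.
have mgf c : 0 < c -> \forall n \near \oo,
    expR ((2^-1 - eta) * (c * tau n) ^+ 2) <= trunc_mgf P x0 n (c * tau n) <=
    expR ((2^-1 + eta) * (c * tau n) ^+ 2).
  move=> c0; have cs : 0 < c * Num.sqrt 2 by rewrite mulr_gt0.
  have := trunc_mgf_bounds x4 mx0 m1 m2 cs eta0 eta2; apply: filterS => n; apply.
  by rewrite ger0_norm ?mulr_ge0// ?(ltW c0)// mulrA.
have hc : \forall n \near \oo, mean P (h n) <= 4 * (n.+1%:R ^+ 2)^-1.
  near=> n.
  have n0 : (0 < n)%N by near: n; exact: nbhs_infty_gt.
  have nR : 0 < n%:R :> R by rewrite ltr0n.
  rewrite (le_trans _ (expR_Nln2_le _ n0))//.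
  have nK : (2 * K <= n)%N by near: n; exact: nbhs_infty_ge.
  set L := ln n%:R.
  have L1 : 1 <= L by rewrite /L; near: n; exact: near_ln_ge.
  have LA : 8 / k ^+ 2 <= L by rewrite /L; near: n; exact: near_ln_ge.
  have LB : 32 * K%:R / k ^+ 2 <= L by rewrite /L; near: n; exact: near_ln_ge.
  rewrite ler_pdivrMr// in LA; rewrite ler_pdivrMr// in LB.
  have L0 : 0 < L by rewrite (lt_le_trans _ L1).
  have /andP[u1 _] : expR ((2^-1 - eta) * (al * tau n) ^+ 2) <=
    trunc_mgf P x0 n (al * tau n) <= expR ((2^-1 + eta) * (al * tau n) ^+ 2).
    by near: n; exact: mgf.
  have /andP[_ u2] : expR ((2^-1 - eta) * ((al - k) * tau n) ^+ 2) <=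
    trunc_mgf P x0 n ((al - k) * tau n) <= expR ((2^-1 + eta) * ((al - k) * tau n) ^+ 2).
    by near: n; exact: mgf.
  have /andP[_ u3] : expR ((2^-1 - eta) * ((al + k) * tau n) ^+ 2) <=
    trunc_mgf P x0 n ((al + k) * tau n) <= expR ((2^-1 + eta) * ((al + k) * tau n) ^+ 2).
    by near: n; exact: mgf.
  have tn : tau n ^+ 2 * n%:R = 2 * L.
    rewrite /tau -/L exprMn !sqr_sqrtr ?divr_ge0 ?(ltW L0)//.
    by field; rewrite gt_eqF.
  set m := (n %/ K)%N.
  have mn : (m <= n)%N by exact: leq_div.
  have mKn : m%:R * K%:R <= n%:R :> R by rewrite -natrM ler_nat leq_divM.
  have m0 : (0 < m)%N by rewrite divn_gt0// (leq_trans _ nK)// leq_pmull.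
  have mlow : n%:R <= 2 * K%:R * m%:R :> R.
    rewrite -!natrM ler_nat (leq_trans (ltnW (ltn_ceil n K0)))//.
    by rewrite mulnAC leq_mul2r mul2n -addnn -addn1 leq_add2l m0 orbT.
  have mR : 0 < m%:R :> R by rewrite ltr0n.
  set N' := (n - m)%N.
  have N'n : N'%:R <= n%:R :> R by rewrite ler_nat leq_subr.
  have N'low : (1 - k ^+ 2 / 8) * n%:R <= N'%:R.
    rewrite natrB// mulrBl mul1r lerD2l lerN2.
    apply: (@range_length _ _ _ _ K%:R); first by rewrite ler_wpM2r// [leRHS]mulrC.
    by rewrite ler_wpM2l// ltW.
  set u := expR ((al ^+ 2 - k ^+ 2 / 4) * L).
  have al20 : 0 <= al ^+ 2 by exact: sqr_ge0.
  have M1 : u <= trunc_mgf P x0 n (al * tau n) ^+ N'.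
    apply: (@le_trans _ _ (expR ((2^-1 - eta) * (al * tau n) ^+ 2) ^+ N')).
      rewrite -expRM_natl ler_expR exprMn.
      have : (2^-1 - eta) * (al ^+ 2 * tau n ^+ 2) * ((1 - k ^+ 2 / 8) * n%:R) <=
          (2^-1 - eta) * (al ^+ 2 * tau n ^+ 2) * N'%:R.
        by rewrite ler_wpM2l// mulr_ge0 ?subr_ge0// mulr_ge0 ?sqr_ge0.
      rewrite (_ : _ * ((1 - _) * _) = (1 - 2 * eta) * (1 - k ^+ 2 / 8) * al ^+ 2 * L); last first.
        transitivity ((2^-1 - eta) * (1 - k ^+ 2 / 8) * al ^+ 2 * (tau n ^+ 2 * n%:R)).
          by ring.
        by rewrite tn; field.
      rewrite [leRHS]mulrC => /(le_trans _); apply.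
      rewrite ler_wpM2r ?(ltW L0)// /eta.
      have h' : 1 - k ^+ 2 / 4 <= (1 - 2 * (k ^+ 2 / 16)) * (1 - k ^+ 2 / 8).
        rewrite (_ : _ * _ = 1 - k ^+ 2 / 4 + (k ^+ 2 / 8) ^+ 2); last by field.
        by rewrite lerDl sqr_ge0.
      apply: (le_trans _ (ler_wpM2r al20 h')).
      by apply: main_exponent; rewrite ler_piMr// ltW.
    by rewrite lerXn2r ?nnegrE ?expR_ge0// mean_ge0// => w; exact: expR_ge0.
  (* Completing the square, a tilt shifted by k or - k replaces the exponent al^2 by al^2 - k^2 up
     to the errors, so each correction term of the window is at most u / 4. *)
  have other (sg : R) : (sg = 1 \/ sg = -1) ->
      trunc_mgf P x0 n ((al + sg * k) * tau n) <=
        expR ((2^-1 + eta) * ((al + sg * k) * tau n) ^+ 2) ->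
      expR (- (sg * (k * tau n) * ((al + sg * k) * tau n * n%:R))) *
        trunc_mgf P x0 n ((al + sg * k) * tau n) ^+ N' <= u / 4.
    move=> sgE hs; have sg2 : sg ^+ 2 = 1 by case: sgE => ->; rewrite ?sqrrN expr1n.
    have M2 : trunc_mgf P x0 n ((al + sg * k) * tau n) ^+ N' <=
        expR ((1 + 2 * eta) * (al + sg * k) ^+ 2 * L).
      apply: (@le_trans _ _ (expR ((2^-1 + eta) * ((al + sg * k) * tau n) ^+ 2) ^+ N')).
        by rewrite lerXn2r ?nnegrE ?expR_ge0// mean_ge0// => w; exact: expR_ge0.
      rewrite -expRM_natl ler_expR mulrC exprMn.
      apply: (@le_trans _ _ ((2^-1 + eta) * ((al + sg * k) ^+ 2 * tau n ^+ 2) * n%:R)).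
        rewrite ler_wpM2l// mulr_ge0//; first by rewrite addr_ge0// ltW.
        by rewrite mulr_ge0 ?sqr_ge0.
      rewrite le_eqVlt; apply/orP; left; apply/eqP.
      transitivity ((2^-1 + eta) * (al + sg * k) ^+ 2 * (tau n ^+ 2 * n%:R)).
        by ring.
      by rewrite tn; field.
    apply: (le_trans (ler_wpM2l (expR_ge0 _) M2)); rewrite -expRD.
    have -> : - (sg * (k * tau n) * ((al + sg * k) * tau n * n%:R)) =
        - (sg * k * (al + sg * k) * (tau n ^+ 2 * n%:R)) by ring.
    rewrite tn.
    have e4 : expR (- (5 / 8 * k ^+ 2 * L)) <= 4^-1.
      rewrite expRN lef_pV2 ?posrE ?expR_gt0// (le_trans _ (expR_ge_id _))//.
      exact: gap_large.
    apply: (@le_trans _ _ (u * expR (- (5 / 8 * k ^+ 2 * L)))); last first.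
      by rewrite ler_wpM2l// expR_ge0.
    rewrite /u -expRD ler_expR.
    have sal := alsg sg sgE.
    have sqE : (al + sg * k) ^+ 2 = al ^+ 2 + 2 * sg * k * al + k ^+ 2.
      by rewrite sqrrD exprMn sg2; ring.
    rewrite (_ : - _ + _ = (al ^+ 2 - k ^+ 2 + 2 * eta * (al + sg * k) ^+ 2) * L); last first.
      have -> : sg * k * (al + sg * k) = sg * k * al + sg ^+ 2 * k ^+ 2 by ring.
      by rewrite sg2 sqE; ring.
    rewrite [leRHS](_ : _ = (al ^+ 2 - k ^+ 2 / 4 - 5 / 8 * k ^+ 2) * L); last by ring.
    rewrite ler_wpM2r ?(ltW L0)// /eta.
    by apply: other_exponent => //; rewrite ler_piMr// ltW.
  have M2 := other (-1) (or_intror erefl); rewrite mulN1r in M2.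
  have {}M2 := M2 u2; rewrite mulN1r mulNr opprK in M2.
  have M3 := other 1 (or_introl erefl); rewrite mul1r in M3.
  have {}M3 := M3 u3; rewrite mul1r in M3.
  have [_ ->] := mean_prod_window (al * tau n) (k * tau n) (a n) (b n) m n.
  rewrite -/N' -!mulrBl -!mulrDl.
  set D := _ - _ * _ - _ * _.
  have Du : u / 2 <= D by exact: half_remains M1 M2 M3.
  set q := expR _ * D.
  have q_low : expR (- ((1 - k) * L)) / 2 <= q.
    apply: (@le_trans _ _ (expR (- (al * tau n * b n)) * (u / 2))); last first.
      by rewrite ler_wpM2l// expR_ge0.
    rewrite mulrA ler_wpM2r// /u -expRD ler_expR /b.
    have -> : al * tau n * ((al + k) * tau n * n%:R) = al * (al + k) * (tau n ^+ 2 * n%:R) by ring.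
    rewrite tn [leRHS](_ : _ = - (al ^+ 2 + 2 * al * k + k ^+ 2 / 4) * L); last by ring.
    by rewrite -mulNr ler_wpM2r ?(ltW L0)// lerN2 /al; nra.
  (* Needed to raise 1 - q <= exp(- q) to the power m; it holds because 1 - q is the mean of a
     nonnegative window. *)
  have q1 : 0 <= 1 - q.
    have [_ e] := mean_window (al * tau n) (k * tau n) (a n) (b n) n m0.
    rewrite -/N' -!mulrBl -!mulrDl -/D -/q in e; rewrite -e.
    by apply: mean_ge0 => w; apply: window_ge0; rewrite mulr_ge0// ltW.
  have qm : 2 * L <= m%:R * q.
    have mexp : expR L <= 2 * K%:R * m%:R by rewrite lnK.
    have h2 : expR (k * L) = expR (- ((1 - k) * L)) * expR L.
      by rewrite -expRD; congr expR; ring.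
    (* A square of log n below n^k suffices to beat K log n once log n >= 32 K / k^2. *)
    have h3 : (k * L / 2) ^+ 2 <= expR (k * L).
      have -> : expR (k * L) = expR (k * L / 2) ^+ 2.
        by rewrite -expRM_natl; congr expR; field.
      rewrite lerXn2r ?nnegrE ?expR_ge0 ?expR_ge_id//.
      by rewrite divr_ge0// mulr_ge0// ?(ltW k0) ?(ltW L0).
    have h4 : expR (k * L) <= 4 * K%:R * (m%:R * q).
      rewrite h2 (le_trans (ler_wpM2l (expR_ge0 _) mexp))//.
      have h4 := ler_wpM2l (ltW mR) q_low; have h5 := ler_wpM2l (ltW KR) h4.
      exact: scaled_exp h4 h5.
    have h5 : 8 * K%:R * L <= (k * L / 2) ^+ 2.
      by apply: scaled_log; exact: ler_wpM2r (ltW L0) _ _ LB.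
    have h6 : 8 * K%:R * L <= 4 * K%:R * (m%:R * q) by rewrite (le_trans h5)// (le_trans h3).
    rewrite -(@ler_pM2l _ (4 * K%:R)) ?mulr_gt0//; exact: scaled_goal.
  apply: (@le_trans _ _ (expR (- q) ^+ m)).
    by rewrite lerXn2r ?nnegrE ?expR_ge0// expR_ge1Dx.
  by rewrite -expRM_natl ler_expR mulrN lerN2.
have c0 n : 0 <= 4 * (n.+1%:R ^+ 2)^-1 :> R by rewrite mulr_ge0// invr_ge0 sqr_ge0.
have cM N : \sum_(n < N) 4 * (n.+1%:R ^+ 2)^-1 <= 4 * 2 :> R.
  by rewrite -mulr_sumr ler_wpM2l// sum_inv_sqr_le.
have := borel_cantelli_mean h1 h0 c0 cM hc.
apply: filterS => w; apply: filterS => n hn; apply: contrapT => nex.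
move: hn; rewrite ltNge => /negP; apply.
rewrite /h big_seq; apply: (big_ind (fun x => 1 <= x)) => //.
  by move=> x y x1 y1; rewrite mulr_ege1.
move=> i; rewrite mem_iota add0n /= => im.
apply: window_ge1; first by rewrite mulr_ge0// ltW.
rewrite leNgt; apply/negP => ha; apply: nex; exists i => //.
apply: le_lt_trans ha; rewrite /a /tau /al.
have n0 : (0 < n)%N by case: (posnP n) im => // ->; rewrite div0n.
have nR : 0 < n%:R :> R by rewrite ltr0n.
rewrite -[leRHS]mulrA (_ : 1 - 2 * k - k = 1 - 3 * k); last by ring.
rewrite (_ : _ * n%:R = Num.sqrt (2 * (n%:R * ln n%:R))) ?lexx//.
have L0 : 0 <= ln n%:R :> R by rewrite ln_ge0// ler1n.
rewrite -sqrtrM// -[X in _ * X](ger0_norm (ltW nR)) -sqrtr_sqr -sqrtrM; last first.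
  by rewrite mulr_ge0// divr_ge0// ltW.
by congr Num.sqrt; field; rewrite gt_eqF.
Unshelve. all: by end_near. Qed.

End row_sum_lower_bound.
(** * The off-diagonal part *)

Section moment_recursion.
Context (R : realType).
Implicit Types y b : R.

(** In closed form y^p (p + p0)! / p0!. The shift p0 absorbs the factor n exp(b / y) of the
    recursion. *)
Fixpoint moment_majorant y (p0 p : nat) : R :=
  if p is q.+1 then moment_majorant y p0 q * (y * (p + p0)%:R) else 1.

Lemma moment_majorant_ge0 y p0 p : 0 <= y -> 0 <= moment_majorant y p0 p.
Proof. by move=> y0; elim: p => //= p IH; rewrite !mulr_ge0. Qed.

Lemma moment_majorant_le y p0 p : 0 <= y ->
  moment_majorant y p0 p <= (y * (p + p0)%:R) ^+ p.
Proof.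
move=> y0; elim: p => [|p IH] //=; rewrite exprSr ler_wpM2r ?mulr_ge0//.
rewrite (le_trans IH)// lerXn2r ?nnegrE ?mulr_ge0// ler_wpM2l// ler_nat.
by rewrite leq_add2r.
Qed.

(** The falling factorial is dominated factor by factor by the last c factors of the majorant.
    Divided by c!, this turns the binomial sum of the recursion into the series of exp(b / y). *)
Lemma moment_majorant_ffact y p0 p c : 0 <= y -> (c <= p)%N ->
  (p ^_ c)%:R * y ^+ c * moment_majorant y p0 (p - c) <= moment_majorant y p0 p.
Proof.
move=> y0; elim: c => [|c IH] cp; first by rewrite expr0 !mul1r subn0.
apply: le_trans (IH (ltnW cp)).
rewrite ffactnSr natrM exprSr -(subnSK cp) [moment_majorant y p0 (p - c.+1).+1]/=.
rewrite (subnSK cp).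
have M0 := @moment_majorant_ge0 y p0 (p - c.+1) y0.
rewrite [leLHS](_ : _ = (p ^_ c)%:R * y ^+ c *
  (moment_majorant y p0 (p - c.+1) * (y * (p - c)%:R))); last by ring.
rewrite ler_wpM2l ?mulr_ge0 ?exprn_ge0// ler_wpM2l// ler_wpM2l// ler_nat.
by rewrite leq_addr.
Qed.

Lemma sum_exp_coeff_le b n : 0 <= b -> \sum_(c < n) b ^+ c / c`!%:R <= expR b.
Proof.
move=> b0; have := nondecreasing_cvgn_le _ (is_cvg_series_exp_coeff b) n.
rewrite /series/= big_mkord /exp_coeff/=; apply.
apply: nondecreasing_series => k _ _; exact: exp_coeff_ge0.
Qed.

(* The recursion is that of the Bell polynomials, i.e. of Poisson moments,
   whose p-th root is o(p): this is what beats the factor log n. *)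
Lemma moment_recursion_le (t : nat -> R) (n y b : R) p0 : 0 <= n -> 0 < y -> 0 <= b ->
  n * expR (b / y) <= y * p0%:R -> t 0%N <= n ->
  (forall p, t p.+1 <= n * \sum_(c < p.+1) 'C(p, c)%:R * b ^+ c * t (p - c)%N) ->
  forall p, t p <= n * (y * (p + p0)%:R) ^+ p.
Proof.
move=> n0 y0 b0 hp0 t0 trec p.
suff h q : t q <= n * moment_majorant y p0 q.
  by rewrite (le_trans (h p))// ler_wpM2l// moment_majorant_le// ltW.
elim/ltn_ind: q => [[|q] IH]; first by rewrite mulr1.
rewrite (le_trans (trec q))// ler_wpM2l//=.
have M0 := @moment_majorant_ge0 y p0 q (ltW y0).
apply: (@le_trans _ _ (\sum_(c < q.+1) n * moment_majorant y p0 q * ((b / y) ^+ c / c`!%:R))).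
  apply: ler_sum => c _.
  apply: (@le_trans _ _ ('C(q, c)%:R * b ^+ c * (n * moment_majorant y p0 (q - c)))).
    by rewrite ler_wpM2l ?mulr_ge0 ?exprn_ge0// IH// ltnS leq_subr.
  have := @moment_majorant_ffact y p0 q c (ltW y0); rewrite -ltnS ltn_ord => /(_ isT).
  rewrite -bin_ffact natrM => h.
  have f0 : 0 < c`!%:R :> R by rewrite ltr0n fact_gt0.
  have yc : 0 < y ^+ c by rewrite exprn_gt0.
  rewrite expr_div_n -[leRHS]mulrA -[b ^+ c / y ^+ c / _]mulrA -invfM.
  rewrite (_ : 'C(q, c)%:R * _ * _ = n * (b ^+ c * ('C(q, c)%:R * moment_majorant y p0 (q - c)))); last by ring.
  rewrite ler_wpM2l// [leRHS]mulrCA ler_wpM2l ?exprn_ge0//.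
  rewrite ler_pdivlMr ?mulr_gt0//.
  rewrite (le_trans _ h)// le_eqVlt; apply/orP; left; apply/eqP; ring.
rewrite -mulr_sumr -mulrA mulrCA ler_wpM2l//.
(* The majorant gains the factor y (q + 1 + p0) from q to q + 1, and y p0 alone covers n exp(b /
   y). *)
apply: (@le_trans _ _ (n * expR (b / y))).
  by rewrite ler_wpM2l// sum_exp_coeff_le// divr_ge0// ltW.
by rewrite (le_trans hp0)// ler_wpM2l ?(ltW y0)// ler_nat leq_addl.
Qed.

End moment_recursion.

(** * Expected traces of powers of the Gram matrix *)

Section bounded_measurable.
Context d (T : measurableType d) (R : realType) (P : probability T R).
Context (I : choiceType) (X : I -> {RV P >-> R}).
Implicit Types (S : set I) (f g : T -> R).

Definition bounded_rv S f : Prop :=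
  rv_measurable X S f /\ exists M, forall w, `|f w| <= M.

Lemma bounded_rv_cst S c : bounded_rv S (fun=> c).
Proof. by split; [exact: rv_measurable_cst|exists `|c|]. Qed.

Lemma bounded_rvM S f g : bounded_rv S f -> bounded_rv S g ->
  bounded_rv S (fun w => f w * g w).
Proof.
move=> [mf [A fA]] [mg [B gB]]; split; first exact: rv_measurableM.
by exists (A * B) => w; rewrite normrM ler_pM.
Qed.

Lemma bounded_rv_sum S (A : Type) (r : seq A) (p : pred A) (f : A -> T -> R) :
  (forall a, p a -> bounded_rv S (f a)) ->
  bounded_rv S (fun w => \sum_(a <- r | p a) f a w).
Proof.
move=> h; split.
  by apply: rv_measurable_sum => a /h[].
elim: r => [|a r [M IH]]; first by exists 0 => w; rewrite big_nil normr0.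
case pa: (p a); last by exists M => w; rewrite big_cons pa.
have [_ [A0 hA]] := h a pa; exists (A0 + M) => w; rewrite big_cons pa.
by rewrite (le_trans (ler_normD _ _))// lerD.
Qed.

Lemma bounded_rv_L1 S f : bounded_rv S f -> L1 P f.
Proof. by move=> [mf [M fM]]; apply: (@L1_bounded _ _ _ _ _ M) => //; exact: rv_measurableT mf. Qed.

Lemma bounded_rv_mx_exp S n (W : T -> 'M[R]_n) p :
  (forall i j, bounded_rv S (fun w => W w i j)) ->
  forall i j, bounded_rv S (fun w => (W w ^+ p) i j).
Proof.
move=> h; elim: p => [|p IH] i j.
  by under eq_fun do rewrite expr0 mxE; exact: bounded_rv_cst.
rewrite (_ : (fun w => _) = fun w => \sum_k W w i k * (W w ^+ p) k j).
  by apply: bounded_rv_sum => k _; exact: bounded_rvM.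
by apply/funext => w; rewrite exprS -mulmxE mxE.
Qed.

End bounded_measurable.

Section trace_moments.
Context d (T : measurableType d) (R : realType) (P : probability T R).
Context (X : nat -> nat -> {RV P >-> R}).
Hypotheses (X_iid : iid upper_pairs (entry X))
  (X_mean : ('E_P[X 0%N 1%N] = 0)%E)
  (X_var : ('V_P[X 0%N 1%N] = 1)%E)
  (X_moment4 : ('E_P[fun w => (X 0%N 1%N w ^+ 4)%R] < +oo)%E).
Variables (n : nat) (b : R).
Hypothesis b0 : 0 <= b.

Let x0 : T -> R := X 0%N 1%N.

Let col w k : 'rV[R]_n := upper_col (fun i j => X i j w) n k.

(** A column that is too long is replaced by zero as a whole. The decision uses that column only, so
    columns stay independent, and the length bound holds surely. *)
Definition short_col w k : 'rV[R]_n :=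
  if \sum_(i < k) X i k w ^+ 2 <= b then col w k else 0.

Definition short_gram w : 'M[R]_n :=
  \sum_(k < n) (short_col w k)^T *m short_col w k.

Let others w (k : 'I_n) : 'M[R]_n :=
  \sum_(l < n | l != k) (short_col w l)^T *m short_col w l.

Let col_pairs (k : nat) : set (nat * nat) := [set p | p.2 = k /\ (p.1 < k)%N].

Let other_pairs (k : nat) : set (nat * nat) :=
  [set p | p.2 != k /\ (p.1 < p.2)%N].

Let gramE w k : short_gram w = others w k + (short_col w k)^T *m short_col w k.
Proof. by rewrite /short_gram (bigD1 k)//= addrC. Qed.

Let psd_others w k : psd (others w k).
Proof. by apply: psd_sum => l _; exact: psd_rank1. Qed.

Let col_sqr w k : (k < n)%N -> bil (col w k) 1 (col w k) = \sum_(i < k) X i k w ^+ 2.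
Proof.
move=> kn; rewrite /bil mulmx1 mxE.
rewrite (big_ord_widen n (fun i => X i k w ^+ 2) (ltnW kn)) [RHS]big_mkcond/=.
by apply: eq_bigr => i _; rewrite !mxE; case: ifP => _; rewrite ?mulr0 ?expr2.
Qed.

Let short_col_sqr w k : (k < n)%N -> bil (short_col w k) 1 (short_col w k) <= b.
Proof.
move=> kn; rewrite /short_col; case: ifP => // h; first by rewrite col_sqr.
by rewrite /bil mul0mx mul0mx mxE.
Qed.

Let short_le w k Q : psd Q -> bil (short_col w k) Q (short_col w k) <=
  bil (col w k) Q (col w k).
Proof.
move=> [_ Qp]; rewrite /short_col; case: ifP => // _.
by rewrite {1}/bil mul0mx mul0mx mxE.
Qed.

Let coord_bounded (l : nat) i : (l < n)%N ->
  bounded_rv (entry X) (col_pairs l) (fun w => short_col w l 0 i).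
Proof.
move=> ln.
have mX j : (j < l)%N -> rv_measurable (entry X) (col_pairs l) (X j l).
  by move=> jl; exact: (@rv_measurable_coord _ _ _ _ _ (entry X) _ (j, l)).
split; last first.
  exists (1 + b) => w.
  have := short_col_sqr w ln; set u := short_col w l => ub.
  have ui : u 0 i ^+ 2 <= b.
    rewrite (le_trans _ ub)// /bil mulmx1 mxE (bigD1 i)//= mxE -expr2 lerDl.
    by apply: sumr_ge0 => j _; rewrite mxE -expr2 sqr_ge0.
  have [u1|u1] := leP `|u 0 i| 1; first by rewrite (le_trans u1)// lerDl.
  rewrite (le_trans (y := `|u 0 i| ^+ 2))//.
    by rewrite expr2 ler_peMr// ltW.
  by rewrite real_normK ?num_real// (le_trans ui)// lerDr.
rewrite (_ : (fun w => _) = fun w =>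
  if \sum_(j < l) X j l w ^+ 2 <= b then (if (i < l)%N then X i l w else 0) else 0).
  apply: (@measurable_fun_if _ _ (g_sigma_algebraType (rv_events (entry X) (col_pairs l)))) => //.
  - apply: measurable_fun_ler => //.
    apply: rv_measurable_sum => j _.
    apply: (@rv_measurable_comp _ _ _ _ _ _ _ (X j l) (fun x => x ^+ 2)).
      exact: measurable_funX.
    by apply: mX.
  - by apply: measurable_funTS; case il: (i < l)%N => //; exact: mX.
by apply/funext => w; rewrite /short_col; case: ifP; rewrite !mxE.
Qed.

Let gram_entry_bounded (A : pred 'I_n) S i j :
  (forall l : 'I_n, A l -> col_pairs l `<=` S) ->
  bounded_rv (entry X) S
    (fun w => (\sum_(l < n | A l) (short_col w l)^T *m short_col w l) i j).
Proof.
move=> AS.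
rewrite (_ : (fun w => _) = fun w =>
    \sum_(l < n | A l) short_col w l 0 i * short_col w l 0 j).
  apply: bounded_rv_sum => l Al.
  have sub t : bounded_rv (entry X) S (fun w => short_col w l 0 t).
    have [m1 m2] := coord_bounded t (ltn_ord l); split => //.
    exact: sub_rv_measurable (AS l Al) m1.
  exact: bounded_rvM.
apply/funext => w; rewrite summxE; apply: eq_bigr => l _.
by rewrite mxE big_ord_recl big_ord0 addr0 !mxE.
Qed.

Lemma L1_trace_gram p : L1 P (fun w => \tr (short_gram w ^+ p)).
Proof.
apply: (@bounded_rv_L1 _ _ _ _ _ (entry X) setT).
apply: bounded_rv_sum => i _; apply: bounded_rv_mx_exp => {}i j.
exact: gram_entry_bounded.
Qed.

Let shift_bounded p (k : 'I_n) i j :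
  bounded_rv (entry X) (other_pairs k)
    (fun w => ((others w k + b%:M) ^+ p) i j).
Proof.
apply: bounded_rv_mx_exp => {}i {}j.
rewrite (_ : (fun w => _) = fun w => others w k i j + (b%:M : 'M[R]_n) i j); last first.
  by apply/funext => w; rewrite mxE.
have [m1 [M hM]] : bounded_rv (entry X) (other_pairs k) (fun w => others w k i j).
  apply: gram_entry_bounded => l lk [p1 p2] [/= -> h]; split => //=.
have [m2 [M2 hM2]] := bounded_rv_cst (entry X) (other_pairs k) ((b%:M : 'M[R]_n) i j).
split; last first.
  by exists (M + M2) => w; rewrite (le_trans (ler_normD _ _))// lerD// hM2.
exact: (@measurable_funD _ (g_sigma_algebraType (rv_events (entry X) (other_pairs k)))).
Qed.

Let entry_L4 i k : (i < k)%N -> L1 P (fun w => X i k w ^+ 2) /\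
  mean P (fun w => X i k w ^+ 2) = 1.
Proof.
move=> ik; rewrite -(mean_x0_sqr X_mean X_var X_moment4).
apply: (@iid_mean _ _ _ P X X_iid (fun x => x ^+ 2) (i, k)).
- exact: measurable_funX.
- exact: (moment_L1 X_moment4 (isT : (2 <= 4)%N)).
- exact: ltnW.
Qed.

Let entry_L1 i k : (i < k)%N -> L1 P (X i k) /\ mean P (X i k) = 0.
Proof.
move=> ik; rewrite -(mean_x0 X_mean X_moment4).
apply: (@iid_mean _ _ _ P X X_iid (fun x => x) (i, k)) => //.
- by have := moment_L1 X_moment4 (isT : (1 <= 4)%N).
- exact: ltnW.
Qed.

Let col_cov (k i j : 'I_n) : L1 P (fun w => col w k 0 i * col w k 0 j) /\
  mean P (fun w => col w k 0 i * col w k 0 j) = ((i == j) && (i < k)%N)%:R.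
Proof.
have [ik|ki] := ltnP i k; last first.
  have -> : (fun w => col w k 0 i * col w k 0 j) = fun=> 0.
    by apply/funext => w; rewrite !mxE ltnNge ki mul0r.
  by rewrite andbF mean_cst; split => //; exact: L1_cst.
have [jk|kj] := ltnP j k; last first.
  have -> : (fun w => col w k 0 i * col w k 0 j) = fun=> 0.
    by apply/funext => w; rewrite !mxE [(j < k)%N]ltnNge kj mulr0.
  rewrite mean_cst; split; first exact: L1_cst.
  by case: eqP => // e; move: ik; rewrite e ltnNge kj.
rewrite andbT.
have -> : (fun w => col w k 0 i * col w k 0 j) = fun w => X i k w * X j k w.
  by apply/funext => w; rewrite !mxE ik jk.
have [i1 i0] := entry_L1 ik; have [j1 j0] := entry_L1 jk.
have [->|ij] := eqVneq i j.
  by have [] := entry_L4 jk; under eq_fun do rewrite expr2.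
suff : indep_funs P (X i k) (X j k).
  by move=> h; have [? ->] := indep_mean h i1 j1; rewrite i0 mul0r.
apply: (@rv_measurable_indep _ _ _ _ _ upper_pairs (entry X) X_iid.1
  [set (nat_of_ord i, nat_of_ord k)] [set (nat_of_ord j, nat_of_ord k)]).
- by move=> _ ->; exact: ltnW.
- by move=> _ ->; exact: ltnW.
- apply/seteqP; split => // p [/= -> [/val_inj e]].
  by rewrite e eqxx in ij.
- exact: (@rv_measurable_coord _ _ _ _ _ (entry X) _ (nat_of_ord i, nat_of_ord k)).
- exact: (@rv_measurable_coord _ _ _ _ _ (entry X) _ (nat_of_ord j, nat_of_ord k)).
Qed.

Let col_rv_measurable (k i : 'I_n) :
  rv_measurable (entry X) (col_pairs k) (fun w => col w k 0 i).
Proof.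
rewrite (_ : (fun w => _) = fun w => if (i < k)%N then X i k w else 0).
  case ik: (i < k)%N; last exact: rv_measurable_cst.
  exact: (@rv_measurable_coord _ _ _ _ _ (entry X) _ (nat_of_ord i, nat_of_ord k)).
by apply/funext => w; rewrite mxE.
Qed.

(** The matrix depends on the other columns only, so its mean factors from the covariance of column
    k, the identity restricted to indices below k. The full column appears here because cutting by
    length need not keep the coordinates uncorrelated. *)
Let mean_quadratic p (k : 'I_n) :
  L1 P (fun w => bil (col w k) ((others w k + b%:M) ^+ p) (col w k)) /\
  mean P (fun w => bil (col w k) ((others w k + b%:M) ^+ p) (col w k)) <=
  mean P (fun w => \tr ((others w k + b%:M) ^+ p)).
Proof.
pose Q w := (others w k + b%:M) ^+ p.
have Qb i j := shift_bounded p k i j.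
have Q1 i j : L1 P (fun w => Q w i j) := bounded_rv_L1 (Qb i j).
have key i j : L1 P (fun w => Q w i j * (col w k 0 i * col w k 0 j)) /\
    mean P (fun w => Q w i j * (col w k 0 i * col w k 0 j)) =
    mean P (fun w => Q w i j) * ((i == j) && (i < k)%N)%:R.
  have [c1 <-] := col_cov k i j.
  apply: indep_mean => //.
  apply: (@rv_measurable_indep _ _ _ _ _ upper_pairs (entry X) X_iid.1
    (other_pairs k) (col_pairs k)).
  - by move=> q [_ h]; exact: ltnW.
  - by move=> [q1 q2] [/= -> h]; exact: ltnW.
  - apply/seteqP; split => // q [[h _] [e _]].
    by rewrite e eqxx in h.
  - exact: (Qb i j).1.
  - by apply: rv_measurableM; exact: col_rv_measurable.
have E : (fun w => bil (col w k) (Q w) (col w k)) =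
    fun w => \sum_j \sum_i Q w i j * (col w k 0 i * col w k 0 j).
  apply/funext => w; rewrite bilE; apply: eq_bigr => j _; apply: eq_bigr => i _.
  by rewrite -/(col w k); ring.
rewrite -/(Q _) E; split.
  by apply: L1_sum => j _; apply: L1_sum => i _; case: (key i j).
rewrite mean_sum; last by move=> j _; apply: L1_sum => i _; case: (key i j).
rewrite /mxtrace mean_sum; last by move=> j _; exact: Q1.
apply: ler_sum => j _.
rewrite mean_sum; last by move=> i _; case: (key i j).
rewrite (bigD1 j)//= big1 ?addr0; last first.
  by move=> i ij; rewrite (key i j).2 (negbTE ij) mulr0.
rewrite (key j j).2 eqxx/= ler_piMr//.
  apply: mean_ge0 => w; apply: psd_diag; apply: psd_exp.
  exact: psd_shift.
by case: (j < k)%N.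
Qed.

(** tr A^(p+1) is the sum of u_k A^p u_k^T. The column u_k is removed from A^p at the price of the
    shift b, the outer column is made full again and averaged, and the matrix without u_k is
    enlarged back to A under the trace. The binomial formula concludes. *)
Lemma mean_trace_gram_rec p :
  mean P (fun w => \tr (short_gram w ^+ p.+1)) <=
  n%:R * \sum_(c < p.+1) 'C(p, c)%:R * b ^+ c *
    mean P (fun w => \tr (short_gram w ^+ (p - c))).
Proof.
have tr_shift_L1 k : L1 P (fun w => \tr ((others w k + b%:M) ^+ p)).
  by apply: L1_sum => i _; exact: bounded_rv_L1 (shift_bounded p k i i).
have gram_shift w : \tr ((short_gram w + b%:M) ^+ p) =
    \sum_(c < p.+1) 'C(p, c)%:R * b ^+ c * \tr (short_gram w ^+ (p - c)).
  exact: mxtrace_shift.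
have shift_L1 : L1 P (fun w => \tr ((short_gram w + b%:M) ^+ p)).
  under eq_fun do rewrite gram_shift.
  by apply: L1_sum => c _; apply: L1Z; exact: L1_trace_gram.
have quad_L1 (k : 'I_n) :
    L1 P (fun w => bil (col w k) ((others w k + b%:M) ^+ p) (col w k)).
  by case: (mean_quadratic p k).
apply: (@le_trans _ _ (mean P (fun w =>
    \sum_(k < n) bil (col w k) ((others w k + b%:M) ^+ p) (col w k)))).
  apply: le_mean; [exact: L1_trace_gram|exact: L1_sum|move=> w].
  rewrite exprS {1}/short_gram mulr_suml linear_sum/=; apply: ler_sum => k _.
  rewrite -mulmxE mxtrace_rank1.
  rewrite (gramE w k).
  have := @word_le _ _ (short_col w k) (others w k) b 0 p (psd_others w k)
    (short_col_sqr w (ltn_ord k)).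
  rewrite !expr0 !mul1r => /le_trans; apply.
  by apply: short_le; apply: psd_exp; exact: psd_shift.
rewrite mean_sum//.
apply: (@le_trans _ _ (\sum_(k < n) mean P (fun w => \tr ((short_gram w + b%:M) ^+ p)))).
  apply: ler_sum => k _; rewrite (le_trans (mean_quadratic p k).2)//.
  apply: le_mean => // w.
  have -> : short_gram w + b%:M = others w k + b%:M + (short_col w k)^T *m short_col w k.
    by rewrite (gramE w k) addrAC.
  by apply: mxtrace_exp_le; exact: psd_shift.
rewrite sumr_const card_ord -[leLHS]mulr_natl ler_wpM2l//.
under [X in mean P X]eq_fun do rewrite gram_shift.
rewrite mean_sum; last by move=> c _; apply: L1Z; exact: L1_trace_gram.
rewrite le_eqVlt; apply/orP; left; apply/eqP.
by apply: eq_bigr => c _; rewrite meanZ//; exact: L1_trace_gram.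
Qed.

End trace_moments.
(** * Almost sure bounds *)

Section assembly_arithmetic.
Context (R : realFieldType).
Implicit Types p q L n e x y a b : R.

Lemma order_le p q L : 0 < L -> p <= 4 * L -> 1 + q <= L -> p + 1 + q <= 6 * L.
Proof. lra. Qed.

Lemma order_ge p L : 0 < L -> 4 * L <= p -> L + p * -1 <= - (2 * L).
Proof. lra. Qed.

Lemma ratio_bound x n e : (e + 1) * (x - n) <= e * x -> x <= (1 + e) * n.
Proof. lra. Qed.

Lemma upper_factor e : 0 <= e -> e <= 1 -> (1 + 2 * e) * (1 + e) <= 1 + 5 * e.
Proof. by move=> ? ?; nra. Qed.

Lemma lower_factor e x y a b : (1 - 3 * e) * x < b -> - (e * y) < a ->
  e * y <= e * x -> (1 - 4 * e) * x <= a + b.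
Proof. lra. Qed.

Lemma distance_le e x y : 0 <= e * x -> (1 - 4 * e) * x <= y ->
  y <= e * x + (1 + 5 * e) * x -> `|x - y| <= 6 * e * x.
Proof. by move=> ? ? ?; rewrite ler_norml; apply/andP; split; lra. Qed.

End assembly_arithmetic.

(** A mean value bound: consecutive powers have a relative gap of at most (p + 1) / (k + 1). *)
Lemma expn_succ_sub_le (k p : nat) : (k.+1 ^ p.+1 - k ^ p.+1 <= p.+1 * k.+1 ^ p)%N.
Proof.
elim: p => [|p IH]; first by rewrite !expn1 subSnn.
rewrite leq_subLR in IH; rewrite leq_subLR.
rewrite expnS (leq_trans (leq_mul (leqnn k.+1) IH))// mulnDr.
rewrite [(k.+1 * (p.+1 * _))%N]mulnCA -[(k.+1 * k.+1 ^ p)%N]expnS.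
rewrite [(k.+1 * _)%N]mulSn -[(k * _)%N]expnS [(k ^ p.+1 + _)%N]addnC -addnA.
by rewrite leq_add2l [(p.+2 * _)%N]mulSn leq_add2r leq_exp2r.
Qed.

Section assembly.
Context d (T : measurableType d) (R : realType) (P : probability T R).
Context (X : nat -> nat -> {RV P >-> R}).
Hypotheses (X_iid : iid upper_pairs (entry X))
  (X_mean : ('E_P[X 0%N 1%N] = 0)%E)
  (X_var : ('V_P[X 0%N 1%N] = 1)%E)
  (X_moment4 : ('E_P[fun w => (X 0%N 1%N w ^+ 4)%R] < +oo)%E).

Let raw w i j : R := X i j w.

Let ln_ge0_nat n : 0 <= ln n%:R :> R.
Proof.
case: n => [|n]; first by rewrite ln0.
by rewrite ln_ge0// ler1n.
Qed.

(** With b = 8 n and y = dl n, the ratio b / y and hence p0 do not depend on n. For p about 4 log n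
    the recursion bounds the mean by n (6 dl n log n)^(p+1), which is n exp(-(p + 1)) <= n^(-3)
    relative to the claimed bound. *)
Lemma gram_trace_small e : 0 < e ->
  {ae P, forall w, \forall n \near \oo, exists p,
    \tr (short_gram X n (8 * n%:R) w ^+ p.+1) <= (e * (n%:R * ln n%:R)) ^+ p.+1}.
Proof.
(* The 6 comes from p + 1 + p0 <= 6 log n, and the factor exp(-1) produces the decay exp(-(p +
   1)). *)
move=> e0; pose dl := e * expR (-1) / 6.
have dl0 : 0 < dl by rewrite divr_gt0// mulr_gt0// expR_gt0.
pose p0 := (Num.truncn (expR (8 / dl) / dl)).+1.
have hp0 : expR (8 / dl) <= dl * p0%:R by rewrite -ler_pdivrMl// mulrC ltW// truncnS_gt.
pose p n := Num.truncn (4 * ln n%:R : R).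
pose s n := e * (n%:R * ln n%:R) : R.
have s0 n : 0 <= s n by rewrite mulr_ge0 ?(ltW e0)// mulr_ge0.
pose h n w := (s n ^+ (p n).+1)^-1 * \tr (short_gram X n (8 * n%:R) w ^+ (p n).+1).
have b0 n : 0 <= 8 * n%:R :> R by rewrite mulr_ge0.
have h1 n : L1 P (h n) by apply: L1Z; exact: L1_trace_gram.
have psd_gram n w : psd (short_gram X n (8 * n%:R) w).
  by apply: psd_sum => k _; exact: psd_rank1.
have h0 n w : 0 <= h n w.
  rewrite mulr_ge0 ?invr_ge0 ?exprn_ge0//.
  by apply: sumr_ge0 => i _; apply: psd_diag; exact: psd_exp.
have hc : \forall n \near \oo, mean P (h n) <= 4 * (n.+1%:R ^+ 2)^-1.
  near=> n.
  have n0 : (0 < n)%N by near: n; exact: nbhs_infty_gt.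
  have nR : 0 < n%:R :> R by rewrite ltr0n.
  rewrite (le_trans _ (expR_Nln2_le _ n0))//.
  set L := ln n%:R.
  have LA : 1 + p0%:R <= L by rewrite /L; near: n; exact: near_ln_ge.
  have L0 : 0 < L by rewrite (lt_le_trans _ LA)// ltr_pwDl.
  have sn0 : 0 < s n by rewrite !mulr_gt0.
  have y0 : 0 < dl * n%:R by rewrite mulr_gt0.
  have rec : n%:R * expR (8 * n%:R / (dl * n%:R)) <= dl * n%:R * p0%:R.
    rewrite -mulf_div divff ?gt_eqF// mulr1 [dl * _]mulrC -mulrA ler_wpM2l//.
  have t0 : mean P (fun w => \tr (short_gram X n (8 * n%:R) w ^+ 0)) <= n%:R.
    by under eq_fun do rewrite expr0 mxtrace1; rewrite mean_cst.
  have tp := moment_recursion_le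
    (t := fun q => mean P (fun w => \tr (short_gram X n (8 * n%:R) w ^+ q))) (ler0n _ n) y0 (b0 n) rec t0
    (mean_trace_gram_rec X_iid X_mean X_var X_moment4 n (b0 n)) (p n).+1.
  rewrite /h meanZ; last exact: L1_trace_gram.
  rewrite mulrC ler_pdivrMr ?exprn_gt0// (le_trans tp)//.
  have p4 : 4 * L <= (p n).+1%:R by rewrite ltW// truncnS_gt.
  have p4' : (p n)%:R <= 4 * L by rewrite truncn_le mulr_ge0// ltW.
  have yb : dl * n%:R * ((p n).+1 + p0)%:R <= s n * expR (-1).
    apply: (@le_trans _ _ (dl * n%:R * (6 * L))).
      by rewrite ler_wpM2l ?(ltW y0)// natrD -natr1; exact: order_le.
    by rewrite le_eqVlt; apply/orP; left; apply/eqP; rewrite /dl /s -/L; field.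
  apply: (@le_trans _ _ (n%:R * (s n * expR (-1)) ^+ (p n).+1)).
    by rewrite ler_wpM2l// lerXn2r ?nnegrE ?mulr_ge0 ?expR_ge0// ltW.
  rewrite exprMn mulrCA mulrC ler_wpM2r ?exprn_ge0// -expRM_natl.
  rewrite -[X in X * _](lnK nR) -expRD ler_expR -/L.
  exact: order_ge.
have c0 n : 0 <= 4 * (n.+1%:R ^+ 2)^-1 :> R by rewrite mulr_ge0// invr_ge0 sqr_ge0.
have cM N : \sum_(n < N) 4 * (n.+1%:R ^+ 2)^-1 <= 4 * 2 :> R.
  by rewrite -mulr_sumr ler_wpM2l// sum_inv_sqr_le.
have := borel_cantelli_mean h1 h0 c0 cM hc.
apply: filterS => w hw; near=> n; exists (p n).
have n1 : (1 < n)%N by near: n; exact: nbhs_infty_gt.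
have nR : 0 < n%:R :> R by rewrite ltr0n ltnW.
have L0 : 0 < ln n%:R :> R by rewrite ln_gt0// ltr1n.
have sn0 : 0 < s n by rewrite !mulr_gt0.
have : h n w < 1 by near: n.
by rewrite /h mulrC ltr_pdivrMr ?exprn_gt0// mul1r => /ltW.
Unshelve. all: by end_near. Qed.

(** Almost surely no column is cut for large n: its entries equal their truncations, whose squares
    sum to less than 8 n, so the two Gram matrices coincide. *)
Lemma gram_trace_small_upper_col e : 0 < e ->
  {ae P, forall w, \forall n \near \oo, exists p,
    \tr ((\sum_(k < n) (upper_col (raw w) n k)^T *m upper_col (raw w) n k) ^+ p.+1)
      <= (e * (n%:R * ln n%:R)) ^+ p.+1}.
Proof.
move=> e0; have h1 := gram_trace_small e0.
have h2 := columns_bounded X_iid X_mean X_var X_moment4.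
have h3 := entries_truncated X_iid X_moment4.
move: h1 h2 h3; apply: filterS3 => w h1 h2 h3; near=> n.
have [p hp] : exists p, \tr (short_gram X n (8 * n%:R) w ^+ p.+1) <=
  (e * (n%:R * ln n%:R)) ^+ p.+1 by near: n.
have b3 : forall i j, (i <= j < n)%N -> X i j w ^+ 2 <= n%:R by near: n.
have b2 : forall k, (k < n)%N -> \sum_(i < k) trunc n (X i k w) ^+ 2 < 8 * n%:R.
  by near: n.
exists p; apply: le_trans hp; rewrite le_eqVlt; apply/orP; left; apply/eqP.
congr (\tr (_ ^+ _)); apply: eq_bigr => k _; rewrite /short_col.
rewrite ifT// (le_trans _ (ltW (b2 k (ltn_ord k))))//.
apply: ler_sum => i _; rewrite trunc_id// b3// ltn_ord andbT.
exact: ltnW.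
Unshelve. all: by end_near. Qed.

Let trunc_row_sumE N i lo hi w :
  (forall i j, (i <= j < N)%N -> X i j w ^+ 2 <= N%:R) ->
  (i < N)%N -> (hi <= N)%N -> trunc_row_sum X N i lo hi w =
  \sum_(lo <= j < hi | j != i) sym_entry (raw w) i j.
Proof.
move=> b3 iN hiN; rewrite /trunc_row_sum /row_range big_filter.
rewrite big_seq_cond [RHS]big_seq_cond.
apply: eq_bigr => j; rewrite mem_index_iota => /andP[/andP[_ jhi] _].
have jN := leq_trans jhi hiN.
apply: trunc_id; rewrite /sentry /sym_entry.
by case: leqP => ij; apply: b3; rewrite ?ij// ltnW.
Qed.

Let row_sumE n i w :
  row_sum (raw w) n i = \sum_(0 <= j < n | j != i) sym_entry (raw w) i j.
Proof. by rewrite /row_sum big_mkord. Qed.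

(** The least k with n <= k^(p+1) works: the previous power lies below n, so k^(p+1) - n is at most
    the gap between the two. *)
Lemma power_above (p K : nat) : \forall n \near \oo, forall k0,
  (k0 ^ p.+1 < n)%N -> (K * p.+1 <= k0)%N ->
  exists k, [/\ (k0 <= k)%N, (n <= k ^ p.+1)%N & (K * (k ^ p.+1 - n) <= k ^ p.+1)%N].
Proof.
near=> n => k0 k0n Kk0.
have ex : exists k, (n <= k ^ p.+1)%N.
  by exists n; rewrite -{1}[n]expn1; case: (n) => // m; rewrite leq_pexp2l.
case: (ex_minnP ex) => k nk kmin; exists k.
have k0k : (k0 <= k)%N.
  rewrite leqNgt; apply/negP => kk0.
  have : (k ^ p.+1 <= k0 ^ p.+1)%N by rewrite leq_exp2r// ltnW.
  by rewrite leqNgt (leq_trans k0n nk).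
split=> //; case: k nk kmin k0k => [|k] nk kmin k0k.
  by rewrite exp0n// sub0n muln0.
have kn : (k ^ p.+1 < n)%N.
  by rewrite ltnNge; apply/negP => /kmin; rewrite ltnn.
apply: (@leq_trans (K * (p.+1 * k.+1 ^ p))).
  rewrite leq_mul2l (leq_trans _ (expn_succ_sub_le k p)) ?orbT//.
  by rewrite leq_sub2l// ltnW.
by rewrite mulnA [(k.+1 ^ p.+1)%N]expnS leq_mul2r (leq_trans Kk0 k0k) orbT.
Unshelve. all: by end_near. Qed.

(** The row sum up to n is the row sum up to the next power N minus the short range from n to N,
    both truncated at the level of N. *)
Lemma row_sums_upper e : 0 < e -> e <= 1 ->
  {ae P, forall w, \forall n \near \oo, forall i, (i < n)%N ->
    `|row_sum (raw w) n i| <= (1 + 5 * e) * Num.sqrt (2 * (n%:R * ln n%:R))}.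
Proof.
move=> e0 e1.
pose p := Num.truncn (2 / e : R).
have ep : 2 <= e * p.+1%:R.
  by rewrite -ler_pdivrMl// mulrC ltW// truncnS_gt.
have h1 := row_sums_along_powers X_iid X_mean X_var X_moment4 e0 ep.
have [K1 K10 h2] := short_row_sums X_iid X_mean X_var X_moment4 e0.
have h3 := entries_truncated X_iid X_moment4.
(* K >= K1 makes the range from n to N short, and K >= 1 + 1 / e gives N <= (1 + e) n. *)
pose K := (K1 + (Num.truncn (1 + e^-1)).+1)%N.
have K1K : (K1 <= K)%N by exact: leq_addr.
have KR : 1 + e^-1 <= K%:R :> R.
  by rewrite (le_trans (ltW (truncnS_gt _)))// ler_nat leq_addl.
move: h1 h2 h3; apply: filterS3 => w [k1 _ h1] [n2 _ h2] [n3 _ h3].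
pose k0 := (k1 + n2 + n3 + K * p.+1)%N.
near=> n => i iN.
have n0 : (0 < n)%N by near: n; exact: nbhs_infty_gt.
have nR : 0 < n%:R :> R by rewrite ltr0n.
have L1 : 1 <= ln n%:R :> R by near: n; exact: near_ln_ge.
have L0 : 0 <= ln n%:R :> R by rewrite (le_trans _ L1).
have k0n : (k0 ^ p.+1 < n)%N by near: n; exact: nbhs_infty_gt.
have [k [k0k nN KN]] : exists k, [/\ (k0 <= k)%N, (n <= k ^ p.+1)%N &
    (K * (k ^ p.+1 - n) <= k ^ p.+1)%N].
  have pa : forall k0, (k0 ^ p.+1 < n)%N -> (K * p.+1 <= k0)%N ->
    exists k, [/\ (k0 <= k)%N, (n <= k ^ p.+1)%N & (K * (k ^ p.+1 - n) <= k ^ p.+1)%N].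
    by near: n; exact: power_above.
  by apply: pa => //; rewrite /k0 leq_addl.
set N := (k ^ p.+1)%N in nN KN *.
have NR : 0 < N%:R :> R by rewrite ltr0n (leq_trans n0).
have kN : (k <= N)%N.
  by rewrite /N; case: (k) => // m; rewrite -{1}[m.+1]expn1 leq_pexp2l.
have k1k : (k1 <= k)%N by rewrite (leq_trans _ k0k)// /k0 -!addnA leq_addr.
have n2N : (n2 <= N)%N.
  by rewrite (leq_trans _ kN)// (leq_trans _ k0k)// /k0 -addnA addnAC leq_addl.
have n3N : (n3 <= N)%N.
  by rewrite (leq_trans _ kN)// (leq_trans _ k0k)// /k0 addnAC leq_addl.
have iNN := leq_trans iN nN.
have tr := h3 N n3N.
have b1 := h1 k k1k i iNN; rewrite -/N in b1.
have b2 : `|trunc_row_sum X N i n N w| < e * Num.sqrt (N%:R * ln N%:R).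
  by apply: h2 => //; rewrite (leq_trans _ KN)// leq_mul2r K1K orbT.
rewrite (trunc_row_sumE 0 tr iNN (leqnn N)) in b1.
rewrite (trunc_row_sumE n tr iNN (leqnn N)) in b2.
have split_sum : row_sum (raw w) n i =
    \sum_(0 <= j < N | j != i) sym_entry (raw w) i j -
    \sum_(n <= j < N | j != i) sym_entry (raw w) i j.
  by rewrite row_sumE [X in _ = X - _](big_cat_nat (n := n))//= addrK.
have lnN0 : 0 <= ln N%:R :> R by exact: ln_ge0_nat.
have NL : N%:R * ln N%:R <= (1 + e) ^+ 2 * (n%:R * ln n%:R) :> R.
  have Nn : N%:R <= (1 + e) * n%:R.
    have : K%:R * (N%:R - n%:R) <= N%:R :> R by rewrite -natrB// -natrM ler_nat.
    move=> hK; have hN : 0 <= N%:R - n%:R :> R by rewrite subr_ge0 ler_nat.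
    have h' := le_trans (ler_wpM2r hN KR) hK.
    have h'' : (e * (1 + e^-1)) * (N%:R - n%:R) <= e * N%:R.
      by rewrite -mulrA ler_wpM2l// ltW.
    have ee : e * (1 + e^-1) = e + 1 by rewrite mulrDr mulr1 divff ?gt_eqF.
    rewrite ee in h''.
    exact: ratio_bound h''.
  have lnn : ln N%:R <= (1 + e) * ln n%:R.
    apply: (@le_trans _ _ (ln ((1 + e) * n%:R))).
      by rewrite ler_ln ?posrE// mulr_gt0// ltr_pwDl// ltW.
    rewrite lnM ?posrE ?ltr_pwDl ?(ltW e0)// mulrDl mul1r addrC lerD2l.
    (* log(1 + e) <= e <= e log n. *)
    rewrite (le_trans (y := e))//; last by rewrite ler_peMr// ltW.
    by rewrite -ler_expR lnK ?posrE ?ltr_pwDl ?(ltW e0)// expR_ge1Dx.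
  rewrite (le_trans (ler_pM _ _ Nn lnn))// le_eqVlt; apply/orP; left; apply/eqP; ring.
have sq : Num.sqrt (2 * (N%:R * ln N%:R)) <= (1 + e) * Num.sqrt (2 * (n%:R * ln n%:R)).
  have -> : 1 + e = Num.sqrt ((1 + e) ^+ 2) by rewrite sqrtr_sqr ger0_norm// addr_ge0// ltW.
  by rewrite -sqrtrM ?sqr_ge0// ler_wsqrtr// [leRHS]mulrCA ler_wpM2l.
have sq' : Num.sqrt (N%:R * ln N%:R) <= Num.sqrt (2 * (N%:R * ln N%:R)) :> R.
  by rewrite ler_wsqrtr// ler_peMl ?mulr_ge0// ler1n.
rewrite split_sum (le_trans (ler_normB _ _))//.
apply: (le_trans (lerD (ltW b1) (ltW b2))).
apply: (@le_trans _ _ ((1 + 2 * e) * Num.sqrt (2 * (N%:R * ln N%:R)))).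
  rewrite (_ : 1 + 2 * e = 1 + e + e); last by ring.
  by rewrite [leRHS]mulrDl lerD2l ler_wpM2l// ltW.
apply: (le_trans (ler_wpM2l _ sq)); first by rewrite addr_ge0// mulr_ge0// ltW.
by rewrite [leLHS]mulrA ler_wpM2r ?sqrtr_ge0// upper_factor// ltW.
Unshelve. all: by end_near. Qed.

(** The part of some row beyond column n / K is large, and the part before that column is a short
    range, too small to cancel it. *)
Lemma row_sums_lower e : 0 < e -> e <= 4^-1 ->
  {ae P, forall w, \forall n \near \oo, exists2 i, (i < n)%N &
    (1 - 4 * e) * Num.sqrt (2 * (n%:R * ln n%:R)) <= `|row_sum (raw w) n i|}.
Proof.
move=> e0 e4.
have [K1 K10 h2] := short_row_sums X_iid X_mean X_var X_moment4 e0.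
pose K := (K1 + (Num.truncn (8 / e ^+ 2)).+1)%N.
have KR : 8 <= K%:R * e ^+ 2 :> R.
  rewrite -ler_pdivrMr ?exprn_gt0// (le_trans (ltW (truncnS_gt _)))//.
  by rewrite ler_nat leq_addl.
have h1 := exists_large_row_sum X_iid X_mean X_var X_moment4 e0 e4 KR.
have h3 := entries_truncated X_iid X_moment4.
move: h1 h2 h3; apply: filterS3 => w h1 h2 h3; near=> n.
have [i im big] : exists2 i, (i < n %/ K)%N &
    (1 - 3 * e) * Num.sqrt (2 * (n%:R * ln n%:R)) <
    trunc_row_sum X n i (n %/ K) n w by near: n.
have mn : (n %/ K <= n)%N by exact: leq_div.
have iN := leq_trans im mn.
have tr : forall i j, (i <= j < n)%N -> X i j w ^+ 2 <= n%:R by near: n.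
have small : `|trunc_row_sum X n i 0 (n %/ K) w| < e * Num.sqrt (n%:R * ln n%:R).
  have : forall i lo hi, (i < n)%N -> (hi <= n)%N -> (K1 * (hi - lo) <= n)%N ->
    `|trunc_row_sum X n i lo hi w| < e * Num.sqrt (n%:R * ln n%:R) by near: n.
  apply => //; rewrite subn0 (leq_trans _ (leq_divM n K))//.
  by rewrite mulnC leq_mul2l leq_addr orbT.
exists i => //.
rewrite (trunc_row_sumE 0 tr iN mn) in small.
rewrite (trunc_row_sumE (n %/ K) tr iN (leqnn n)) in big.
rewrite row_sumE (big_cat_nat (n := (n %/ K)%N))//=.
apply: le_trans (ler_norm _).
have sq' : Num.sqrt (n%:R * ln n%:R) <= Num.sqrt (2 * (n%:R * ln n%:R)) :> R.
  by rewrite ler_wsqrtr// ler_peMl ?mulr_ge0// ler1n.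
move: small; rewrite ltr_norml => /andP[small _].
have := ler_wpM2l (ltW e0) sq' => sq''.
exact: lower_factor big small sq''.
Unshelve. all: by end_near. Qed.

End assembly.

Theorem theorem1p5 (R : realType) (d : measure_display) (T : measurableType d)
    (P : probability T R) (X : nat -> nat -> {RV P >-> R})
    (X_iid : iid [set ij : nat * nat | (ij.1 <= ij.2)%N]
                 (fun ij => X ij.1 ij.2))
    (X_mean : ('E_P[X 0%N 1%N] = 0)%E)
    (X_var : ('V_P[X 0%N 1%N] = 1)%E)
    (X_moment4 : ('E_P[fun w => (X 0%N 1%N w ^+ 4)%R] < +oo)%E) :
  {ae P, forall w,
    (fun n : nat =>
       spectral_norm (markov_mx (fun i j => X i j w) n)
         / Num.sqrt (2 * n%:R * ln n%:R)) @ \oo --> (1 : R)}.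
Proof.
have iidX : iid upper_pairs (entry X) by exact: X_iid.
pose f w n := spectral_norm (markov_mx (fun i j => X i j w) n) / Num.sqrt (2 * n%:R * ln n%:R).
(* Starting at 1 / 4 keeps every level within the range allowed by the lower bound on row sums. *)
pose e m : R := m.+4%:R^-1.
have e0 m : 0 < e m by rewrite invr_gt0.
have e4 m : e m <= 4^-1 by rewrite lef_pV2 ?posrE// ler_nat.
have key m : {ae P, forall w, \forall n \near \oo, `|1 - f w n| <= 6 * e m}.
  have e1 : e m <= 1 by rewrite (le_trans (e4 m))// invf_le1 ?ler1n.
  (* Twice the square root of (e^2 / 2) n log n is e sqrt(2 n log n). *)
  have ee0 : 0 < e m ^+ 2 / 2 by rewrite divr_gt0// exprn_gt0.
  have h1 := row_sums_upper iidX X_mean X_var X_moment4 (e0 m) e1.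
  have h2 := row_sums_lower iidX X_mean X_var X_moment4 (e0 m) (e4 m).
  have h3 := gram_trace_small_upper_col iidX X_mean X_var X_moment4 ee0.
  move: h1 h2 h3; apply: filterS3 => w h1 h2 h3; near=> n.
  have n1 : (1 < n)%N by near: n; exact: nbhs_infty_gt.
  have nR : 0 < n%:R :> R by rewrite ltr0n ltnW.
  have L0 : 0 < ln n%:R :> R by rewrite ln_gt0// ltr1n.
  rewrite /f -mulrA; set S := Num.sqrt _.
  have S0 : 0 < S by rewrite sqrtr_gt0 !mulr_gt0.
  have up : forall i, (i < n)%N -> `|row_sum (fun i j => X i j w) n i| <= (1 + 5 * e m) * S.
    by rewrite /S; near: n.
  have [i iN low] : exists2 i, (i < n)%N &
    (1 - 4 * e m) * S <= `|row_sum (fun i j => X i j w) n i| by rewrite /S; near: n.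
  have [p tr] : exists p,
    \tr ((\sum_(k < n) (upper_col (fun i j => X i j w) n k)^T *m upper_col (fun i j => X i j w) n k) ^+ p.+1)
      <= (e m ^+ 2 / 2 * (n%:R * ln n%:R)) ^+ p.+1 by near: n.
  have K0 : 0 <= e m ^+ 2 / 2 * (n%:R * ln n%:R) by rewrite ltW// !mulr_gt0.
  have /andP[lo hi] := markov_norm_bounds (Ordinal iN) K0 tr up.
  have KS : 2 * Num.sqrt (e m ^+ 2 / 2 * (n%:R * ln n%:R)) = e m * S.
    rewrite /S -[X in X * _ = _](ger0_norm (ler0n _ 2)) -[X in _ = X * _](ger0_norm (ltW (e0 m))).
    rewrite -!sqrtr_sqr -!sqrtrM ?sqr_ge0//.
    by congr Num.sqrt; field.
  rewrite KS in hi.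
  have {}low := le_trans low lo.
  set s := spectral_norm _ in low hi *.
  have -> : 1 - s / S = (S - s) / S by rewrite mulrBl divff ?gt_eqF.
  rewrite normrM normfV (gtr0_norm S0) ler_pdivrMr//.
  by apply: distance_le => //; rewrite mulr_ge0// ltW.
(* Countably many error levels share one null set. *)
have := ae_foralln key; apply: filterS => w h.
apply/cvgrPdist_le => eps eps0.
have em : 6 * e (Num.truncn (6 / eps)) <= eps.
  rewrite ler_pdivrMr// mulrC -ler_pdivrMr// (le_trans (ltW (truncnS_gt _)))//.
  by rewrite ler_nat; do 3 apply: leqW.
by apply: filterS (h (Num.truncn (6 / eps))) => n /le_trans; apply.
Unshelve. all: by end_near. Qed.
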